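(* Let $G=\langle a,b \mid a^8=b^2=1,\ bab^{-1}=a^5\rangle$ be the group of order $16$ which is the semidirect product $\mathbb{Z}/8\rtimes\mathbb{Z}/2$ whose centre is cyclic of order $4$, and let $r_2,r_3$ (one-dimensional real representations) and $r_8$ (a $4$-dimensional real representation of complex type) be the representations described in the context. Write $H^*(G)=H^*(BG,\mathbb{F}_2)$. Then there is a class $x\in H^3(G)$, which does not belong to the subring of $H^*(G)$ generated by the Stiefel-Whitney classes of the real representations of $G$, such that $H^*(G)$ is generated as an $\mathbb{F}_2$-algebra by $w_1(r_2)$, $w_1(r_3)$, $w_4(r_8)$ and $x$, and the ideal of relations between these generators is generated by $$w_1(r_2)^2+w_1(r_3)^2=0,\qquad w_1(r_2)^2w_1(r_3)+w_1(r_2)w_1(r_3)^2=0,$$ $$w_1(r_2)x+w_1(r_3)x=0,\qquad x^2=0.$$ Moreover $$Sq^1(w_4(r_8))=0,\qquad Sq^2(w_4(r_8))=w_4(r_8)w_1(r_2)w_1(r_3),\qquad Sq^3(w_4(r_8))=0.$$ Finally, the element $x$ can be taken to be the generator denoted $x$ in Carlson's presentation of $H^*(G)$ (recalled in the context).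
   Context: For a real representation $r:G\to O(n)$ of a finite group $G$, $w_j(r)\in H^j(BG,\mathbb{F}_2)$ denotes its $j$-th Stiefel-Whitney class, i.e. the pull-back of the universal class $w_j\in H^j(BO(n),\mathbb{F}_2)$ under $Br:BG\to BO(n)$. $Sq^k$ denotes the Steenrod squares. An irreducible real representation $V$ is of complex type when $\mathrm{End}_G(V)\cong\mathbb{C}$. The representations: $r_2$ and $r_3$ are the two one-dimensional real representations of $G$ that are nontrivial on $b$, namely $a\mapsto 1,\ b\mapsto -1$ and $a\mapsto -1,\ b\mapsto -1$ (in either order); their product $r_1=r_2\otimes r_3$ ($a\mapsto -1$, $b\mapsto 1$) is the remaining nontrivial one. $G$ has exactly two irreducible complex representations of dimension $2$, which are complex conjugate to each other; $r_8$ is the $4$-dimensional irreducible real representation underlying either of them. Carlson's presentation: $H^*(G)=\mathbb{F}_2[z,y,x,w]/(z^2,\ zy^2,\ zx,\ x^2)$ with $|z|=|y|=1$, $|x|=3$, $|w|=4$. *)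

(* Defs.v *)
From HB Require Import structures.
From mathcomp Require Import all_boot all_order all_algebra all_fingroup all_character.
From mathcomp Require Import generic_quotient ring_quotient.
From mathcomp Require Import all_classical reals topology complex mpoly.
From mathcomp Require normed_module matrix_normedtype.
From mathcomp Require Import ring zify.

Set Implicit Arguments.
Unset Strict Implicit.
Unset Printing Implicit Defensive.

Import GRing.Theory Num.Theory.
(* normed_module itself cannot be imported together with mpoly. *)
Import normed_module.numFieldNormedType.Exports.
Local Open Scope ring_scope.
Local Open Scope quotient_scope.

(* Simplices are acted upon by all maps of vertices, not only the monotone
   ones; the simplicial models of BG and BO(n) used below have this extra
   symmetry, and cohomology only involves the monotone maps.  The chosen
   vertex records nonemptiness; it need not be preserved by maps.             *)
Record sset := SSet {
  simplex : nat -> Type;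
  vertex : simplex 0;
  act : forall m n, ('I_m.+1 -> 'I_n.+1) -> simplex n -> simplex m;
  act_id : forall n (s : simplex n), act id s = s;
  act_comp : forall l m n (f : 'I_l.+1 -> 'I_m.+1) (g : 'I_m.+1 -> 'I_n.+1)
    (s : simplex n), act (g \o f) s = act f (act g s) }.

Record smap (X Y : sset) := SMap {
  smap_fun :> forall n, simplex X n -> simplex Y n;
  smap_act : forall m n (f : 'I_m.+1 -> 'I_n.+1) (s : simplex X n),
    smap_fun (act f s) = act f (smap_fun s) }.

Definition simplices (X : sset) := {n & simplex X n}.

(* The face of s spanned by a nonempty list of its vertices. *)
Definition face (X : sset) n (s : simplex X n) (e : seq 'I_n.+1) : simplices X :=
  existT (simplex X) (size e).-1
    (act (fun i : 'I_(size e).-1.+1 => nth ord0 e i) s).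

Definition cochain (X : sset) := simplices X -> 'F_2.

Definition coboundary (X : sset) (f : cochain X) : cochain X :=
  fun x => let: existT n s := x in
  if (0 < n)%N then \sum_(k < n.+1) f (face s (rem k (enum 'I_n.+1))) else 0.

(* All ways of cutting e at m of its elements u_1 < ... < u_m into m + 1
   consecutive blocks, u_k belonging to both of the blocks that it separates:
   the pairs (A, B) where A is the union of the 1st, 3rd, 5th... blocks and B the
   union of the others (the other way round if b is true).                    *)
Fixpoint blocks (T : Type) (m : nat) (b : bool) (e : seq T) :
    seq (seq T * seq T) :=
  match e with
  | [::] => if m is 0 then [:: ([::], [::])] else [::]
  | v :: e' =>
      [seq (if b then (p.1, v :: p.2) else (v :: p.1, p.2)) | p <- blocks m b e']
      ++ (if m is m'.+1
          then [seq (v :: p.1, v :: p.2) | p <- blocks m' (~~ b) e'] else [::])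
  end.

(* Steenrod's cup-i product; for i = 0 there is a single cut, the blocks are
   the front and back faces and this is the Alexander-Whitney cup product.    *)
Definition cupi (X : sset) (i : nat) (f g : cochain X) : cochain X :=
  fun x => let: existT n s := x in
  \sum_(p <- blocks i.+1 false (enum 'I_n.+1)) f (face s p.1) * g (face s p.2).

Definition cochain1 (X : sset) : cochain X := fun x => (tag x == 0%N)%:R.

Definition component (X : sset) (n : nat) (f : cochain X) : cochain X :=
  fun x => if tag x == n then f x else 0.

(* On a degree n cochain f this is the cup-(n - k) square of f if k <= n, and 0
   otherwise; it is extended to inhomogeneous cochains componentwise.         *)
Definition sq_cochain (X : sset) (k : nat) (f : cochain X) : cochain X :=
  fun x => let f_n := component (tag x - k) f in
  if (k.*2 <= tag x)%N then cupi (tag x - k.*2) f_n f_n x else 0.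

Definition bounded (X : sset) (f : cochain X) :=
  exists N, forall x, (N <= tag x)%N -> f x = 0.

Section Combinatorics.

Lemma addF2 (x : 'F_2) : x + x = 0.
Proof. exact/addrr_pchar2/pchar_Fp. Qed.

Lemma oppF2 (x : 'F_2) : - x = x.
Proof. by apply/eqP; rewrite eq_sym -subr_eq0 opprK addF2. Qed.

(* The lists obtained by deleting one element of e. *)
Fixpoint dels (T : Type) (e : seq T) : seq (seq T) :=
  if e is v :: e' then e' :: map (cons v) (dels e') else [::].

Lemma rem_dels (T : eqType) (e : seq T) (F : seq T -> 'F_2) : uniq e ->
  \sum_(k <- e) F (rem k e) = \sum_(t <- dels e) F t.
Proof.
elim: e F => [|v e IH] F; first by rewrite !big_nil.
move=> /= /andP[ve ue]; rewrite !big_cons eqxx big_map -(IH (F \o cons v)) //.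
congr (_ + _); rewrite !big_seq; apply: eq_bigr => k ke /=.
by case: eqP => // vk; rewrite vk ke in ve.
Qed.

Lemma dels_map (T U : Type) (h : T -> U) e :
  dels (map h e) = map (map h) (dels e).
Proof.
elim: e => //= v e ->; congr (_ :: _); rewrite -!map_comp.
exact: eq_map.
Qed.

Lemma size_dels (T : eqType) (e t : seq T) : t \in dels e -> size t = (size e).-1.
Proof.
elim: e t => //= v e IH t; rewrite inE => /predU1P[->//|/mapP[t' t'e ->]] /=.
by rewrite (IH _ t'e); case: e t'e {IH}.
Qed.

Lemma blocks_map (T U : Type) (h : T -> U) m b e :
  blocks m b (map h e) = [seq (map h p.1, map h p.2) | p <- blocks m b e].
Proof.
elim: e m b => [[|m] b|v e IH m b] //=; rewrite map_cat -!map_comp IH.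
congr (_ ++ _).
  by rewrite -map_comp; apply: eq_map => -[p q]; case: b.
by case: m => // m; rewrite IH -!map_comp; apply: eq_map.
Qed.

Lemma size_blocks (T : eqType) m b (e : seq T) p : p \in blocks m b e ->
  (size p.1 + size p.2)%N = (size e + m)%N.
Proof.
elim: e m b p => [[|m] b p|v e IH m b p] /=; rewrite ?inE //; first by move/eqP->.
rewrite mem_cat => /orP[/mapP[q qe ->]|].
  by have := IH _ _ _ qe; case: b {qe} => /= qe; rewrite ?addnS addSn qe.
case: m => // m /mapP[q qe ->] /=.
by rewrite addSn addnS (IH _ _ _ qe) addSn addnS.
Qed.

Lemma blocks_neq0 (T : eqType) m b (e : seq T) p : p \in blocks m.+1 b e ->
  (p.1 != [::]) && (p.2 != [::]).
Proof.
elim: e m b p => [|v e IH] m b p //=.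
rewrite mem_cat => /orP[/mapP[q qe ->]|/mapP[q qe ->]//].
by have /andP[q1 q2] := IH _ _ _ qe; case: b {qe} => /=; rewrite ?q1 ?q2.
Qed.

Lemma blocks_swap (T : Type) m b (e : seq T) :
  blocks m (~~ b) e = [seq (p.2, p.1) | p <- blocks m b e].
Proof.
elim: e m b => [[|m] b|v e IH m b] //=; rewrite map_cat -!map_comp IH.
congr (_ ++ _).
  by rewrite -map_comp; apply: eq_map => -[p q]; case: b.
by case: m => // m; rewrite IH -!map_comp; apply: eq_map.
Qed.

Lemma blocks0 (T : Type) b (e : seq T) :
  blocks 0 b e = [:: if b then ([::], e) else (e, [::])].
Proof. by elim: e b => [|v e IH] [] //=; rewrite IH. Qed.

Lemma dels_blocks (T : Type) m b (e : seq T) (F : seq T -> seq T -> 'F_2) :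
  \sum_(t <- dels e) \sum_(p <- blocks m b t) F p.1 p.2 =
  \sum_(p <- blocks m b e) (\sum_(t <- dels p.1) F t p.2 +
                            \sum_(t <- dels p.2) F p.1 t) +
  (if m is m'.+1 then \sum_(p <- blocks m' b e) F p.1 p.2 +
                      \sum_(p <- blocks m' (~~ b) e) F p.1 p.2 else 0).
Proof.
pose S k c w (G : seq T -> seq T -> 'F_2) := \sum_(p <- blocks k c w) G p.1 p.2.
pose d (G : seq T -> seq T -> 'F_2) x y : 'F_2 :=
  \sum_(t <- dels x) G t y + \sum_(t <- dels y) G x t.
rewrite -[RHS]/(S m b e (d F) +
  (if m is m'.+1 then S m' b e F + S m' (~~ b) e F else 0)).
elim: e m b F => [|v e IH] m b F.
  rewrite /S /= big_nil; case: m => [|m]; first by rewrite big_seq1 /d !big_nil !addr0.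
  by rewrite big_nil add0r; case: m => [|m]; rewrite ?big_seq1 ?big_nil ?addF2.
pose Fb (c : bool) x y := if c then F x (v :: y) else F (v :: x) y.
pose FW x y := F (v :: x) (v :: y).
have S_cons k c G w : S k c (v :: w) G =
    S k c w (fun x y => if c then G x (v :: y) else G (v :: x) y) +
    (if k is k'.+1 then S k' (~~ c) w (fun x y => G (v :: x) (v :: y)) else 0).
  rewrite /S /= big_cat big_map /=; congr (_ + _).
    by apply: eq_bigr => p _; case: c.
  by case: k => [|k]; rewrite ?big_nil // big_map.
have SD k c w G G' : S k c w (fun x y => G x y + G' x y) = S k c w G + S k c w G'.
  exact: big_split.
have eqS k c w G G' : (forall x y, G x y = G' x y) -> S k c w G = S k c w G'.
  by move=> GG'; apply: eq_bigr.
rewrite [dels _]/= big_cons big_map -/(S m b e F).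
under eq_bigr do rewrite -/(S m b (v :: _) F) S_cons -/(Fb b).
rewrite big_split /= (IH m b (Fb b)) S_cons.
rewrite (eqS _ _ _ (fun x y => if b then d F x (v :: y) else d F (v :: x) y)
  (fun x y => F x y + d (Fb b) x y)); last first.
  move=> x y; rewrite /d /Fb; case: b => /=; rewrite big_cons big_map /=.
    by rewrite addrCA.
  by rewrite addrA.
rewrite SD -!addrA; congr (_ + (_ + _)).
case: m => [|m]; first by rewrite big1 ?addr0.
rewrite -/FW (IH m (~~ b) FW) negbK !S_cons negbK -/(Fb b) -/(Fb (~~ b)) -/FW.
rewrite (eqS _ _ _ (fun x y => d F (v :: x) (v :: y))
  (fun x y => Fb b x y + (Fb (~~ b) x y + d FW x y))); last first.
  move=> x y; rewrite /d /FW /Fb /= !big_cons !big_map /=.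
  by case: b => /=; ring.
rewrite (SD _ _ _ (Fb b)) (SD _ _ _ (Fb (~~ b))).
set a5 := (if m is _.+1 then _ else _).
set a6 := (if m is _.+1 then _ else _).
set a7 := (if m is _.+1 then _ else _).
have -> : a5 = a6 + a7 by rewrite /a5 /a6 /a7; case: (m) => *; rewrite ?addr0 // addrC.
set a3 := S m (~~ b) e (Fb (~~ b)).
rewrite [RHS](_ : _ = S m b e (Fb b) + (S m (~~ b) e (Fb b) +
  (S m (~~ b) e (d FW) + (a6 + a7))) + (a3 + a3)); last by ring.
by rewrite addF2 addr0; ring.
Qed.

Lemma dels_dels (T : Type) (e : seq T) (F : seq T -> 'F_2) :
  \sum_(t <- dels e) \sum_(u <- dels t) F u = 0.
Proof.
elim: e F => [|v e IH] F; first by rewrite big_nil.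
rewrite /= big_cons big_map /=.
under [X in _ + X]eq_bigr do rewrite big_cons big_map.
by rewrite big_split /= addrA addF2 add0r (IH (F \o cons v)).
Qed.

Lemma blocks1_cons (T : Type) v (e : seq T) (F : seq T -> seq T -> 'F_2) :
  \sum_(p <- blocks 1 false (v :: e)) F p.1 p.2 =
  \sum_(p <- blocks 1 false e) F (v :: p.1) p.2 + F [:: v] (v :: e).
Proof. by rewrite /= blocks0 big_cat big_map /= big_seq1. Qed.

Lemma blocks1_assoc (T : Type) (e : seq T) (F : seq T -> seq T -> seq T -> 'F_2) :
  \sum_(p <- blocks 1 false e) \sum_(q <- blocks 1 false p.1) F q.1 q.2 p.2 =
  \sum_(p <- blocks 1 false e) \sum_(q <- blocks 1 false p.2) F p.1 q.1 q.2.
Proof.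
elim: e F => [|v e IH] F; first by rewrite !big_nil.
rewrite (blocks1_cons _ _ (fun a c => \sum_(q <- blocks 1 false a) F q.1 q.2 c)).
rewrite (blocks1_cons _ _ (fun a c => \sum_(q <- blocks 1 false c) F a q.1 q.2)).
rewrite (blocks1_cons v [::] (fun a b => F a b (v :: e))).
rewrite (blocks1_cons v e (F [:: v])) big_nil add0r.
under eq_bigr do rewrite (blocks1_cons _ _ (fun a c => F a c _)).
by rewrite big_split /= (IH (fun a b c => F (v :: a) b c)) addrA.
Qed.

Lemma blocks1_unitl (T : eqType) (e : seq T) (F : seq T -> 'F_2) : e != [::] ->
  \sum_(p <- blocks 1 false e) (size p.1 == 1%N)%:R * F p.2 = F e.
Proof.
case: e => // v e _.
rewrite (blocks1_cons _ _ (fun a c => (size a == 1%N)%:R * F c)) mul1r.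
rewrite big_seq big1 ?add0r // => p /blocks_neq0/andP[p1 _].
by rewrite /= eqSS size_eq0 (negPf p1) mul0r.
Qed.

Lemma blocks1_unitr (T : eqType) (e : seq T) (F : seq T -> 'F_2) : e != [::] ->
  \sum_(p <- blocks 1 false e) F p.1 * (size p.2 == 1%N)%:R = F e.
Proof.
elim: e F => // v e IH F _.
rewrite (blocks1_cons _ _ (fun a c => F a * (size c == 1%N)%:R)).
have [->|e0] := eqVneq e [::]; first by rewrite big_nil add0r mulr1.
rewrite (IH (F \o cons v)) //=.
by rewrite eqSS size_eq0 (negPf e0) mulr0 addr0.
Qed.

End Combinatorics.

Section Cochains.
Variable X : sset.
Implicit Types (f g h : cochain X) (x : simplices X).

Lemma existT_act n (s : simplex X n) m m' (a : 'I_m.+1 -> 'I_n.+1)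
    (a' : 'I_m'.+1 -> 'I_n.+1) :
  m = m' -> (forall (i : 'I_m.+1) (j : 'I_m'.+1), i = j :> nat -> a i = a' j) ->
  existT (simplex X) m (act a s) = existT (simplex X) m' (act a' s).
Proof.
move=> mm'; case: m' / mm' a' => a' aa'.
by congr (existT _ _ (act _ s)); apply: funext => i; apply: aa'.
Qed.

Lemma face_face n (s : simplex X n) e (t : seq 'I_(size e).-1.+1) :
  t != [::] -> face (projT2 (face s e)) t = face s [seq nth ord0 e (val i) | i <- t].
Proof.
move=> t0; rewrite /face /= -act_comp; apply: existT_act.
  by rewrite size_map.
move=> i j ij /=; rewrite (nth_map ord0) ?ij //.
by rewrite -ij (leq_trans (ltn_ord i)) // prednK // lt0n size_eq0.
Qed.

Lemma face_enum n (s : simplex X n) : face s (enum 'I_n.+1) = existT _ n s.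
Proof.
rewrite -[s in RHS]act_id; apply: existT_act; first by rewrite size_enum_ord.
move=> i j ij; apply: val_inj => /=.
by rewrite nth_enum_ord ij // (ltn_ord j).
Qed.

Lemma map_nth_enum n (e : seq 'I_n.+1) : e != [::] ->
  [seq nth ord0 e (val i) | i <- enum 'I_(size e).-1.+1] = e.
Proof.
move=> e0; apply: (@eq_from_nth _ ord0).
  by rewrite size_map size_enum_ord prednK // lt0n size_eq0.
move=> i; rewrite size_map => ie; rewrite (nth_map ord0) //=.
by rewrite nth_enum_ord // -[X in (_ < X)%N](size_enum_ord (size e).-1.+1).
Qed.

Definition eval_face f n (s : simplex X n) (e : seq 'I_n.+1) : 'F_2 :=
  if e is [::] then 0 else f (face s e).

Lemma eval_face_face f n (s : simplex X n) e t :
  eval_face f (projT2 (face s e)) t = eval_face f s [seq nth ord0 e (val i) | i <- t].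
Proof. by case: t => // v t; rewrite /eval_face face_face. Qed.

Lemma eval_faceE f n (s : simplex X n) e : e != [::] ->
  f (face s e) = eval_face f s e.
Proof. by case: e. Qed.

Lemma eval_faceD f g n (s : simplex X n) e :
  eval_face (f + g) s e = eval_face f s e + eval_face g s e.
Proof. by case: e => [|v e]; rewrite ?addr0. Qed.

Lemma coboundary_face f n (s : simplex X n) e : e != [::] ->
  coboundary f (face s e) = \sum_(t <- dels e) eval_face f s t.
Proof.
move=> e0; rewrite -[e in RHS](map_nth_enum e0) dels_map big_map.
under eq_bigr do rewrite -eval_face_face.
rewrite -rem_dels ?enum_uniq // -[LHS]/(if (0 < (size e).-1)%N then
  \sum_(k < (size e).-1.+1) f (face (projT2 (face s e)) (rem k (enum _))) else 0).
rewrite big_enum /=; have [e1|e1] := ltnP; last first.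
  have n1 : (size e).-1 = 0%N by apply/eqP; rewrite -leqn0.
  apply/esym/big1 => k _; rewrite [rem _ _](_ : _ = [::]) //.
  apply/eqP; rewrite -size_eq0 size_rem ?mem_enum // size_enum_ord /=.
  by rewrite n1.
apply: eq_bigr => k _; rewrite eval_faceE //.
by rewrite -size_eq0 size_rem ?mem_enum // size_enum_ord /= -lt0n.
Qed.

Lemma cupi_eval i f g n (s : simplex X n) e :
  eval_face (cupi i f g) s e =
  \sum_(p <- blocks i.+1 false e) eval_face f s p.1 * eval_face g s p.2.
Proof.
have [->|e0] := eqVneq e [::]; first by rewrite big_nil.
rewrite -eval_faceE // -[e in RHS](map_nth_enum e0) blocks_map big_map /=.
rewrite !big_seq; apply: eq_bigr => p /blocks_neq0/andP[p1 p2] /=.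
by rewrite -!eval_face_face !eval_faceE.
Qed.

Lemma cochainP f g :
  (forall n (s : simplex X n) e, e != [::] -> f (face s e) = g (face s e)) -> f = g.
Proof.
move=> fg; apply: funext => -[n s]; rewrite -face_enum fg //.
by rewrite -size_eq0 size_enum_ord.
Qed.

Lemma eval_coboundary f n (s : simplex X n) e :
  eval_face (coboundary f) s e = \sum_(t <- dels e) eval_face f s t.
Proof.
have [->|e0] := eqVneq e [::]; first by rewrite big_nil.
by rewrite -eval_faceE // coboundary_face.
Qed.

Lemma cupi_coboundary i f g : coboundary (cupi i f g) =
  cupi i (coboundary f) g + cupi i f (coboundary g) +
  (if i is j.+1 then cupi j f g + cupi j g f else 0).
Proof.
apply: cochainP => n s e e0; rewrite coboundary_face //.
under eq_bigr do rewrite cupi_eval.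
rewrite (dels_blocks _ _ _ (fun a b => eval_face f s a * eval_face g s b)).
rewrite [RHS]eval_faceE // !eval_faceD !cupi_eval -big_split; congr (_ + _).
  apply: eq_bigr => p _ /=.
  by rewrite !eval_coboundary mulr_suml mulr_sumr.
case: i => [|i].
  rewrite !blocks0 !big_seq1 /= mulr0 mul0r addr0.
  by case: (e) => [|? ?].
rewrite eval_faceD !cupi_eval; congr (_ + _).
rewrite blocks_swap big_map.
by apply: eq_bigr => p _; rewrite mulrC.
Qed.

HB.instance Definition _ := GRing.Zmodule.on (cochain X).

Lemma coboundaryK f : coboundary (coboundary f) = 0.
Proof.
apply: cochainP => n s e e0; rewrite coboundary_face //.
by under eq_bigr do rewrite eval_coboundary; rewrite dels_dels.
Qed.

Lemma coboundaryD f g : coboundary (f + g) = coboundary f + coboundary g.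
Proof.
apply: cochainP => n s e e0; rewrite [RHS]eval_faceE // eval_faceD.
rewrite coboundary_face // !eval_coboundary -big_split.
by apply: eq_bigr => t _; rewrite eval_faceD.
Qed.

Lemma coboundary0 : coboundary (0 : cochain X) = 0.
Proof. by apply: (addIr (coboundary 0)); rewrite -coboundaryD !add0r. Qed.

Lemma coboundary_local f g x :
  (forall y, (tag y).+1 = tag x -> f y = g y) -> coboundary f x = coboundary g x.
Proof.
case: x => -[|n] s fg //=; apply: eq_bigr => k _; apply: fg.
by rewrite /= size_rem ?mem_enum // size_enum_ord.
Qed.

Lemma oppC f : - f = f.
Proof. by apply: funext => x; exact: oppF2. Qed.

Lemma addCC f : f + f = 0.
Proof. by apply: funext => x; exact: addF2. Qed.

Lemma cupiDl i f g h : cupi i (f + g) h = cupi i f h + cupi i g h.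
Proof.
apply: funext => x; rewrite -[RHS]/(cupi i f h x + cupi i g h x).
by case: x => n s; rewrite -big_split; apply: eq_bigr => p _; apply: mulrDl.
Qed.

Lemma cupiDr i f g h : cupi i f (g + h) = cupi i f g + cupi i f h.
Proof.
apply: funext => x; rewrite -[RHS]/(cupi i f g x + cupi i f h x).
by case: x => n s; rewrite -big_split; apply: eq_bigr => p _; apply: mulrDr.
Qed.

Lemma cupi0l i f : cupi i 0 f = 0.
Proof. by apply: (addIr (cupi i 0 f)); rewrite -cupiDl addr0 add0r. Qed.

Lemma cupi0r i f : cupi i f 0 = 0.
Proof. by apply: (addIr (cupi i f 0)); rewrite -cupiDr addr0 add0r. Qed.

Lemma cupA f g h : cupi 0 f (cupi 0 g h) = cupi 0 (cupi 0 f g) h.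
Proof.
apply: cochainP => n s e e0; rewrite !eval_faceE // !cupi_eval.
under eq_bigr do rewrite cupi_eval mulr_sumr.
under [RHS]eq_bigr do rewrite cupi_eval mulr_suml.
rewrite -(blocks1_assoc e (fun a b c => eval_face f s a * (eval_face g s b * eval_face h s c))).
by apply: eq_bigr => p _; apply: eq_bigr => q _; rewrite mulrA.
Qed.

Lemma eval_cochain1 n (s : simplex X n) e :
  eval_face (@cochain1 X) s e = (size e == 1%N)%:R.
Proof. by case: e. Qed.

Lemma cup1l f : cupi 0 (@cochain1 X) f = f.
Proof.
apply: cochainP => n s e e0; rewrite !eval_faceE // cupi_eval.
by under eq_bigr do rewrite eval_cochain1; rewrite blocks1_unitl.
Qed.

Lemma cup1r f : cupi 0 f (@cochain1 X) = f.
Proof.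
apply: cochainP => n s e e0; rewrite !eval_faceE // cupi_eval.
by under eq_bigr do rewrite eval_cochain1; rewrite blocks1_unitr.
Qed.

Lemma bounded_cupi i f g : bounded f -> bounded g -> bounded (cupi i f g).
Proof.
move=> [N fN] [M gM]; exists (N + M)%N => -[n s] /= nNM.
rewrite big_seq big1 // => p pb; have /andP[p1 p2] := blocks_neq0 pb.
have := size_blocks pb; rewrite size_enum_ord => szp.
have [Np|pN] := leqP N (size p.1).-1; first by rewrite fN // mul0r.
rewrite gM ?mulr0 //=; move: p1 p2; rewrite -!size_eq0.
move: (size p.1) (size p.2) szp pN => [|a] [|b] //=; lia.
Qed.

Definition is_cocycle : {pred cochain X} :=
  fun f => `[< coboundary f = 0 /\ bounded f >].

Lemma is_cocycle_zmod : zmod_closed is_cocycle.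
Proof.
split.
  by apply/asboolP; split; [exact: coboundary0 | exists 0%N].
move=> f g /asboolP[df [N fN]] /asboolP[dg [M gM]]; apply/asboolP.
rewrite oppC; split; first by rewrite coboundaryD df dg addr0.
exists (maxn N M) => x; rewrite geq_max => /andP[Nx Mx].
by rewrite -[LHS]/(f x + g x) fN // gM // addr0.
Qed.

HB.instance Definition _ := GRing.isZmodClosed.Build _ is_cocycle is_cocycle_zmod.

Record cocycle := Cocycle { cochain_of :> cochain X; _ : is_cocycle cochain_of }.

HB.instance Definition _ := [isSub for cochain_of].
HB.instance Definition _ := [Choice of cocycle by <:].
HB.instance Definition _ := [SubChoice_isSubZmodule of cocycle by <:].

Definition is_coboundary : {pred cocycle} :=
  fun z => `[< exists f, cochain_of z = coboundary f >].

Lemma is_coboundary_zmod : zmod_closed is_coboundary.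
Proof.
split; first by apply/asboolP; exists 0; rewrite coboundary0.
move=> z z' /asboolP[f zf] /asboolP[f' zf']; apply/asboolP; exists (f + f').
by rewrite coboundaryD -zf -zf' -[in RHS](oppC z').
Qed.

HB.instance Definition _ := GRing.isZmodClosed.Build _ is_coboundary is_coboundary_zmod.

End Cochains.

Definition cohomology (X : sset) := Quotient.quot (@is_coboundary X).
HB.instance Definition _ (X : sset) := GRing.Zmodule.on (cohomology X).

Definition cls (X : sset) (z : cocycle X) : cohomology X := \pi z.

Section CohomologyRing.
Variable X : sset.
Implicit Types (z : cocycle X) (a b c : cohomology X).

Lemma cocycleP z : coboundary z = 0 /\ bounded z.
Proof. by case: z => f zf; apply/asboolP. Qed.

Lemma cls_eqP z z' :
  cls z = cls z' <-> exists f, cochain_of z = cochain_of z' + coboundary f.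
Proof.
split.
  move=> /eqP; rewrite -[_ == _]/(\pi_(cohomology X) z == \pi z').
  rewrite -Quotient.idealrBE => /asboolP[f zf]; exists f.
  by rewrite -zf addrC subrK.
move=> [f zf]; apply/eqP; rewrite -[_ == _]/(\pi_(cohomology X) z == \pi z').
rewrite -Quotient.idealrBE; apply/asboolP; exists f.
by rewrite -[LHS]/(cochain_of z - cochain_of z') zf addrC addKr.
Qed.

Lemma clsD z z' : cls (z + z') = cls z + cls z'.
Proof. by rewrite /cls !piE. Qed.

Lemma reprP a : cls (repr a) = a.
Proof. exact: reprK. Qed.

Lemma cls_ind (P : cohomology X -> Prop) : (forall z, P (cls z)) -> forall a, P a.
Proof. by move=> Pz a; rewrite -(reprP a). Qed.

Lemma cup_subproof z z' : @is_cocycle X (cupi 0 z z').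
Proof.
have [[dz bz] [dz' bz']] := (cocycleP z, cocycleP z').
apply/asboolP; split; last exact: bounded_cupi.
by rewrite cupi_coboundary dz dz' cupi0l cupi0r !addr0.
Qed.

Definition cup z z' : cocycle X := Cocycle (cup_subproof z z').

Lemma cocycle1_subproof : @is_cocycle X (@cochain1 X).
Proof.
apply/asboolP; split; last by exists 1%N => x; rewrite /cochain1; case: (tag x).
apply: (addIr (coboundary (@cochain1 X))).
have := cupi_coboundary 0 (@cochain1 X) (@cochain1 X).
by rewrite cup1l cup1r cup1l addr0 add0r => ->; rewrite addCC addCC.
Qed.

Definition cocycle1 : cocycle X := Cocycle cocycle1_subproof.

Definition cohomology_mul a b : cohomology X := cls (cup (repr a) (repr b)).

Lemma cls_cup z z' : cohomology_mul (cls z) (cls z') = cls (cup z z').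
Proof.
rewrite /cohomology_mul; set w := repr _; set w' := repr _.
have /cls_eqP[f wE] : cls w = cls z by exact: reprP.
have /cls_eqP[f' wE'] : cls w' = cls z' by exact: reprP.
have [[dz _] [dw' _]] := (cocycleP z, cocycleP w').
apply/cls_eqP; exists (cupi 0 z f' + cupi 0 f w') => /=.
rewrite coboundaryD !cupi_coboundary dz dw' !cupi0l !cupi0r !addr0 add0r.
by rewrite {1}wE cupiDl {1}wE' cupiDr addrA.
Qed.

Lemma cohomology_mulA : associative cohomology_mul.
Proof.
elim/cls_ind => z; elim/cls_ind => z'; elim/cls_ind => z''.
by rewrite !cls_cup; congr cls; apply: val_inj => /=; rewrite cupA.
Qed.

Lemma cohomology_mulC : commutative cohomology_mul.
Proof.
elim/cls_ind => z; elim/cls_ind => z'; rewrite !cls_cup.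
have [[dz _] [dz' _]] := (cocycleP z, cocycleP z').
apply/cls_eqP; exists (cupi 1 z z').
by rewrite cupi_coboundary dz dz' cupi0l cupi0r add0r add0r addrCA addCC addr0.
Qed.

Lemma cohomology_mul1 : left_id (cls cocycle1) cohomology_mul.
Proof.
elim/cls_ind => z; rewrite cls_cup; congr cls; apply: val_inj; exact: cup1l.
Qed.

Lemma cohomology_mulD : left_distributive cohomology_mul +%R.
Proof.
elim/cls_ind => z; elim/cls_ind => z'; elim/cls_ind => z''.
rewrite -clsD !cls_cup -clsD; congr cls; apply: val_inj; exact: cupiDl.
Qed.

Lemma cohomology1_neq0 : cls cocycle1 != 0.
Proof.
rewrite -[0]reprP; apply/eqP => /cls_eqP[f].
have : cls (repr (0 : cohomology X)) = cls 0 by rewrite reprP /cls piE.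
move=> /cls_eqP[f' ->] /(congr1 (fun h => h (existT _ 0%N (vertex X)))).
rewrite -[X in _ = X -> _]/(0 + coboundary f' (existT _ 0%N (vertex X)) +
  coboundary f (existT _ 0%N (vertex X))) /= !addr0.
by move/eqP; rewrite oner_eq0.
Qed.

HB.instance Definition _ := GRing.Zmodule_isComNzRing.Build (cohomology X)
  cohomology_mulA cohomology_mulC cohomology_mul1 cohomology_mulD cohomology1_neq0.

Lemma clsM z z' : cls z * cls z' = cls (cup z z').
Proof. exact: cls_cup. Qed.

Lemma cohomology_pchar2 : 2 \in [pchar cohomology X].
Proof.
rewrite inE /=; apply/eqP; rewrite -[1]reprP mulr2n -clsD.
rewrite (_ : _ + _ = 0) ?/cls ?piE //.
by apply: val_inj; exact: addCC.
Qed.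

(* The structure map of the F_2-algebra H^*(X). *)
Definition cohomology_scalar (c : 'F_2) : cohomology X := (val c)%:R.

Lemma cohomology_scalar_zmod : zmod_morphism cohomology_scalar.
Proof.
have := addrr_pchar2 cohomology_pchar2 1; rewrite /cohomology_scalar => C11.
case=> [[|[|//]] ?] [[|[|//]] ?] /=; rewrite ?subr0 ?subrr //.
by rewrite sub0r -[RHS]addr0 -C11 addKr.
Qed.

Lemma cohomology_scalar_monoid : monoid_morphism cohomology_scalar.
Proof.
split=> //; rewrite /cohomology_scalar.
by case=> [[|[|//]] ?] [[|[|//]] ?]; rewrite /= ?mul0r ?mulr0 ?mulr1.
Qed.

HB.instance Definition _ := GRing.isZmodMorphism.Build _ _ cohomology_scalar
  cohomology_scalar_zmod.
HB.instance Definition _ := GRing.isMonoidMorphism.Build _ _ cohomology_scalar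
  cohomology_scalar_monoid.

(* The subspace H^n(X). *)
Definition in_degree (n : nat) (a : cohomology X) :=
  exists2 z : cocycle X, (forall x, tag x != n -> cochain_of z x = 0) & a = cls z.

End CohomologyRing.

Section Steenrod.
Variable X : sset.
Implicit Types (z : cocycle X) (f : cochain X).

Lemma component_coboundary n f :
  coboundary (component n f) = component n.+1 (coboundary f).
Proof.
apply: funext => x; rewrite /component; have [xn|xn] := eqVneq (tag x) n.+1.
  by apply: coboundary_local => y; rewrite xn => -[->]; rewrite eqxx.
rewrite (@coboundary_local X _ 0) ?coboundary0 //.
by move=> y yx; case: eqP => // yn; rewrite -yx yn eqxx in xn.
Qed.

Lemma component0 n : component n (0 : cochain X) = 0.
Proof. by apply: funext => x; rewrite /component; case: eqP. Qed.

Lemma componentD n f f' : component n (f + f') = component n f + component n f'.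
Proof.
apply: funext => x; rewrite -[RHS]/(component n f x + component n f' x) /component.
by case: eqP => // _; rewrite addr0.
Qed.

Lemma coboundary_component z n : coboundary (component n z) = 0.
Proof. by have [dz _] := cocycleP z; rewrite component_coboundary dz component0. Qed.

Lemma sq_subproof k z : @is_cocycle X (sq_cochain k z).
Proof.
have [dz [N zN]] := cocycleP z; apply/asboolP; split.
  apply: funext => x; case xM: (tag x) => [|M].
    by rewrite (@coboundary_local X _ 0) ?coboundary0 // => y; rewrite xM.
  pose f_n := component (M - k) z.
  have [kM|kM] := leqP k.*2 M; last first.
    rewrite (@coboundary_local X _ 0) ?coboundary0 //.
    by move=> y; rewrite xM => -[yM]; rewrite /sq_cochain yM leqNgt kM.
  rewrite (@coboundary_local X _ (cupi (M - k.*2) f_n f_n)).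
    rewrite cupi_coboundary coboundary_component cupi0l cupi0r !add0r.
    by case: (_ - _)%N => // j; rewrite addCC.
  by move=> y; rewrite xM => -[yM]; rewrite /sq_cochain yM kM.
exists (N + k)%N => x Nx; rewrite /sq_cochain; case: ifP => // _.
rewrite (_ : component _ _ = 0) ?cupi0l //.
apply: funext => y; rewrite /component; case: eqP => // yx.
by rewrite zN // yx leq_subRL; [rewrite addnC | apply: leq_trans Nx; exact: leq_addl].
Qed.

Definition sq_cocycle k z : cocycle X := Cocycle (sq_subproof k z).

Definition Sq k (a : cohomology X) : cohomology X := cls (sq_cocycle k (repr a)).

Lemma Sq_cls k z : Sq k (cls z) = cls (sq_cocycle k z).
Proof.
rewrite /Sq; set w := repr _.
have /cls_eqP[b wE] : cls w = cls z by exact: reprP.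
pose h M := let n := (M.+1 - k)%N in let i := (M.+1 - k.*2)%N in
  let zn := component n z in let db := component n (coboundary b) in
  let bn := component n.-1 b in
  cupi i.+1 zn db + (cupi i bn db + (if i is j.+1 then cupi j bn bn else 0)).
apply/cls_eqP.
exists (fun x => if (k.*2 <= (tag x).+1)%N then h (tag x) x else 0) => /=.
apply: funext => x; rewrite -[RHS]/(sq_cochain k z x + coboundary _ x).
rewrite /sq_cochain; have -> : component (tag x - k) w =
    component (tag x - k) z + component (tag x - k) (coboundary b).
  by rewrite wE componentD.
case: ifP => [kx|kx]; last first.
  rewrite add0r (@coboundary_local X _ 0) ?coboundary0 //.
  by move=> y ->; rewrite kx.
case xM: (tag x) kx => [|M] kx.
  rewrite [coboundary _ _](@coboundary_local X _ 0) ?coboundary0; last first.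
    by move=> y; rewrite xM.
  rewrite (_ : component (0 - k) (coboundary b) = 0) ?addr0 //.
  apply: funext => y; rewrite /component; case: eqP => // y0.
  rewrite (@coboundary_local X _ 0) ?coboundary0 // => y'.
  by rewrite y0 sub0n.
rewrite [coboundary _ x](@coboundary_local X _ (h M)); last first.
  by move=> y; rewrite xM => -[->]; rewrite kx.
rewrite /h; set n := (M.+1 - k)%N; set i := (M.+1 - k.*2)%N.
have n0 : n.-1.+1 = n by rewrite prednK // /n subn_gt0; lia.
set zn := component n z; set db := component n (coboundary b).
set bn := component n.-1 b.
have dzn : coboundary zn = 0 by exact: coboundary_component.
have dbn : coboundary bn = db by rewrite component_coboundary n0.
have ddb : coboundary db = 0 by rewrite -dbn coboundaryK.
rewrite !coboundaryD !cupi_coboundary dzn dbn ddb cupi0l !cupi0r !add0r addr0.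
rewrite -[RHS]/((_ + _) x); congr (_ x).
rewrite cupiDl !cupiDr -!addrA; congr (_ + _).
rewrite [RHS]addrA -[LHS]addr0 -!addrA; congr (_ + (_ + (_ + _))).
case: (i) => [|j]; first by rewrite coboundary0 addr0.
rewrite cupi_coboundary dbn (addrC (cupi j bn db)) addrA addCC add0r.
by case: j => // j; rewrite addCC.
Qed.

End Steenrod.

Section Pullback.
Variables (X Y : sset) (phi : smap X Y).

Definition smap_simplices (x : simplices X) : simplices Y :=
  existT (simplex Y) (tag x) (phi _ (tagged x)).

Definition pull (f : cochain Y) : cochain X := f \o smap_simplices.

Lemma smap_face n (s : simplex X n) e :
  smap_simplices (face s e) = face (phi _ s) e.
Proof. by rewrite /smap_simplices /face /= smap_act. Qed.

Lemma pull_coboundary f : coboundary (pull f) = pull (coboundary f).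
Proof.
apply: funext => -[n s] /=; rewrite /pull /=; case: ifP => // _.
by apply: eq_bigr => k _; rewrite /= smap_face.
Qed.

Lemma pull_cupi i f g : cupi i (pull f) (pull g) = pull (cupi i f g).
Proof.
apply: funext => -[n s]; rewrite /pull /=.
by apply: eq_bigr => p _; rewrite /= !smap_face.
Qed.

Lemma pull_subproof (z : cocycle Y) : @is_cocycle X (pull z).
Proof.
have [dz [N zN]] := cocycleP z; apply/asboolP.
rewrite pull_coboundary dz; split; first exact: funext.
by exists N => x Nx; apply: zN.
Qed.

Definition pull_cocycle (z : cocycle Y) : cocycle X := Cocycle (pull_subproof z).

Definition pullback (a : cohomology Y) : cohomology X := cls (pull_cocycle (repr a)).

Lemma pullback_cls z : pullback (cls z) = cls (pull_cocycle z).
Proof.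
have /cls_eqP[f zf] : cls (repr (cls z)) = cls z by exact: reprP.
apply/cls_eqP; exists (pull f); rewrite pull_coboundary /= zf; exact: funext.
Qed.

Lemma pullback_zmod_morphism : zmod_morphism pullback.
Proof.
elim/cls_ind => z; elim/cls_ind => z'.
have clsB Z (c c' : cocycle Z) : cls (c - c') = cls c - cls c' by rewrite /cls !piE.
rewrite -clsB !pullback_cls -clsB; congr cls; apply: val_inj; exact: funext.
Qed.

Lemma pullback_monoid_morphism : monoid_morphism pullback.
Proof.
split.
  rewrite -[LHS]/(pullback (cls (cocycle1 Y))) -[RHS]/(cls (cocycle1 X)) pullback_cls.
  by congr cls; apply: val_inj; exact: funext.
elim/cls_ind => z; elim/cls_ind => z'.
rewrite clsM !pullback_cls clsM; congr cls.
by apply: val_inj => /=; rewrite pull_cupi.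
Qed.

HB.instance Definition _ :=
  GRing.isZmodMorphism.Build _ _ pullback pullback_zmod_morphism.
HB.instance Definition _ :=
  GRing.isMonoidMorphism.Build _ _ pullback pullback_monoid_morphism.

End Pullback.

Section Product.
Variables X Y : sset.

Definition prod_sset : sset.
Proof.
refine (@SSet (fun n => (simplex X n * simplex Y n)%type) (vertex X, vertex Y)
  (fun m n f s => (act f s.1, act f s.2)) _ _).
- by move=> n [s t] /=; rewrite (act_id s) (act_id t).
- by move=> l m n f g [s t] /=; rewrite (act_comp f g s) (act_comp f g t).
Defined.

Definition prod_fst : smap prod_sset X :=
  @SMap prod_sset X (fun _ s => s.1) (fun _ _ _ _ => erefl).
Definition prod_snd : smap prod_sset Y :=
  @SMap prod_sset Y (fun _ s => s.2) (fun _ _ _ _ => erefl).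

End Product.

(* The nerve of G, a simplicial model of BG: a simplex with vertices 0, ..., n is
   a functor from the indiscrete category on these vertices to G, that is, a
   label in G on each oriented edge, multiplicative along paths.              *)
Section Nerve.
Variable gT : finGroupType.

Record nerve_simplex (n : nat) := NerveSimplex {
  label : 'I_n.+1 -> 'I_n.+1 -> gT;
  labelM : forall i j k, (label i j * label j k)%g = label i k }.

Lemma nerve_simplexP n (s t : nerve_simplex n) :
  (forall i j, label s i j = label t i j) -> s = t.
Proof.
case: s t => [g gM] [h hM] /= gh.
have {}gh : g = h by apply: funext => i; apply: funext => j.
by case: h / gh hM => hM; congr NerveSimplex; exact: Prop_irrelevance.
Qed.

Definition nerve_act m n (f : 'I_m.+1 -> 'I_n.+1) (s : nerve_simplex n) :
    nerve_simplex m :=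
  @NerveSimplex m (fun i j => label s (f i) (f j)) (fun _ _ _ => labelM s _ _ _).

Definition nerve : sset.
Proof.
refine (@SSet nerve_simplex
  (@NerveSimplex 0 (fun _ _ => 1%g) (fun _ _ _ => mulg1 1%g)) nerve_act _ _).
- by move=> n s; exact: nerve_simplexP.
- by move=> l m n f g s; exact: nerve_simplexP.
Defined.

End Nerve.

Section ClassifyingSpace.
Local Open Scope classical_set_scope.
Variable R : realType.

Definition std_simplex (n : nat) : set 'rV[R]_n.+1 :=
  [set t | (forall i, 0 <= t 0 i) /\ \sum_i t 0 i = 1].
Arguments std_simplex : clear implicits.

(* The affine map sending the i-th vertex to the f i-th one. *)
Definition affine_row m n (f : 'I_m.+1 -> 'I_n.+1) (t : 'rV[R]_m.+1) :
  'rV[R]_n.+1 := \row_j \sum_(i | f i == j) t 0 i.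

Lemma affine_subproof m n (f : 'I_m.+1 -> 'I_n.+1) (t : std_simplex m) :
  affine_row f (set_val t) \in std_simplex n.
Proof.
apply/mem_set; have [t0 t1] := set_valP t; split.
  by move=> j; rewrite mxE sumr_ge0.
under eq_bigr do rewrite mxE.
by rewrite -t1 [RHS](partition_big f xpredT).
Qed.

Definition affine m n (f : 'I_m.+1 -> 'I_n.+1) (t : std_simplex m) : std_simplex n :=
  exist (fun u => u \in std_simplex n) _ (affine_subproof f t).

Lemma continuous_mx (T : topologicalType) m n (g : T -> 'M[R]_(m, n)) :
  (forall i j, continuous (fun t => g t i j)) -> continuous g.
Proof.
move=> gc t A [P Pg PA]; rewrite nbhs_simpl /=.
have : \forall u \near t, forall ij, P ij.1 ij.2 (g u ij.1 ij.2).
  by apply: filter_forall => -[i j]; apply: gc; exact: Pg.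
by apply: filterS => u Pu; apply: PA => i j; exact: (Pu (i, j)).
Qed.

Lemma affine_continuous m n (f : 'I_m.+1 -> 'I_n.+1) : continuous (affine f).
Proof.
apply: continuous_comp_initial; apply: continuous_mx => i j /=.
rewrite [X in continuous X](_ : _ =
  fun t : std_simplex m => \sum_(k | f k == j) (set_val t : 'rV[R]_m.+1) 0 k).
  apply: continuous_big; first exact: tvs.add_continuous.
  move=> k _ t; apply: (@continuous_comp _ _ _ set_val (fun r : 'rV[R]_m.+1 => r 0 k)).
    exact: initial_continuous.
  exact: matrix_normedtype.coord_continuous.
by apply: funext => t; rewrite -[LHS]/(affine_row f (set_val t) i j) mxE.
Qed.

Lemma affine_id n (t : std_simplex n) : affine id t = t.
Proof.
apply: val_inj; apply/rowP => j.
by rewrite -[LHS]/(affine_row id (set_val t) 0 j) mxE big_pred1_eq.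
Qed.

Lemma affine_comp l m n (f : 'I_l.+1 -> 'I_m.+1) (g : 'I_m.+1 -> 'I_n.+1)
  (t : std_simplex l) : affine (g \o f) t = affine g (affine f t).
Proof.
apply: val_inj; apply/rowP => j.
rewrite -[LHS]/(affine_row (g \o f) (set_val t) 0 j).
rewrite -[RHS]/(affine_row g (affine_row f (set_val t)) 0 j) !mxE.
rewrite (partition_big f (fun i => g i == j)) //=.
apply: eq_bigr => i /eqP gij; rewrite mxE; apply: eq_bigl => k.
by case: (eqVneq (f k) i) => [/= ->|_]; rewrite ?gij ?eqxx ?andbF.
Qed.

(* A simplicial model of BO(k): the diagonal of the nerve of the simplicial
   group of singular simplices of O(k).  Its n-simplices are the simplices of
   the nerve whose labels are singular n-simplices of O(k).                   *)
Record BO_simplex (k n : nat) := BOSimplex {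
  sing_label : 'I_n.+1 -> 'I_n.+1 -> std_simplex n -> 'M[R]_k;
  sing_continuous : forall i j, continuous (sing_label i j);
  sing_orthogonal : forall i j t, sing_label i j t *m (sing_label i j t)^T = 1%:M;
  sing_labelM : forall i j l t,
    sing_label i j t *m sing_label j l t = sing_label i l t }.

Lemma BO_simplexP k n (s u : BO_simplex k n) :
  (forall i j t, sing_label s i j t = sing_label u i j t) -> s = u.
Proof.
case: s u => [g gc go gM] [h hc ho hM] /= gh.
have {}gh : g = h.
  by apply: funext => i; apply: funext => j; apply: funext => t.
case: h / gh hc ho hM => hc ho hM.
by congr BOSimplex; exact: Prop_irrelevance.
Qed.

Lemma BO_act_continuous k m n (f : 'I_m.+1 -> 'I_n.+1) (s : BO_simplex k n) i j :
  continuous (sing_label s (f i) (f j) \o affine f).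
Proof.
move=> t; apply: continuous_comp; first exact: affine_continuous.
exact: sing_continuous.
Qed.

Definition BO_act k m n (f : 'I_m.+1 -> 'I_n.+1) (s : BO_simplex k n) :
    BO_simplex k m :=
  @BOSimplex k m (fun i j => sing_label s (f i) (f j) \o affine f)
    (@BO_act_continuous k m n f s) (fun _ _ _ => sing_orthogonal s _ _ _)
    (fun _ _ _ _ => sing_labelM s _ _ _ _).

Lemma orthogonal1 k : 1%:M *m (1%:M : 'M[R]_k)^T = 1%:M.
Proof. by rewrite trmx1 mulmx1. Qed.

Definition BO_vertex k : BO_simplex k 0 :=
  @BOSimplex k 0 (fun _ _ _ => 1%:M) (fun _ _ => @cst_continuous _ _ _)
    (fun _ _ _ => orthogonal1 k) (fun _ _ _ _ => mulmx1 1%:M).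

Definition BO (k : nat) : sset.
Proof.
refine (@SSet (BO_simplex k) (BO_vertex k) (@BO_act k) _ _).
- by move=> n s; apply: BO_simplexP => i j t /=; rewrite affine_id.
- by move=> l m n f g s; apply: BO_simplexP => i j t /=; rewrite affine_comp.
Defined.

(* The map BO(k) x BO(l) -> BO(k + l) given by the block sum of matrices. *)
Section BlockSum.
Variables k l : nat.

Definition block_diag (A : 'M[R]_k) (B : 'M[R]_l) : 'M[R]_(k + l) :=
  block_mx A 0 0 B.

Lemma block_diag_orthogonal A B : A *m A^T = 1%:M -> B *m B^T = 1%:M ->
  block_diag A B *m (block_diag A B)^T = 1%:M.
Proof.
move=> AA BB; rewrite /block_diag tr_block_mx mulmx_block !trmx0.
by rewrite !mulmx0 !mul0mx !addr0 !add0r AA BB -scalar_mx_block.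
Qed.

Lemma block_diagM A B A' B' :
  block_diag A B *m block_diag A' B' = block_diag (A *m A') (B *m B').
Proof. by rewrite mulmx_block !mulmx0 !mul0mx !addr0 !add0r. Qed.

Lemma block_diag_continuous (T : topologicalType) (f : T -> 'M[R]_k)
    (g : T -> 'M[R]_l) : continuous f -> continuous g ->
  continuous (fun t => block_diag (f t) (g t)).
Proof.
move=> fc gc; apply: continuous_mx => i j.
rewrite -(splitK i) -(splitK j).
case: (fintype.split i) => i'; case: (fintype.split j) => j' /=.
- under eq_fun do rewrite block_mxEul.
  move=> t; apply: (@continuous_comp _ _ _ f (fun M : 'M[R]_k => M i' j')).
    exact: fc.
  exact: matrix_normedtype.coord_continuous.
- by under eq_fun do rewrite block_mxEur mxE; exact: cst_continuous.
- by under eq_fun do rewrite block_mxEdl mxE; exact: cst_continuous.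
- under eq_fun do rewrite block_mxEdr.
  move=> t; apply: (@continuous_comp _ _ _ g (fun M : 'M[R]_l => M i' j')).
    exact: gc.
  exact: matrix_normedtype.coord_continuous.
Qed.

Definition BO_sum_simplex n (s : simplex (prod_sset (BO k) (BO l)) n) :
  simplex (BO (k + l)) n.
Proof.
refine (@BOSimplex (k + l) n
  (fun i j t => block_diag (sing_label s.1 i j t) (sing_label s.2 i j t)) _ _ _).
- by move=> i j; apply: block_diag_continuous; exact: sing_continuous.
- by move=> i j t; apply: block_diag_orthogonal; exact: sing_orthogonal.
- by move=> i j m t; rewrite block_diagM !sing_labelM.
Defined.

Definition BO_sum : smap (prod_sset (BO k) (BO l)) (BO (k + l)).
Proof.
refine (@SMap (prod_sset (BO k) (BO l)) (BO (k + l)) BO_sum_simplex _).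
by move=> m n f s; exact: BO_simplexP.
Defined.

End BlockSum.

(* The axioms of Hirzebruch and Milnor-Stasheff for the universal classes
   w_j in H^j(BO(k)), w k j standing for w_j. *)
Record stiefel_whitney (w : forall k : nat, nat -> cohomology (BO k)) : Prop := {
  sw_degree : forall k j, in_degree j (w k j);
  sw_unit : forall k, w k 0 = 1;
  sw_rank : forall k j, (k < j)%N -> w k j = 0;
  sw_sum : forall k l j, pullback (BO_sum k l) (w (k + l)%N j) =
    \sum_(i < j.+1) pullback (prod_fst (BO k) (BO l)) (w k i) *
                    pullback (prod_snd (BO k) (BO l)) (w l (j - i)%N);
  sw_line : w 1%N 1%N != 0 }.

End ClassifyingSpace.

Section Representations.
Variables (R : realType) (gT : finGroupType).

Record orthogonal_rep (k : nat) := OrthogonalRep {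
  rep_of :> mx_representation R [set: gT] k;
  rep_orthogonal : forall g, rep_of g *m (rep_of g)^T = 1%:M }.

Lemma Brep_subproof k (r : orthogonal_rep k) (g h : gT) :
  r g *m r h = r (g * h)%g.
Proof. by rewrite repr_mxM ?inE. Qed.

Definition Brep_simplex k (r : orthogonal_rep k) n (s : nerve_simplex gT n) :
  BO_simplex R k n.
Proof.
refine (@BOSimplex R k n (fun i j _ => r (label s i j)) _ _ _).
- by move=> i j; exact: cst_continuous.
- by move=> i j t; exact: rep_orthogonal.
- by move=> i j l t; rewrite Brep_subproof labelM.
Defined.

Definition Brep k (r : orthogonal_rep k) : smap (nerve gT) (BO R k).
Proof.
refine (@SMap (nerve gT) (BO R k) (Brep_simplex r) _).
by move=> m n f s; exact: BO_simplexP.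
Defined.

Variable w : forall k : nat, nat -> cohomology (BO R k).

Definition sw j k (r : orthogonal_rep k) : cohomology (nerve gT) :=
  pullback (Brep r) (w k j).

Definition sw_subring : set (cohomology (nerve gT)) :=
  smallest (fun S : set (cohomology (nerve gT)) => GRing.subring_closed [pred a in S])
    [set a | exists k (r : orthogonal_rep k) j, a = sw j r].

End Representations.

Section ComplexType.
Variables (R : realType) (gT : finGroupType).

Definition complex_type k (r : mx_representation R [set: gT] k) : Prop :=
  exists phi : {rmorphism R[i] -> 'M[R]_k},
    [/\ forall c : R, phi c%:C%C = c%:M, injective phi &
        forall A, centgmx r A <-> exists z, A = phi z].

(* The real matrix of A acting on row vectors x + iy, written (x, y). *)
Definition realify n (A : 'M[R[i]]_n) : 'M[R]_(n + n) :=
  block_mx (map_mx (@complex.Re R) A) (map_mx (@complex.Im R) A)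
           (- map_mx (@complex.Im R) A) (map_mx (@complex.Re R) A).

Lemma map_mx_ReM n (A B : 'M[R[i]]_n) : map_mx (@complex.Re R) (A *m B) =
  map_mx (@complex.Re R) A *m map_mx (@complex.Re R) B -
  map_mx (@complex.Im R) A *m map_mx (@complex.Im R) B.
Proof.
apply/matrixP => i j; rewrite !mxE raddf_sum -sumrB.
by apply: eq_bigr => k _; rewrite !mxE; case: (A i k) (B k j) => [? ?] [? ?].
Qed.

Lemma map_mx_ImM n (A B : 'M[R[i]]_n) : map_mx (@complex.Im R) (A *m B) =
  map_mx (@complex.Re R) A *m map_mx (@complex.Im R) B +
  map_mx (@complex.Im R) A *m map_mx (@complex.Re R) B.
Proof.
apply/matrixP => i j; rewrite !mxE raddf_sum -big_split.
by apply: eq_bigr => k _; rewrite !mxE; case: (A i k) (B k j) => [? ?] [? ?].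
Qed.

Lemma realifyM n : {morph (@realify n) : A B / A *m B}.
Proof.
move=> A B; rewrite /realify mulmx_block map_mx_ReM map_mx_ImM.
rewrite !mulNmx !mulmxN opprD [X in block_mx _ _ X _]addrC.
by rewrite [X in block_mx _ _ _ X]addrC.
Qed.

Lemma realify1 n : realify (1%:M : 'M[R[i]]_n) = 1%:M.
Proof.
rewrite /realify (_ : map_mx (@complex.Im R) 1%:M = 0) ?oppr0.
  rewrite (_ : map_mx (@complex.Re R) 1%:M = 1%:M) -?scalar_mx_block //.
  by apply/matrixP => i j; rewrite !mxE; case: eqP.
by apply/matrixP => i j; rewrite !mxE; case: eqP.
Qed.

Section Realification.
Variables (n : nat) (rho : mx_representation R[i] [set: gT] n).

Lemma realification_subproof : mx_repr [set: gT] (fun g => realify (rho g)).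
Proof.
split; first by rewrite repr_mx1 realify1.
by move=> g h Gg Gh; rewrite repr_mxM // realifyM.
Qed.

(* The real representation underlying rho. *)
Definition realification := MxRepresentation realification_subproof.

End Realification.
End ComplexType.

Section Presentation.
Variables (X : sset) (n : nat) (gens : 'I_n -> cohomology X).

Definition eval_gens (p : {mpoly 'F_2[n]}) : cohomology X :=
  mmap (@cohomology_scalar X) gens p.

Definition presented_by (rels : seq {mpoly 'F_2[n]}) : Prop :=
  (forall a, exists p, a = eval_gens p) /\
  (forall p, eval_gens p = 0 <->
    exists q : 'I_(size rels) -> {mpoly 'F_2[n]}, p = \sum_i q i * rels`_i).

End Presentation.

(* Carlson's relations, in the variables z, y, x, w. *)
Definition carlson_relations : seq {mpoly 'F_2[4]} :=
  let z := 'X_(0 : 'I_4) in let y := 'X_(1 : 'I_4) in let x := 'X_(2 : 'I_4) in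
  [:: z ^+ 2; z * y ^+ 2; z * x; x ^+ 2].

(* In the variables w_1(r_2), w_1(r_3), w_4(r_8), x. *)
Definition sw_relations : seq {mpoly 'F_2[4]} :=
  let u := 'X_(0 : 'I_4) in let v := 'X_(1 : 'I_4) in let x := 'X_(3 : 'I_4) in
  [:: u ^+ 2 + v ^+ 2; u ^+ 2 * v + u * v ^+ 2; u * x + v * x; x ^+ 2].

Definition carlson_presentation (X : sset) (z y x w : cohomology X) : Prop :=
  [/\ in_degree 1 z, in_degree 1 y, in_degree 3 x, in_degree 4 w &
      presented_by (fun i : 'I_4 => [:: z; y; x; w]`_i) carlson_relations].

(* Main.v *)
(* Everything is computed from the Gysin sequences of index 2 subgroups. They give
   the cohomology of cyclic groups by doubling the order, and that of G from the
   kernel <a> of the character y: H^*(<a>) is known, x is a transfer from <a^2, b>,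
   and w = w_4(r_8) restricts to the square of the generator of H^2(<a>) because
   a^4 acts by -1. Multiplication by w is injective since w stays monic on the
   central subgroup <a^4>; hence no class of degree 2 mod 4 survives on <a>, and
   the normal forms of Carlson's presentation are seen to be a basis, degree by
   degree, from the restriction to <a> and the kernel of y.
   The subring of Stiefel-Whitney classes misses x because w_3 = w_1 w_2 on <a>
   and H^2(G) restricts to 0 on <a>, while x does not.
   For the Steenrod squares r_8 is extended to the central product Gam of Z/8 and
   the dihedral group of order 8, of which G is a subgroup. In high degrees
   H^*(Gam) is detected on three subgroups Z/8 x Z/2, where r_8 is a sum of two
   planes, and the squares of the Euler class of a plane are found on (Z/2)^2. *)
Require Import Defs.
From HB Require Import structures.
From mathcomp Require Import all_boot all_order all_algebra all_fingroup all_character.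
From mathcomp Require Import all_classical reals topology complex mpoly.
From mathcomp Require normed_module matrix_normedtype.
From mathcomp Require Import ring zify.

Set Implicit Arguments.
Unset Strict Implicit.
Unset Printing Implicit Defensive.

Import Order.TTheory GRing.Theory Num.Theory.
Import normed_module.numFieldNormedType.Exports.
Local Open Scope ring_scope.

(** * Grading and functoriality *)

(** Detection on the index 2 subgroups of G itself does not give the squares: a character of G can
    restrict to the nilpotent class [e8] on a cyclic subgroup of order 8, and division by it loses
    information. In Gam the three subgroups are split, the other characters restrict to the
    polynomial generator t of the factor Z/2, and t is a nonzerodivisor; this is why r_8 is extended
    to Gam. On (Z/2)^2 neither a Cartan nor a Wu formula is invoked. The class s^2 (s + t)^2 is
    restricted from C16 x Z/2, so only even powers of s occur in its squares; with the swap of the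
    factors and the shear s -> s + t, a single coefficient of Sq^2 stays open, and it is found by
    evaluating a cochain on an explicit cycle. For the clause on Carlson's x, all presentations
    share the same x: degree 3 is spanned by x and y^3, and x^2 = 0 while y^6 is not 0. The two
    possible orders of r_2 and r_3 are exchanged by replacing a with ab. *)

Section Grading.
Variable X : sset.
Implicit Types (z : cocycle X) (a b : cohomology X).

Lemma cls0 : cls 0 = 0 :> cohomology X.
Proof. by apply: (addIr (cls 0)); rewrite -clsD !add0r. Qed.

Lemma cls_eq0 z : cls z = 0 <-> exists f, cochain_of z = coboundary f.
Proof.
rewrite -cls0 cls_eqP; split=> -[f fE]; exists f.
  by rewrite fE -[LHS]/(0 + coboundary f) add0r.
by rewrite fE -[RHS]/(0 + coboundary f) add0r.
Qed.

Lemma addHH a : a + a = 0.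
Proof. exact: (addrr_pchar2 (cohomology_pchar2 X)). Qed.

Lemma oppH a : - a = a.
Proof. by apply/eqP; rewrite eq_sym -subr_eq0 opprK addHH. Qed.

Lemma addHC_eq0 a b : a + b = 0 -> a = b.
Proof. by move=> ab; rewrite -[b]oppH; apply/eqP; rewrite -addr_eq0 ab. Qed.

Lemma compz_subproof n z : @is_cocycle X (component n z).
Proof.
apply/asboolP; split; first exact: coboundary_component.
exists n.+1 => x nx; rewrite /component; case: eqP => // xn.
by rewrite xn ltnn in nx.
Qed.
Definition compz n z : cocycle X := Cocycle (compz_subproof n z).

Definition hcomp n a : cohomology X := cls (compz n (generic_quotient.repr a)).

Lemma hcomp_cls n z : hcomp n (cls z) = cls (compz n z).
Proof.
have /cls_eqP[f fE] : cls (generic_quotient.repr (cls z)) = cls z by exact: reprP.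
apply/cls_eqP => /=; rewrite fE componentD.
case: n => [|n]; last by exists (component n f); rewrite component_coboundary.
(* In degree 0 nothing precedes [f], and [coboundary f] vanishes there by definition. *)
exists 0; rewrite coboundary0; congr (_ + _); apply: funext => x; rewrite /component.
case: eqP => // x0; rewrite (@coboundary_local X _ 0) ?coboundary0 // => y.
by rewrite x0.
Qed.

Lemma hcompD n : {morph hcomp n : a b / a + b}.
Proof.
elim/cls_ind => z; elim/cls_ind => z'; rewrite -clsD !hcomp_cls -clsD.
by congr cls; apply: val_inj => /=; rewrite componentD.
Qed.

Lemma hcomp0 n : hcomp n 0 = 0.
Proof. by apply: (addIr (hcomp n 0)); rewrite -hcompD !add0r. Qed.

Lemma hcomp_sum n I (r : seq I) (P : pred I) (F : I -> cohomology X) :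
  hcomp n (\sum_(i <- r | P i) F i) = \sum_(i <- r | P i) hcomp n (F i).
Proof. by apply: (big_morph (hcomp n) (hcompD n) (hcomp0 n)). Qed.

Lemma in_degreeP n a :
  in_degree n a <-> exists2 z, component n (cochain_of z) = z & a = cls z.
Proof.
split=> -[z zn ->]; exists z => //.
  by apply: funext => x; rewrite /component; case: eqP => // /eqP/zn.
by move=> x /negPf xn; rewrite -zn /component xn.
Qed.

Lemma hcomp_in n a : in_degree n (hcomp n a).
Proof. by exists (compz n (generic_quotient.repr a)) => // x /negPf xn /=; rewrite /component xn. Qed.

Lemma hcomp_id n a : in_degree n a -> hcomp n a = a.
Proof. by case/in_degreeP=> z zn ->; rewrite hcomp_cls; congr cls; apply: val_inj. Qed.

Lemma hcomp_neq m n a : in_degree m a -> m != n -> hcomp n a = 0.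
Proof.
case=> z zm -> mn; rewrite hcomp_cls; apply/cls_eq0; exists 0; rewrite coboundary0.
apply: funext => x /=; rewrite /component; case: eqP => // xn.
by apply: zm; rewrite xn eq_sym.
Qed.

(** A cocycle is bounded, which is what makes the sum of its components finite. Statements proved
    for homogeneous classes reach the whole ring through this lemma. *)
Lemma hcomp_decomp a : exists N, a = \sum_(i < N) hcomp i a.
Proof.
elim/cls_ind: a => z; have [_ [N zN]] := cocycleP z; exists N.
have sumC (r : seq nat) : \sum_(i <- r) hcomp i (cls z) = cls (\sum_(i <- r) compz i z).
  elim: r => [|i r IH]; first by rewrite !big_nil cls0.
  by rewrite !big_cons clsD IH hcomp_cls.
rewrite -(big_mkord xpredT (fun i => hcomp i (cls z))) sumC; congr cls; apply: val_inj.
apply: funext => x /=.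
have evS (r : seq nat) : cochain_of (\sum_(i <- r) compz i z) x =
    \sum_(i <- r) component i z x.
  elim: r => [|i r IH]; first by rewrite !big_nil.
  by rewrite !big_cons -IH.
rewrite evS; have [xN|Nx] := ltnP (tag x) N; last first.
  rewrite zN // big_seq big1 // => i; rewrite mem_index_iota /component => /andP[_ iN].
  by case: eqP => // xi; rewrite xi leqNgt iN in Nx.
rewrite (bigD1_seq (tag x)) ?mem_index_iota ?iota_uniq //= /component eqxx big1 ?addr0 //.
by move=> i; rewrite eq_sym => /negPf ->.
Qed.

Lemma hcomp_eq0 a : (forall n, hcomp n a = 0) -> a = 0.
Proof. by have [N aE] := hcomp_decomp a => a0; rewrite aE big1. Qed.

Lemma in_degree0 n : in_degree n (0 : cohomology X).
Proof. by rewrite -(hcomp0 n); exact: hcomp_in. Qed.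

Lemma in_degreeD n a b : in_degree n a -> in_degree n b -> in_degree n (a + b).
Proof. by move=> /hcomp_id<- /hcomp_id<-; rewrite -hcompD; exact: hcomp_in. Qed.

Lemma in_degree_one : in_degree 0 (1 : cohomology X).
Proof. by exists (cocycle1 X) => // x /negPf x0; rewrite /= /cochain1 x0. Qed.

(** The two faces in a term of the cup-i product share i + 1 vertices, so their dimensions add up to
    that of the simplex plus i. *)
Lemma cupi_degree i m n (f g : cochain X) :
  (forall x, tag x != m -> f x = 0) -> (forall x, tag x != n -> g x = 0) ->
  forall x, (tag x + i)%N != (m + n)%N -> cupi i f g x = 0.
Proof.
move=> fm gn [k s] /= kmn; rewrite big_seq big1 // => p pb.
have /andP[p1 p2] := blocks_neq0 pb; have := size_blocks pb.
rewrite size_enum_ord => szp.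
have [pm|pm] := eqVneq (size p.1).-1 m; last by rewrite fm // mul0r.
rewrite gn ?mulr0 //=; apply: contra_neq kmn => pn.
move: p1 p2; rewrite -!size_eq0.
by move: (size p.1) (size p.2) szp pm pn => [|?] [|?] //=; lia.
Qed.

Lemma in_degreeM m n a b : in_degree m a -> in_degree n b -> in_degree (m + n) (a * b).
Proof.
case=> z zm ->; case=> z' zn ->; rewrite clsM; exists (cup z z') => // x xmn.
by apply: (cupi_degree zm zn); rewrite addn0.
Qed.

Lemma in_degreeX m k a : in_degree m a -> in_degree (m * k) (a ^+ k).
Proof.
move=> am; elim: k => [|k IH]; first by rewrite muln0 expr0; exact: in_degree_one.
by rewrite mulnS exprS; exact: in_degreeM.
Qed.

Lemma hcompM m n a b : in_degree m a -> hcomp (m + n) (a * b) = a * hcomp n b.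
Proof.
move=> am; have [N bN] := hcomp_decomp b; rewrite {1}bN mulr_sumr hcomp_sum.
have [nN|Nn] := ltnP n N.
  rewrite (bigD1 (Ordinal nN)) //= hcomp_id; last exact/in_degreeM/hcomp_in.
  rewrite big1 ?addr0 // => i ni.
  apply: (@hcomp_neq (m + i)); first exact/in_degreeM/hcomp_in.
  by rewrite eqn_add2l.
have bn : hcomp n b = 0.
  rewrite bN hcomp_sum big1 // => i _.
  by apply: (hcomp_neq (hcomp_in i b)); rewrite neq_ltn (leq_trans (ltn_ord i)).
rewrite bn mulr0 big1 // => i _.
apply: (@hcomp_neq (m + i)); first exact/in_degreeM/hcomp_in.
by rewrite eqn_add2l neq_ltn (leq_trans (ltn_ord i)).
Qed.

Lemma hcompM_lt m n a b : in_degree m a -> (n < m)%N -> hcomp n (a * b) = 0.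
Proof.
move=> am nm; have [N ->] := hcomp_decomp b; rewrite mulr_sumr hcomp_sum big1 // => i _.
apply: (@hcomp_neq (m + i)); first exact/in_degreeM/hcomp_in.
by rewrite neq_ltn (leq_trans nm (leq_addr _ _)) orbT.
Qed.

End Grading.

Section Maps.

Lemma pull_comp (X Y Z : sset) (f : smap X Y) (g : smap Y Z) (h : smap X Z) :
  (forall n (s : simplex X n), h n s = g n (f n s)) ->
  forall a, pullback f (pullback g a) = pullback h a.
Proof.
move=> hfg; elim/cls_ind => z; rewrite !pullback_cls; congr cls; apply: val_inj.
by apply: funext => -[n s]; rewrite /= /pull /= /smap_simplices /= hfg.
Qed.

Lemma pull_id (X : sset) (f : smap X X) :
  (forall n (s : simplex X n), f n s = s) -> forall a, pullback f a = a.
Proof.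
move=> fid; elim/cls_ind => z; rewrite !pullback_cls; congr cls; apply: val_inj.
by apply: funext => -[n s]; rewrite /= /pull /= /smap_simplices /= fid.
Qed.

Variables (X Y : sset) (phi : smap X Y).

Lemma pull_component n (f : cochain Y) : pull phi (component n f) = component n (pull phi f).
Proof. by apply: funext => x. Qed.

Lemma pull_hcomp n a : pullback phi (hcomp n a) = hcomp n (pullback phi a).
Proof.
elim/cls_ind: a => z; rewrite hcomp_cls !pullback_cls hcomp_cls; congr cls.
exact: val_inj.
Qed.

Lemma pull_degree n a : in_degree n a -> in_degree n (pullback phi a).
Proof. by move=> an; rewrite -(hcomp_id an) pull_hcomp; exact: hcomp_in. Qed.

Lemma pull_Sq k a : pullback phi (Sq k a) = Sq k (pullback phi a).
Proof.
elim/cls_ind: a => z; rewrite Sq_cls !pullback_cls Sq_cls; congr cls; apply: val_inj.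
apply: funext => x; rewrite /= /pull /= /sq_cochain /=; case: ifP => // _.
by rewrite -[component _ (pull phi z)]pull_component pull_cupi.
Qed.

End Maps.

Section SquareLinear.
Variable X : sset.

Lemma Sq_degree k n (a : cohomology X) : in_degree n a -> in_degree (n + k) (Sq k a).
Proof.
case=> z zn ->; rewrite Sq_cls; exists (sq_cocycle k z) => // x xnk /=.
rewrite /sq_cochain; case: ifP => // kx; rewrite (_ : component _ _ = 0) ?cupi0l //.
apply: funext => y; rewrite /component; case: eqP => // yx; apply: zn.
by rewrite yx; apply: contra_neq xnk => <-; rewrite subnK //; lia.
Qed.

(** The cross terms of the square of a sum are a cup-i product and its transpose, and their sum is
    the coboundary of the cup-(i + 1) product. Since i depends on the degree, the bounding cochain
    [h] is indexed by the degree below that of the simplex. *)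
Lemma SqD k (a b : cohomology X) : Sq k (a + b) = Sq k a + Sq k b.
Proof.
elim/cls_ind: a => z; elim/cls_ind: b => z'; rewrite -clsD !Sq_cls -clsD.
pose h M := let n := (M.+1 - k)%N in
  cupi (M.+1 - k.*2).+1 (component n z) (component n z').
apply/cls_eqP.
exists (fun x => if (k.*2 <= (tag x).+1)%N then h (tag x) x else 0) => /=.
apply: funext => x; rewrite -[RHS]/(sq_cochain k z x + sq_cochain k z' x + coboundary _ x).
rewrite /sq_cochain; rewrite componentD; case: ifP => [kx|kx]; last first.
  rewrite !add0r (@coboundary_local X _ 0) ?coboundary0 //.
  by move=> y ->; rewrite kx.
case xM: (tag x) kx => [|M] kx.
  rewrite [coboundary _ _](@coboundary_local X _ 0) ?coboundary0; last first.
    by move=> y; rewrite xM.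
  (* On a 0-simplex there is no room for a coboundary, but the cup product commutes there on the
     nose. *)
  rewrite addr0 sub0n; have -> : k = 0%N by lia.
  rewrite -[RHS]/((cupi 0 (component 0 z) (component 0 z) +
    cupi 0 (component 0 z') (component 0 z')) x).
  rewrite cupiDl !cupiDr; set A := cupi 0 _ _; set B := cupi 0 _ _.
  set C := cupi 0 _ _; set D := cupi 0 _ _.
  suff BC : B x = C x by rewrite -[LHS]/((A x + B x) + (C x + D x)) BC addrA -(addrA (A x)) addF2 addr0.
  case: x xM {A D} @B @C => n s /= n0; subst n; rewrite enum_ordSl.
  rewrite (_ : enum 'I_0 = [::]) /=; last by apply: size0nil; rewrite size_enum_ord.
  by rewrite !big_seq1 /= mulrC.
rewrite [coboundary _ x](@coboundary_local X _ (h M)); last first.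
  by move=> y; rewrite xM => -[->]; rewrite kx.
rewrite /h; set n := (M.+1 - k)%N; set i := (M.+1 - k.*2)%N.
rewrite cupi_coboundary !coboundary_component cupi0l cupi0r !add0r.
rewrite cupiDl !cupiDr; set A := cupi i _ _; set B := cupi i _ _.
set C := cupi i _ _; set D := cupi i _ _.
rewrite -[LHS]/(A x + B x + (C x + D x)) -[RHS]/(A x + D x + (B x + C x)).
by ring.
Qed.

End SquareLinear.

(** * Homotopy invariance of the pullback *)

Section Homotopy.

(** The labels of the vertices need not be monotone, because all maps of vertices act on simplices:
    this is the nerve of the indiscrete category on two objects. *)
Definition interval : sset.
Proof.
refine (@SSet (fun n => 'I_n.+1 -> bool) (fun=> false) (fun m n f s => s \o f) _ _).
- by move=> n s; apply: funext.
- by move=> l m n f g s; apply: funext.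
Defined.

(** The usual triangulation of the prism: an initial part of the list is taken at [false], the rest
    at [true], and the vertex where the level changes is repeated. *)
Fixpoint prisms (T : Type) (e : seq T) : seq (seq (T * bool)) :=
  if e is v :: e' then
    ((v, false) :: (v, true) :: map (pair^~ true) e') ::
    map (cons (v, false)) (prisms e')
  else [::].

Lemma prisms_map (T U : Type) (h : T -> U) e :
  prisms (map h e) = map (map (fun p => (h p.1, p.2))) (prisms e).
Proof.
elim: e => //= v e ->; congr (((_, _) :: (_, _) :: _) :: _); rewrite -!map_comp //; exact: eq_map.
Qed.

(** The boundary of the triangulated prism: a wall between two consecutive simplices occurs twice
    and cancels, leaving the two ends and the prisms on the faces. *)
Lemma prisms_dels (T : Type) (e : seq T) (F : seq (T * bool) -> 'F_2) :
  \sum_(p <- prisms e) \sum_(t <- dels p) F t =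
  F (map (pair^~ false) e) + F (map (pair^~ true) e) +
  \sum_(t <- dels e) \sum_(p <- prisms t) F p.
Proof.
elim: e F => [|v e IH] F; first by rewrite !big_nil addF2 addr0.
rewrite /= ?(big_cons, big_map) /= -/(dels [seq (x, true) | x <- e]).
rewrite [X in \sum_(_ <- X) F [:: (v, false), (v, true) & _]]dels_map big_map.
under [X in _ + X = _]eq_bigr do rewrite big_cons big_map.
under [X in _ = _ + (_ + X)]eq_bigr do rewrite big_cons big_map.
rewrite !big_split /= (IH (F \o cons (v, false))) /=.
move: (F _) (F _) (F _) => A B C.
rewrite !addrA; set D := \sum_(_ <- _) _; set E := \sum_(_ <- _) F _.
set G := \sum_(_ <- _) \sum_(_ <- _) _.
rewrite [LHS](_ : _ = A + C + E + D + G + (B + B)); last by ring.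
by rewrite addF2 addr0; ring.
Qed.

Variable X : sset.
Let XI := prod_sset X interval.

Definition slice_simplex (b : bool) n (s : simplex X n) : simplex XI n :=
  (s, fun=> b).
Definition slice_map b : smap X XI :=
  @SMap X XI (slice_simplex b) (fun _ _ _ _ => erefl).

Definition prism_face n (s : simplex X n) (e : seq ('I_n.+1 * bool)) : simplices XI :=
  existT (simplex XI) (size e).-1
    (Defs.act (fun i : 'I_(size e).-1.+1 => (nth (ord0, false) e i).1) s,
     fun i : 'I_(size e).-1.+1 => (nth (ord0, false) e i).2).

Definition eval_prism (f : cochain XI) n (s : simplex X n) e : 'F_2 :=
  if e is [::] then 0 else f (prism_face s e).

Definition homotopy (f : cochain XI) : cochain X :=
  fun x => \sum_(p <- prisms (enum 'I_(tag x).+1)) eval_prism f (tagged x) p.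

Lemma existT_prism n (s : simplex X n) m m' (f : 'I_m.+1 -> 'I_n.+1 * bool)
    (f' : 'I_m'.+1 -> 'I_n.+1 * bool) :
  m = m' -> (forall (i : 'I_m.+1) (j : 'I_m'.+1), i = j :> nat -> f i = f' j) ->
  existT (simplex XI) m (Defs.act (fst \o f) s, snd \o f) =
  existT (simplex XI) m' (Defs.act (fst \o f') s, snd \o f').
Proof.
move=> mm'; case: m' / mm' f' => f' ff'.
by have -> : f = f' by apply: funext => i; apply: ff'.
Qed.

Lemma prism_face_face n (s : simplex X n) e t : t != [::] ->
  prism_face (projT2 (face s e)) t =
  prism_face s [seq (nth ord0 e (val q.1), q.2) | q <- t].
Proof.
move=> t0; rewrite /prism_face /= -Defs.act_comp.
apply: (existT_prism s (f := fun i : 'I_(size t).-1.+1 =>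
  (nth ord0 e (val (nth (ord0, false) t i).1), (nth (ord0, false) t i).2))
  (f' := fun i => nth (ord0, false) [seq (nth ord0 e (val q.1), q.2) | q <- t] i)).
  by rewrite size_map.
move=> i j ij /=; rewrite (nth_map (ord0, false)) ?ij //.
by rewrite -ij (leq_trans (ltn_ord i)) // prednK // lt0n size_eq0.
Qed.

Lemma eval_homotopy f n (s : simplex X n) e :
  eval_face (homotopy f) s e = \sum_(p <- prisms e) eval_prism f s p.
Proof.
have [->|e0] := eqVneq e [::]; first by rewrite big_nil.
rewrite -eval_faceE // -[e in RHS](map_nth_enum e0) prisms_map big_map.
apply: eq_bigr => -[|v p] _ //.
by rewrite -[LHS]/(f (prism_face (projT2 (face s e)) (v :: p))) prism_face_face.
Qed.

Lemma prism_face_rem n (s : simplex X n) e t : t != [::] ->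
  face (projT2 (prism_face s e)) t = prism_face s [seq nth (ord0, false) e (val i) | i <- t].
Proof.
move=> t0; rewrite /prism_face /face /= -Defs.act_comp.
apply: (existT_prism s (f := fun i : 'I_(size t).-1.+1 =>
  nth (ord0, false) e (nth ord0 t i))
  (f' := fun i => nth (ord0, false) [seq nth (ord0, false) e (val i) | i <- t] i)).
  by rewrite size_map.
move=> i j ij /=; rewrite (nth_map ord0) ?ij //.
by rewrite -ij (leq_trans (ltn_ord i)) // prednK // lt0n size_eq0.
Qed.

Lemma eval_prism_coboundary (f : cochain XI) n (s : simplex X n) e :
  eval_prism (coboundary f) s e = \sum_(t <- dels e) eval_prism f s t.
Proof.
have [->|e0] := eqVneq e [::]; first by rewrite big_nil.
have eE : [seq nth (ord0, false) e (val i) | i <- enum 'I_(size e).-1.+1] = e.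
  apply: (@eq_from_nth _ (ord0, false)).
    by rewrite size_map size_enum_ord prednK // lt0n size_eq0.
  move=> i; rewrite size_map => ie; rewrite (nth_map ord0) //=.
  by rewrite nth_enum_ord // -[X in (_ < X)%N](size_enum_ord (size e).-1.+1).
rewrite -[e in RHS]eE dels_map big_map.
have -> : eval_prism (coboundary f) s e = coboundary f (prism_face s e) by case: (e) e0.
rewrite -[prism_face s e]/(existT (simplex XI) _ (projT2 (prism_face s e))).
rewrite -face_enum coboundary_face; last by rewrite -size_eq0 size_enum_ord.
apply: eq_bigr => -[|v t] _ //.
by rewrite -[LHS]/(f (face (projT2 (prism_face s e)) (v :: t))) prism_face_rem.
Qed.

Lemma homotopy_coboundary (f : cochain XI) :
  coboundary (homotopy f) + homotopy (coboundary f) =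
  pull (slice_map false) f + pull (slice_map true) f.
Proof.
apply: cochainP => n s e e0; rewrite !eval_faceE // !eval_faceD.
rewrite eval_coboundary eval_homotopy.
under eq_bigr do rewrite eval_homotopy.
under [X in _ + X]eq_bigr do rewrite eval_prism_coboundary.
rewrite prisms_dels addrCA addF2 addr0.
have sliceE b : eval_face (pull (slice_map b) f) s e = eval_prism f s (map (pair^~ b) e).
  rewrite -eval_faceE // [RHS](_ : _ = f (prism_face s (map (pair^~ b) e))); last by case: (e) e0.
  congr f; rewrite /face /smap_simplices /=.
  apply: (existT_prism s (f := fun i : 'I_(size e).-1.+1 => (nth ord0 e i, b))
     (f' := fun i => nth (ord0, false) (map (pair^~ b) e) i)); first by rewrite size_map.
  move=> i j ij; rewrite (nth_map ord0) ?ij //.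
  by rewrite -ij (leq_trans (ltn_ord i)) // prednK // lt0n size_eq0.
by rewrite !sliceE addrC.
Qed.

Lemma slice_pullback : pullback (slice_map false) =1 pullback (slice_map true).
Proof.
elim/cls_ind => z; rewrite !pullback_cls; apply/cls_eqP; exists (homotopy z) => /=.
have [dz _] := cocycleP z; have := homotopy_coboundary z; rewrite dz.
have -> : homotopy 0 = 0.
  by apply: funext => x; rewrite /homotopy big1 // => -[].
rewrite addr0 => ->.
by rewrite addrCA addCC addr0.
Qed.

End Homotopy.

(** Serves to straighten the double cover of a nerve and to conjugate a representation. In both
    cases the homotopy is a change of gauge at the vertices marked [true]. *)
Lemma homotopic_pullback (X Y : sset) (f g : smap X Y)
    (H : smap (prod_sset X interval) Y) :
  (forall n (s : simplex X n), H n (s, fun=> false) = f n s) ->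
  (forall n (s : simplex X n), H n (s, fun=> true) = g n s) ->
  pullback f =1 pullback g.
Proof.
move=> Hf Hg a; have Hf' n (s : simplex X n) : f n s = H n (slice_map X false n s).
  by rewrite -Hf.
have Hg' n (s : simplex X n) : g n s = H n (slice_map X true n s) by rewrite -Hg.
by rewrite -(pull_comp Hf') -(pull_comp Hg') slice_pullback.
Qed.

(** * Homomorphisms, and the cohomology of the nerve in degrees 0 and 1 *)

Record ghom (hT gT : finGroupType) := GHom {
  ghom_fun :> hT -> gT;
  ghomM : forall x y, ghom_fun (x * y)%g = (ghom_fun x * ghom_fun y)%g }.

Lemma addF2_eq0 (x y : 'F_2) : x + y = 0 -> x = y.
Proof. by move/eqP; rewrite addr_eq0 oppF2 => /eqP. Qed.

Section NerveMap.
Variables (hT gT : finGroupType) (f : ghom hT gT).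

Lemma ghom1 : f 1%g = 1%g.
Proof. by apply: (mulgI (f 1%g)); rewrite -ghomM !mulg1. Qed.

Lemma ghomV x : f x^-1%g = (f x)^-1%g.
Proof. by apply: (mulgI (f x)); rewrite -ghomM !mulgV ghom1. Qed.

Lemma ghomX x n : f (x ^+ n)%g = (f x ^+ n)%g.
Proof. by elim: n => [|n IH]; rewrite ?expg0 ?ghom1 // !expgS ghomM IH. Qed.

Definition Bmap_simplex n (s : nerve_simplex hT n) : nerve_simplex gT n :=
  @NerveSimplex gT n (fun i j => f (label s i j))
    (fun i j k => etrans (esym (ghomM f _ _)) (congr1 f (labelM s i j k))).

Definition Bmap : smap (nerve hT) (nerve gT).
Proof.
refine (@SMap (nerve hT) (nerve gT) Bmap_simplex _).
by move=> m n g s; exact: nerve_simplexP.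
Defined.

End NerveMap.

Lemma label1 (gT : finGroupType) n (s : nerve_simplex gT n) i : label s i i = 1%g.
Proof. by apply: (mulgI (label s i i)); rewrite labelM mulg1. Qed.

Notation H gT := (cohomology (nerve gT)).
Notation res f := (pullback (Bmap f)).

Lemma res_comp (kT hT gT : finGroupType) (f : ghom kT hT) (g : ghom hT gT)
    (h : ghom kT gT) : (forall x, h x = g (f x)) ->
  forall a, res f (res g a) = res h a.
Proof. by move=> hfg; apply: pull_comp => n s; apply: nerve_simplexP => i j /=. Qed.

Lemma res_id (gT : finGroupType) (f : ghom gT gT) : f =1 id -> res f =1 id.
Proof. by move=> fid; apply: pull_id => n s; apply: nerve_simplexP => i j /=; rewrite fid. Qed.

Section Character.
Variable gT : finGroupType.
Implicit Type chi : ghom gT 'F_2.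

Lemma chiM chi x y : chi (x * y)%g = chi x + chi y.
Proof. exact: ghomM. Qed.

Lemma chi1 chi : chi 1%g = 0.
Proof. exact: ghom1. Qed.

Lemma chiV chi x : chi x^-1%g = chi x.
Proof. by rewrite ghomV -[RHS]oppF2. Qed.

Lemma chi_label chi n (s : nerve_simplex gT n) i j k :
  chi (label s i j) + chi (label s j k) = chi (label s i k).
Proof. by rewrite -chiM labelM. Qed.

Definition chi_cochain chi : cochain (nerve gT) := fun x =>
  if tag x == 1%N then chi (label (projT2 x) ord0 ord_max) else 0.

Lemma eval_chi chi n (s : nerve_simplex gT n) (e : seq 'I_n.+1) :
  @eval_face (nerve gT) (chi_cochain chi) n s e =
  if e is [:: v; w] then chi (label s v w) else 0.
Proof. by case: e => [|v [|w [|x e]]]. Qed.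

Lemma chi_cocycle_subproof chi : @is_cocycle (nerve gT) (chi_cochain chi).
Proof.
apply/asboolP; split; last first.
  by exists 2 => x; rewrite /chi_cochain; case: eqP => // ->.
apply: cochainP => n s e e0; rewrite !eval_faceE // eval_coboundary.
under eq_bigr do rewrite eval_chi.
rewrite [RHS](_ : _ = 0) //; case: e e0 => // u [|v [|w [|x e]]] _.
- by rewrite big_seq1.
- by rewrite !big_cons big_nil /= !addr0.
- rewrite !big_cons big_nil /= -(chi_label chi s u v w).
  move: (chi _) (chi _) => b c.
  by rewrite (_ : _ + _ = (b + b) + (c + c)); [rewrite !addF2 | ring].
- rewrite big1_seq // => t /size_dels /=.
  by case: t => [|? [|? [|? ?]]].
Qed.

Definition chi_cocycle chi : cocycle (nerve gT) := Cocycle (chi_cocycle_subproof chi).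
Definition chi_class chi : H gT := cls (chi_cocycle chi).

Lemma chi_cochain_degree chi x : tag x != 1%N -> chi_cochain chi x = 0.
Proof. by rewrite /chi_cochain => /negPf ->. Qed.

Lemma chi_degree chi : in_degree 1 (chi_class chi).
Proof. exists (chi_cocycle chi) => // x; exact: chi_cochain_degree. Qed.

Lemma chi_class_ext chi chi' : chi =1 chi' -> chi_class chi = chi_class chi'.
Proof.
move=> cc; congr cls; apply: val_inj; apply: funext => x /=.
by rewrite /chi_cochain cc.
Qed.

Lemma chi_classD chi chi' chi'' : (forall x, chi'' x = chi x + chi' x) ->
  chi_class chi'' = chi_class chi + chi_class chi'.
Proof.
move=> cc; rewrite /chi_class -clsD; congr cls; apply: val_inj; apply: funext => x /=.
rewrite -[RHS]/(chi_cochain chi x + chi_cochain chi' x) /chi_cochain cc.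
by case: eqP => // _; rewrite addr0.
Qed.

Lemma simplex0 (s t : nerve_simplex gT 0) : s = t.
Proof. by apply: nerve_simplexP => i j; rewrite !ord1 !label1. Qed.

Lemma simplices0 (x y : simplices (nerve gT)) : tag x = 0%N -> tag y = 0%N -> x = y.
Proof.
case: x y => n s [m t] /= n0 m0; rewrite n0 in s *; rewrite m0 in t *.
by congr existT; exact: simplex0.
Qed.

Definition edge_label (g : gT) (i j : 'I_2) : gT :=
  if i == j then 1%g else if i == ord0 then g else g^-1%g.

Lemma edge_labelM g i j k : (edge_label g i j * edge_label g j k)%g = edge_label g i k.
Proof.
by case: i j k => [[|[|//]] ?] [[|[|//]] ?] [[|[|//]] ?];
  rewrite /edge_label /= ?mul1g ?mulg1 ?mulgV ?mulVg.
Qed.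

Definition edge g : nerve_simplex gT 1 := NerveSimplex (edge_labelM g).

Lemma edgeP (s : nerve_simplex gT 1) : s = edge (label s ord0 ord_max).
Proof.
apply: nerve_simplexP => -[[|[|//]] ?] [[|[|//]] ?]; rewrite /= /edge_label /= ?label1 //.
- by rewrite -[RHS](label1 s (Ordinal (erefl (0 < 2)%N))); congr label; apply: val_inj.
- by congr label; apply: val_inj.
- set p := label _ _ _; set q := label _ _ _; apply/eqP; rewrite eq_mulgV1 invgK.
  rewrite /p /q (_ : Ordinal _ = ord_max); last exact: val_inj.
  by rewrite (_ : Ordinal _ = ord0) ?labelM ?label1 //; apply: val_inj.
- by rewrite -[RHS](label1 s (Ordinal (erefl (1 < 2)%N))); congr label; apply: val_inj.
Qed.

(** Both ends of an edge are the only vertex of the nerve, so a coboundary vanishes on every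
    edge. *)
Lemma chi_class_eq0 chi : chi_class chi = 0 -> forall g, chi g = 0.
Proof.
case/cls_eq0 => f fE g.
have := congr1 (fun h => h (existT _ 1%N (edge g))) fE.
rewrite /= /chi_cochain /= /edge_label /= => ->.
rewrite !big_ord_recl big_ord0 addr0.
set x := face _ _; set y := face _ _; rewrite (_ : x = y) ?addF2 //.
by apply: simplices0; rewrite /= size_rem ?mem_enum ?size_enum_ord.
Qed.

Lemma degree0P (a : H gT) : in_degree 0 a -> a = 0 \/ a = 1.
Proof.
case=> z z0 ->; set x0 : simplices (nerve gT) := existT (simplex (nerve gT)) 0%N (vertex (nerve gT)).
have zE x : tag x = 0%N -> cochain_of z x = cochain_of z x0.
  by move=> x0'; congr (cochain_of z _); exact: simplices0.
case: (altP (cochain_of z x0 =P 0)) => [zx0|zx0]; [left|right].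
  apply/cls_eq0; exists 0; rewrite coboundary0; apply: funext => x /=.
  by have [x0'|] := eqVneq (tag x) 0%N; [rewrite zE ?zx0 | exact: z0].
congr cls; apply: val_inj; apply: funext => x /=; rewrite /cochain1.
have [x0'|] := eqVneq (tag x) 0%N; last exact: z0.
by rewrite zE //; case: (cochain_of z x0) zx0 => [[|[|//]] ?] // _; apply: val_inj.
Qed.

(** A cocycle of degree 1 is determined by its values on the simplices [edge g], and the cocycle
    condition on 2-simplices is additivity in g. *)
Lemma degree1P (a : H gT) : in_degree 1 a -> exists chi, a = chi_class chi.
Proof.
case=> z z1 ->; have [dz _] := cocycleP z.
pose c g := cochain_of z (existT (simplex (nerve gT)) 1%N (edge g)).
have zE n (s : nerve_simplex gT n) (v w : 'I_n.+1) :
    @eval_face (nerve gT) z n s [:: v; w] = c (label s v w).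
  rewrite /= /c; congr (cochain_of z _); congr existT; rewrite [LHS]edgeP.
  by congr edge.
have cM x y : c (x * y)%g = (c x * c y)%g.
  (* The vertices 1, x, xy span a 2-simplex with edges labelled x, y and xy. *)
  pose lab (i : 'I_3) := if i == 0%N :> nat then 1%g else if i == 1%N :> nat then x else (x * y)%g.
  have labM i j k : ((lab i)^-1 * lab j * ((lab j)^-1 * lab k) = (lab i)^-1 * lab k)%g.
    by rewrite !mulgA mulgK.
  pose s := @NerveSimplex gT 2 (fun i j => (lab i)^-1 * lab j)%g labM.
  pose o0 : 'I_3 := ord0; pose o1 : 'I_3 := inord 1; pose o2 : 'I_3 := inord 2.
  have := congr1 (fun h => h (@face (nerve gT) 2 s [:: o0; o1; o2])) dz.
  rewrite coboundary_face // 3!big_cons big_nil !zE addr0 /=.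
  rewrite /lab !inordK //= invg1 !mul1g mulKg => c0.
  rewrite -[RHS]/(c x + c y); apply: addF2_eq0; rewrite -[RHS]c0 /=.
  by rewrite addrA addrC.
exists (GHom cM); congr cls; apply: val_inj; apply: funext => -[n s] /=.
rewrite /chi_cochain /=; case: eqP => [n1|/eqP n1]; last exact: (z1 (existT (simplex (nerve gT)) n s)).
by move: s; rewrite n1 => s; rewrite /c -edgeP.
Qed.

End Character.

Lemma res_chi (hT gT : finGroupType) (f : ghom hT gT) (chi : ghom gT 'F_2)
    (chi' : ghom hT 'F_2) : (forall x, chi' x = chi (f x)) ->
  res f (chi_class chi) = chi_class chi'.
Proof.
move=> cc; rewrite pullback_cls; congr cls; apply: val_inj; apply: funext => x /=.
by rewrite /pull /chi_cochain /= cc.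
Qed.

Lemma res_chi0 (hT gT : finGroupType) (f : ghom hT gT) (chi : ghom gT 'F_2) :
  (forall x, chi (f x) = 0) -> res f (chi_class chi) = 0.
Proof.
move=> cc; rewrite pullback_cls; apply/cls_eq0; exists 0; rewrite coboundary0.
by apply: funext => x /=; rewrite /pull /chi_cochain /= cc; case: eqP.
Qed.

(** * Double covers and transfer *)

Lemma F2P (c : 'F_2) : c = 0 \/ c = 1.
Proof. by case: c => [[|[|//]] ?]; [left | right]; apply: val_inj. Qed.

Section Cover.
Variables (gT : finGroupType) (chi : ghom gT 'F_2).
Local Notation X := (nerve gT).
Local Notation u := (chi_cochain chi).

(* The double cover of BG defined by chi, a model of B(ker chi). Its Gysin sequence
   comes from cutting a cochain of the cover into the pair of its slices. *)
Record cover_simplex (n : nat) := CoverSimplex {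
  base : nerve_simplex gT n;
  sheet : 'I_n.+1 -> 'F_2;
  sheetP : forall i j, sheet j = sheet i + chi (label base i j) }.

Lemma cover_simplexP n (s t : cover_simplex n) :
  base s = base t -> sheet s =1 sheet t -> s = t.
Proof.
case: s t => [b e eP] [b' e' e'P] /= bb' /funext ee'.
by case: b' / bb' e'P => e'P; case: e' / ee' e'P => e'P; congr CoverSimplex; exact: Prop_irrelevance.
Qed.

Definition cover_act m n (f : 'I_m.+1 -> 'I_n.+1) (s : cover_simplex n) : cover_simplex m :=
  @CoverSimplex m (nerve_act f (base s)) (sheet s \o f) (fun _ _ => sheetP s _ _).

Lemma cover_vertex_subproof (i j : 'I_1) :
  (0 : 'F_2) = 0 + chi (label (vertex X) i j).
Proof. by rewrite chi1 addr0. Qed.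

Definition cover : sset.
Proof.
refine (@SSet cover_simplex (CoverSimplex cover_vertex_subproof) cover_act _ _).
- by move=> n s; apply: cover_simplexP => //=; exact: nerve_simplexP.
- by move=> l m n f g s; apply: cover_simplexP => //=; exact: nerve_simplexP.
Defined.

Definition cover_proj : smap cover X := @SMap cover X base (fun _ _ _ _ => erefl).

Lemma lift_subproof (c : 'F_2) n (s : nerve_simplex gT n) (i j : 'I_n.+1) :
  c + chi (label s ord0 j) = c + chi (label s ord0 i) + chi (label s i j).
Proof. by rewrite -addrA chi_label. Qed.

Definition lift_simplex c n s : simplex cover n := CoverSimplex (@lift_subproof c n s).

Definition lift c (x : simplices X) : simplices cover :=
  existT (simplex cover) (tag x) (lift_simplex c (projT2 x)).

Definition slice (f : cochain cover) c : cochain X := f \o lift c.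

(** The transfer on cochains. Together with the slice over sheet 0 it determines the cochain, so the
    complex of the cover is an extension of that of the base by itself. *)
Definition trans (f : cochain cover) : cochain X := slice f 0 + slice f 1.

Lemma face_lift n (s : simplex X n) c e :
  face (lift_simplex c s) e = lift (c + chi (label s ord0 (nth ord0 e 0))) (face s e).
Proof.
rewrite /lift /face /=; congr existT; apply: cover_simplexP => // i /=.
by rewrite -addrA chi_label.
Qed.

Lemma eval_lift f n (s : simplex X n) c v e :
  @eval_face cover f n (lift_simplex c s) (v :: e) =
  eval_face (slice f (c + chi (label s ord0 v))) s (v :: e).
Proof. by rewrite /= face_lift. Qed.

Lemma slice_face f n (s : simplex X n) c v e :
  eval_face (slice f c) s (v :: e) =
  @eval_face cover f n (lift_simplex (c + chi (label s ord0 v)) s) (v :: e).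
Proof. by rewrite eval_lift -addrA addF2 addr0. Qed.

Lemma sliceE f c : slice f c = slice f 0 + (fun x => c * trans f x).
Proof.
apply: funext => x; rewrite -[RHS]/(slice f 0 x + c * (slice f 0 x + slice f 1 x)).
by have [->|->] := F2P c; rewrite ?mul0r ?addr0 // mul1r addrA addF2 add0r.
Qed.

Lemma coverP f g : (forall c, slice f c = slice g c) -> f = g.
Proof.
move=> fg; apply: funext => -[n y].
have -> : existT (simplex cover) n y = lift (sheet y ord0) (existT (simplex X) n (base y)).
  rewrite /lift /=; congr existT; apply: cover_simplexP => //= i.
  exact: sheetP.
exact: (congr1 (fun h => h _) (fg _)).
Qed.

Lemma eval_cup_chi (g : cochain X) n (s : simplex X n) v w e :
  eval_face (cupi 0 u g) s [:: v, w & e] = chi (label s v w) * eval_face g s (w :: e).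
Proof.
rewrite cupi_eval.
rewrite (blocks1_cons _ _ (fun a b => eval_face u s a * eval_face g s b)).
rewrite (blocks1_cons _ _ (fun a b => eval_face u s (v :: a) * eval_face g s b)).
rewrite !eval_chi mul0r addr0 big1_seq ?add0r // => p /andP[_ /blocks_neq0/andP[]].
by rewrite eval_chi; case: (p.1) => // *; rewrite mul0r.
Qed.

Lemma eval_cup_chi1 (g : cochain X) n (s : simplex X n) v :
  eval_face (cupi 0 u g) s [:: v] = 0.
Proof. by rewrite cupi_eval /= big_seq1 eval_chi mul0r. Qed.

(** Deleting vertex 0 is the only face operation that moves the start of a lift, to the sheet
    shifted by the label of the first edge. The discrepancy is a cup product with [u], which makes
    multiplication by the character the connecting map of the Gysin sequence. *)
Lemma slice_coboundary f c :
  coboundary (slice f c) = slice (coboundary f) c + cupi 0 u (trans f).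
Proof.
apply: cochainP => n s e e0; rewrite !eval_faceE // eval_faceD eval_coboundary.
case: e e0 => // v [|w e] _.
  by rewrite eval_cup_chi1 addr0 slice_face eval_coboundary /= !big_seq1.
rewrite slice_face eval_coboundary eval_cup_chi.
rewrite ![\sum_(_ <- dels _) _]big_cons !big_map.
under [X in _ = _ + X + _]eq_bigr do rewrite eval_lift -addrA addF2 addr0.
rewrite addrAC; congr (_ + _); rewrite eval_lift -addrA -[in RHS](chi_label chi s ord0 v w).
rewrite (addrA (chi _)) addF2 add0r.
rewrite -[LHS]/(slice f c (face s (w :: e))) -[RHS]/(slice f (c + chi (label s v w)) (face s (w :: e)) +
  chi (label s v w) * trans f (face s (w :: e))) sliceE [in RHS]sliceE.
move: (face s _) (chi _) => x k; rewrite -[LHS]/(slice f 0 x + c * trans f x).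
rewrite -[RHS]/(slice f 0 x + (c + k) * trans f x + k * trans f x).
by rewrite mulrDl -!addrA addF2 addr0.
Qed.

Lemma trans_coboundary f : coboundary (trans f) = trans (coboundary f).
Proof.
rewrite /trans coboundaryD !slice_coboundary addrACA addCC addr0 //.
Qed.

Lemma transD f g : trans (f + g) = trans f + trans g.
Proof. by apply: funext => x; rewrite -[RHS]/(_ + _ + (_ + _)) addrACA. Qed.

Lemma slice_proj (g : cochain X) c : slice (pull cover_proj g) c = g.
Proof. by apply: funext => -[n s]. Qed.

Lemma trans_proj (g : cochain X) : trans (pull cover_proj g) = 0.
Proof. by rewrite /trans !slice_proj addCC. Qed.

Lemma slice_cup f (g : cochain X) c :
  slice (cupi 0 f (pull cover_proj g)) c = cupi 0 (slice f c) g.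
Proof.
apply: cochainP => n s e e0; rewrite !eval_faceE //.
case: e e0 => // v e _; rewrite slice_face !cupi_eval.
have gE e' : @eval_face cover (pull cover_proj g) n
    (lift_simplex (c + chi (label s ord0 v)) s) e' = eval_face g s e' by case: e'.
rewrite (blocks1_cons _ _ (fun a b => @eval_face cover f n _ a * @eval_face cover _ n _ b)).
rewrite [RHS](blocks1_cons _ _ (fun a b => eval_face (slice f c) s a * eval_face g s b)).
rewrite !slice_face gE; congr (_ + _); apply: eq_bigr => p _.
by rewrite gE slice_face.
Qed.

Lemma trans_cup f (g : cochain X) :
  trans (cupi 0 f (pull cover_proj g)) = cupi 0 (trans f) g.
Proof. by rewrite /trans !slice_cup cupiDl. Qed.

(** The cochain with slice [p] over sheet 0 and transfer [q]: the extension splits on cochains,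
    though not compatibly with the coboundary. *)
Definition glue (p q : cochain X) : cochain cover := fun y =>
  p (smap_simplices cover_proj y) + sheet (projT2 y) ord0 * q (smap_simplices cover_proj y).

Lemma slice_glue p q c : slice (glue p q) c = p + (fun x => c * q x).
Proof.
apply: funext => -[n s]; rewrite /slice /glue /= label1 chi1 addr0.
by [].
Qed.

Lemma trans_glue p q : trans (glue p q) = q.
Proof.
rewrite /trans !slice_glue addrACA addCC add0r.
by apply: funext => x; rewrite -[LHS]/(0 * q x + 1 * q x) mul0r mul1r add0r.
Qed.

Lemma coboundary_scale (c : 'F_2) (f : cochain X) :
  coboundary (fun x => c * f x) = fun x => c * coboundary f x.
Proof.
have [->|->] := F2P c.
  by rewrite (_ : (fun x => 0 * f x) = 0) ?coboundary0; apply: funext => x; rewrite mul0r.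
by rewrite (_ : (fun x => 1 * f x) = f); apply: funext => x; rewrite mul1r.
Qed.

Lemma trans_subproof (z : cocycle cover) : @is_cocycle X (trans z).
Proof.
have [dz [N zN]] := cocycleP z; apply/asboolP.
rewrite trans_coboundary dz; split.
  by apply: funext => x; rewrite /trans -[LHS]/(0 + 0) addr0.
by exists N => x Nx; rewrite -[LHS]/(cochain_of z _ + cochain_of z _) !zN ?addr0.
Qed.

Definition trans_cocycle z : cocycle X := Cocycle (trans_subproof z).

Definition transfer (a : cohomology cover) : cohomology X :=
  cls (trans_cocycle (generic_quotient.repr a)).

Lemma transfer_cls z : transfer (cls z) = cls (trans_cocycle z).
Proof.
have /cls_eqP[f zf] : cls (generic_quotient.repr (cls z)) = cls z by exact: reprP.
apply/cls_eqP; exists (trans f); rewrite trans_coboundary /= zf.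
by rewrite transD.
Qed.

Lemma transferD : {morph transfer : a b / a + b}.
Proof.
elim/cls_ind => z; elim/cls_ind => z'; rewrite -clsD !transfer_cls -clsD.
by congr cls; apply: val_inj => /=; rewrite transD.
Qed.

Lemma transfer_degree n a : in_degree n a -> in_degree n (transfer a).
Proof.
case=> z zn ->; rewrite transfer_cls; exists (trans_cocycle z) => // x xn.
by rewrite -[LHS]/(cochain_of z _ + cochain_of z _) !zn ?addr0.
Qed.

Lemma transferM a b : transfer (a * pullback cover_proj b) = transfer a * b.
Proof.
elim/cls_ind: a => z; elim/cls_ind: b => z'.
rewrite pullback_cls clsM !transfer_cls clsM; congr cls; apply: val_inj.
exact: trans_cup.
Qed.

Lemma transfer_proj a : transfer (pullback cover_proj a) = 0.
Proof.
elim/cls_ind: a => z; rewrite pullback_cls transfer_cls; apply/cls_eq0.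
by exists 0; rewrite coboundary0 /= trans_proj.
Qed.

Lemma chi_transfer a : chi_class chi * transfer a = 0.
Proof.
elim/cls_ind: a => z; rewrite transfer_cls clsM; apply/cls_eq0.
exists (slice z 0); rewrite slice_coboundary; have [-> _] := cocycleP z.
by rewrite (_ : slice 0 0 = 0) ?add0r.
Qed.

(** When the pullback of z is the coboundary of f', [slice_coboundary] shows that z and the product
    of u with the transfer of f' differ by the coboundary of a slice. *)
Lemma proj_eq0 n (a : H gT) : in_degree n.+1 a -> pullback cover_proj a = 0 ->
  exists2 b, in_degree n b & a = chi_class chi * b.
Proof.
case/in_degreeP=> z zn ->; rewrite pullback_cls => /cls_eq0[f zf].
pose f' := component n f.
have df' : coboundary f' = pull cover_proj z.
  by rewrite component_coboundary -zf /= -pull_component zn.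
have bP : @is_cocycle X (trans f').
  apply/asboolP; split; first by rewrite trans_coboundary df' trans_proj.
  exists n.+1 => x nx; rewrite /trans -[LHS]/(component _ _ _ + component _ _ _) /component /=.
  by rewrite (gtn_eqF nx) addr0.
exists (cls (Cocycle bP)).
  exists (Cocycle bP) => // x /negPf xn /=.
  by rewrite -[LHS]/(component _ _ _ + component _ _ _) /component /= xn addr0.
rewrite clsM; apply/cls_eqP; exists (slice f' 0) => /=.
by rewrite slice_coboundary df' slice_proj addrCA addCC addr0.
Qed.

(** Makes the bounding cochain homogeneous. A coboundary of degree 0 is zero, which settles the
    bottom case. *)
Lemma low_degree_bounding (Y : sset) n (z : cocycle Y) f :
  component n z = z -> cochain_of z = coboundary f ->
  exists2 g, cochain_of z = coboundary g & forall x, (tag x).+1 != n -> g x = 0.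
Proof.
move=> zn zf; case: n zn => [|n] zn; last first.
  exists (component n f); first by rewrite component_coboundary -zf zn.
  by move=> x; rewrite eqSS /component => /negPf ->.
exists 0 => //; rewrite coboundary0 -zn zf; apply: funext => x; rewrite /component.
case: eqP => // x0; rewrite (@coboundary_local _ _ 0) ?coboundary0 // => y.
by rewrite x0.
Qed.

Lemma transfer_eq0 n (a : cohomology cover) : in_degree n a -> transfer a = 0 ->
  exists2 b, in_degree n b & a = pullback cover_proj b.
Proof.
case/in_degreeP=> z zn ->; rewrite transfer_cls => /cls_eq0[r0].
have tzn : component n (trans z) = trans z.
  apply: funext => x; rewrite /component; case: eqP => // /eqP xn.
  rewrite /trans -[RHS]/(cochain_of z _ + cochain_of z _) -zn /component /= (negPf xn).
  by rewrite addr0.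
move/(low_degree_bounding (z := trans_cocycle z) tzn) => [r /= zr rn].
have [dz _] := cocycleP z.
have du : coboundary u = 0 by have [] := cocycleP (chi_cocycle chi).
have bn x : tag x != n -> (slice z 0 + cupi 0 u r) x = 0.
  move=> xn; rewrite -[LHS]/(cochain_of z _ + cupi 0 u r x) -zn /component /= (negPf xn) add0r.
  case: n xn {zn tzn} rn => [|n] xn rn; last first.
    apply: (@cupi_degree _ 0 1 n _ _ (@chi_cochain_degree _ chi)); last by rewrite addn0.
    by move=> y yn; apply: rn.
  by rewrite (_ : r = 0) ?cupi0r //; apply: funext => y; rewrite rn.
(* The coboundary of the slice is u times the transfer of z, and this transfer is the coboundary of
   [r]; adding the product of u and [r] compensates for it. *)
have bP : @is_cocycle X (slice z 0 + cupi 0 u r).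
  apply/asboolP; split; last first.
    by exists n.+1 => x nx; apply: bn; rewrite neq_ltn nx orbT.
  rewrite coboundaryD slice_coboundary dz cupi_coboundary du cupi0l -zr.
  rewrite (_ : slice 0 0 = 0) //.
  rewrite addr0; exact: addCC.
exists (cls (Cocycle bP)); first by exists (Cocycle bP).
rewrite pullback_cls; apply/cls_eqP; exists (glue 0 r); apply: coverP => c.
rewrite -[slice (_ + _) c]/(slice (pull cover_proj (slice z 0 + cupi 0 u r)) c +
  slice (coboundary (glue 0 r)) c).
have -> : slice (coboundary (glue 0 r)) c = (fun x => c * trans z x) + cupi 0 u r.
  have := slice_coboundary (glue 0 r) c.
  rewrite trans_glue slice_glue add0r coboundary_scale -zr => ->.
  by rewrite -addrA addCC addr0.
by rewrite slice_proj addrACA addCC addr0 -sliceE.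
Qed.

(** If u z is the coboundary of p, the cochain glued from p and z is a cocycle of the cover, and its
    transfer is z. *)
Lemma chi_mul_eq0 n (a : H gT) : in_degree n a -> chi_class chi * a = 0 ->
  exists2 b, in_degree n b & a = transfer b.
Proof.
case/in_degreeP=> z zn ->; rewrite clsM => /cls_eq0[p0 zp0].
have un : component n.+1 (cupi 0 u z) = cupi 0 u z.
  apply: funext => x; rewrite /component; case: eqP => // /eqP xn; apply/esym.
  apply: (@cupi_degree _ 0 1 n _ _ (@chi_cochain_degree _ chi)); last by rewrite addn0.
  by move=> y /negPf yn; rewrite -zn /component yn.
pose p := component n p0.
have dp : coboundary p = cupi 0 u z by rewrite component_coboundary -[RHS]un -zp0.
have [dz _] := cocycleP z.
have bn x : tag x != n -> glue p z x = 0.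
  by move=> /negPf xn; rewrite /glue /p -zn /component /= xn mulr0 addr0.
have bP : @is_cocycle cover (glue p z).
  apply/asboolP; split; last first.
    by exists n.+1 => x nx; apply: bn; rewrite neq_ltn nx orbT.
  apply: coverP => c; have := slice_coboundary (glue p z) c.
  rewrite trans_glue slice_glue coboundaryD coboundary_scale dz dp.
  move=> dE; rewrite -[LHS]addr0 -(addCC (cupi 0 u z)) addrA -dE addrAC addCC add0r.
  by apply: funext => x; exact: mulr0.
exists (cls (Cocycle bP)); first by exists (Cocycle bP).
by rewrite transfer_cls; congr cls; apply: val_inj; rewrite /= trans_glue.
Qed.

End Cover.

(** The representative [rep] of the other coset is part of the data: it fixes the equivalence
    between the cover and the nerve of the subgroup, and [res_tr_natural] asks the homomorphism to
    respect it. *)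
Record index2 (hT gT : finGroupType) := Index2 {
  inc : ghom hT gT;
  sgn : ghom gT 'F_2;
  rep : gT;
  index2_inj : injective inc;
  sgn_inc : forall h, sgn (inc h) = 0;
  inc_ker : forall g, sgn g = 0 -> exists h, inc h = g;
  sgn_rep : sgn rep = 1 }.

Section Index2.
Variables (hT gT : finGroupType) (d : index2 hT gT).
Local Notation chi := (sgn d).
Local Notation Y := (cover chi).

Definition incV (g : gT) : hT := odflt 1%g [pick h | inc d h == g].

Lemma incK h : incV (inc d h) = h.
Proof.
rewrite /incV; case: pickP => [h' /eqP/(@index2_inj _ _ d)//|/(_ h)].
by rewrite eqxx.
Qed.

Lemma incVK g : chi g = 0 -> inc d (incV g) = g.
Proof. by move/(@inc_ker _ _ d) => [h <-]; rewrite incK. Qed.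

Definition weight (c : 'F_2) : gT := (rep d ^+ (c : nat))%g.

Lemma sgn_weight c : chi (weight c) = c.
Proof.
have [->|->] := F2P c; first by rewrite /weight expg0 chi1.
by rewrite /weight expg1 sgn_rep.
Qed.

Section Straighten.
Variables (n : nat) (s : simplex Y n).

(** A change of gauge by [rep] at the vertices on sheet 1 moves all labels into the kernel of the
    character. *)
Definition straight (i j : 'I_n.+1) : gT :=
  (weight (sheet s i) * label (base s) i j * (weight (sheet s j))^-1)%g.

Lemma straightM i j k : (straight i j * straight j k = straight i k)%g.
Proof. by rewrite /straight -!mulgA mulKg (mulgA (label _ i j)) labelM. Qed.

Lemma sgn_straight i j : chi (straight i j) = 0.
Proof.
rewrite !chiM chiV !sgn_weight (sheetP s i j).
by rewrite addF2.
Qed.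

Lemma straighten_subproof i j k :
  (incV (straight i j) * incV (straight j k))%g = incV (straight i k).
Proof.
apply: (@index2_inj _ _ d); rewrite ghomM !incVK ?sgn_straight //.
exact: straightM.
Qed.

Definition straighten_simplex : simplex (nerve hT) n := NerveSimplex straighten_subproof.

End Straighten.

Definition straighten : smap Y (nerve hT).
Proof.
refine (@SMap Y (nerve hT) straighten_simplex _).
by move=> m n f s; exact: nerve_simplexP.
Defined.

Lemma inc_cover_subproof n (s : nerve_simplex hT n) (i j : 'I_n.+1) :
  (0 : 'F_2) = 0 + chi (label (Bmap_simplex (inc d) s) i j).
Proof. by rewrite /= sgn_inc addr0. Qed.

Definition inc_cover : smap (nerve hT) Y.
Proof.
refine (@SMap (nerve hT) Y (fun n s => CoverSimplex (@inc_cover_subproof n s)) _).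
by move=> m n f s; apply: cover_simplexP => //; exact: nerve_simplexP.
Defined.

Lemma inc_coverK n (s : nerve_simplex hT n) : straighten n (inc_cover n s) = s.
Proof.
apply: nerve_simplexP => i j; rewrite /= /straight /= /weight expg0 mul1g invg1 mulg1.
exact: incK.
Qed.

Section Deform.
Variables (n : nat) (x : simplex (prod_sset Y interval) n).

(** The same change of gauge made only at the vertices marked [true], which are thereby moved to
    sheet 0; it joins the identity to the straightening. *)
Definition deform_weight (i : 'I_n.+1) : gT :=
  if x.2 i then weight (sheet x.1 i) else 1%g.

Definition deform_label (i j : 'I_n.+1) : gT :=
  (deform_weight i * label (base x.1) i j * (deform_weight j)^-1)%g.

Lemma deform_labelM i j k : (deform_label i j * deform_label j k = deform_label i k)%g.
Proof. by rewrite /deform_label -!mulgA mulKg (mulgA (label _ i j)) labelM. Qed.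

Definition deform_sheet (i : 'I_n.+1) : 'F_2 := if x.2 i then 0 else sheet x.1 i.

Lemma deform_sheetP i j :
  deform_sheet j = deform_sheet i + chi (label (NerveSimplex deform_labelM) i j).
Proof.
rewrite /= /deform_label !chiM chiV /deform_sheet /deform_weight.
have E : chi (label (base x.1) i j) = sheet x.1 i + sheet x.1 j.
  by rewrite (sheetP x.1 i j) addrA addF2 add0r.
rewrite E; move: (sheet x.1 i) (sheet x.1 j) => p q.
case: (x.2 i); case: (x.2 j); rewrite ?sgn_weight ?chi1.
- by rewrite add0r addrA addF2 add0r addF2.
- by rewrite add0r addrA addF2 add0r addr0.
- by rewrite add0r addrA addrA addF2 add0r addF2.
- by rewrite add0r addr0 addrA addF2 add0r.
Qed.

Definition deform_simplex : simplex Y n := CoverSimplex deform_sheetP.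

End Deform.

Definition deform : smap (prod_sset Y interval) Y.
Proof.
refine (@SMap (prod_sset Y interval) Y deform_simplex _).
by move=> m n f s; apply: cover_simplexP => //; exact: nerve_simplexP.
Defined.

Definition smap_id (X : sset) : smap X X := @SMap X X (fun _ s => s) (fun _ _ _ _ => erefl).

Definition smap_comp (X Y Z : sset) (f : smap X Y) (g : smap Y Z) : smap X Z :=
  @SMap X Z (fun n s => g n (f n s))
    (fun m n h s => etrans (congr1 (g m) (smap_act f h s)) (smap_act g h (f n s))).

Lemma straighten_inc (a : cohomology Y) : pullback straighten (pullback inc_cover a) = a.
Proof.
rewrite (@pull_comp _ _ _ _ _ (smap_comp straighten inc_cover)) //.
rewrite -[RHS](@pull_id _ (smap_id Y)) //; apply/esym.
apply: (@homotopic_pullback _ _ _ _ deform) => n s; apply: cover_simplexP => //=.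
- by apply: nerve_simplexP => i j; rewrite /= /deform_label /deform_weight /= mul1g invg1 mulg1.
- apply: nerve_simplexP => i j; rewrite /= /deform_label /deform_weight /=.
  by rewrite incVK // sgn_straight.
Qed.

Lemma inc_straighten (a : H hT) : pullback inc_cover (pullback straighten a) = a.
Proof.
rewrite (@pull_comp _ _ _ _ _ (smap_id (nerve hT))) ?pull_id // => n s.
by rewrite inc_coverK.
Qed.

Lemma inc_proj (a : H gT) : pullback inc_cover (pullback (cover_proj chi) a) = res (inc d) a.
Proof. exact: pull_comp. Qed.

Lemma proj_straighten (a : H gT) :
  pullback (cover_proj chi) a = pullback straighten (res (inc d) a).
Proof. by rewrite -inc_proj straighten_inc. Qed.

Definition tr (a : H hT) : H gT := transfer (pullback straighten a).

Lemma tr_cls z : tr (cls z) = cls (trans_cocycle (pull_cocycle straighten z)).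
Proof. by rewrite /tr [X in transfer X]pullback_cls transfer_cls. Qed.

Lemma trD : {morph tr : a b / a + b}.
Proof. by move=> a b; rewrite /tr rmorphD /= transferD. Qed.

Lemma tr0 : tr 0 = 0.
Proof. by apply: (addIr (tr 0)); rewrite -trD !add0r. Qed.

Lemma tr_degree n a : in_degree n a -> in_degree n (tr a).
Proof. by move=> an; apply/transfer_degree/pull_degree. Qed.

Lemma trM a b : tr (a * res (inc d) b) = tr a * b.
Proof. by rewrite /tr rmorphM /= -proj_straighten transferM. Qed.

Lemma tr_res b : tr (res (inc d) b) = 0.
Proof. by rewrite /tr -proj_straighten transfer_proj. Qed.

Lemma sgn_tr a : chi_class chi * tr a = 0.
Proof. exact: chi_transfer. Qed.

Lemma res_sgn : res (inc d) (chi_class chi) = 0.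
Proof. by apply: res_chi0; exact: sgn_inc. Qed.

Lemma res_eq0 n (a : H gT) : in_degree n.+1 a -> res (inc d) a = 0 ->
  exists2 b, in_degree n b & a = chi_class chi * b.
Proof. by move=> an a0; apply: proj_eq0; rewrite // proj_straighten a0 rmorph0. Qed.

Lemma tr_eq0 n (a : H hT) : in_degree n a -> tr a = 0 ->
  exists2 b, in_degree n b & a = res (inc d) b.
Proof.
move=> an a0; have [b bn ab] := transfer_eq0 (pull_degree straighten an) a0.
by exists b; rewrite // -inc_proj -ab inc_straighten.
Qed.

Lemma sgn_eq0 n (a : H gT) : in_degree n a -> chi_class chi * a = 0 ->
  exists2 b, in_degree n b & a = tr b.
Proof.
move=> an a0; have [b bn ->] := chi_mul_eq0 an a0.
exists (pullback inc_cover b); first exact: pull_degree.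
by rewrite /tr straighten_inc.
Qed.

Lemma sgn_neq0 : chi_class chi != 0.
Proof. by apply/eqP => /chi_class_eq0 /(_ (rep d)) /eqP; rewrite sgn_rep oner_eq0. Qed.

(** The double coset formula for a subgroup of index 2. The lifts starting on the sheets 0 and 1
    straighten to the simplex itself and to its conjugate by [rep], so the identity holds already
    for cochains. *)
Lemma res_tr (c : ghom hT hT) : (forall h, inc d (c h) = (rep d * inc d h * (rep d)^-1)%g) ->
  forall a, res (inc d) (tr a) = a + res c a.
Proof.
move=> cE; elim/cls_ind => z; rewrite tr_cls !pullback_cls -clsD.
congr cls; apply: val_inj; apply: funext => -[n s] /=.
rewrite -[LHS]/(cochain_of z (smap_simplices straighten (lift chi 0 (smap_simplices (Bmap (inc d)) (existT _ n s)))) +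
  cochain_of z (smap_simplices straighten (lift chi 1 (smap_simplices (Bmap (inc d)) (existT _ n s))))).
rewrite -[RHS]/(cochain_of z (existT (simplex (nerve hT)) n s) +
  cochain_of z (smap_simplices (Bmap c) (existT (simplex (nerve hT)) n s))).
congr (cochain_of z _ + cochain_of z _); rewrite /smap_simplices /=; congr existT;
  apply: nerve_simplexP => i j; apply: (@index2_inj _ _ d);
  rewrite /= incVK ?sgn_straight // /straight /= !sgn_inc addr0.
  by rewrite /weight expg0 mul1g invg1 mulg1.
by rewrite cE /weight expg1.
Qed.

End Index2.

Lemma res_tr_natural (hT gT hT' gT' : finGroupType) (d : index2 hT gT) (d' : index2 hT' gT')
    (f : ghom gT' gT) (fh : ghom hT' hT) :
  (forall x, inc d (fh x) = f (inc d' x)) -> (forall x, sgn d' x = sgn d (f x)) ->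
  f (rep d') = rep d -> forall a, res f (tr d a) = tr d' (res fh a).
Proof.
move=> fE sE rE; elim/cls_ind => z; rewrite tr_cls !pullback_cls tr_cls.
congr cls; apply: val_inj; apply: funext => -[n s] /=.
congr (cochain_of z _ + cochain_of z _); rewrite /smap_simplices /=; congr existT;
  apply: nerve_simplexP => i j; apply: (@index2_inj _ _ d);
  rewrite /= fE !incVK ?sgn_straight // /straight /= !ghomM ghomV -!sE /weight !ghomX rE //.
Qed.

(** * Cyclic groups *)

Definition cyclic_gen (gT : finGroupType) (e c : H gT) n : H gT :=
  e ^+ odd n * c ^+ n./2.

(** The square of [e] is left open, so that Z/2, where it equals [c], can start the induction that
    doubles the order. *)
Record cyclic_ring (gT : finGroupType) (e c : H gT) : Prop := {
  cyclic_deg1 : in_degree 1 e;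
  cyclic_deg2 : in_degree 2 c;
  cyclic_span : forall n a, in_degree n a -> a = 0 \/ a = cyclic_gen e c n;
  cyclic_neq0 : forall n, cyclic_gen e c n != 0 }.

Lemma cyclic_gen_degree (gT : finGroupType) (e c : H gT) n :
  in_degree 1 e -> in_degree 2 c -> in_degree n (cyclic_gen e c n).
Proof.
move=> e1 c2; rewrite -{1}[n]odd_double_half -mul2n -{1}(mul1n (odd n)).
by apply: in_degreeM; exact: in_degreeX.
Qed.

Section CyclicStep.
Variables (hT gT : finGroupType) (d : index2 hT gT) (e c : H hT).
Hypothesis H_cyclic : cyclic_ring e c.
Hypothesis chars : forall chi : ghom gT 'F_2, (forall x, chi x = 0) \/ chi =1 sgn d.
Local Notation e' := (chi_class (sgn d)).

Let H1 (a : H gT) : in_degree 1 a -> a = 0 \/ a = e'.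
Proof.
case/degree1P=> chi ->; case: (chars chi) => [chi0|cE]; last by right; exact: chi_class_ext.
left; rewrite -[chi_class chi](res_id (f := GHom (fun x y : gT => erefl (x * y)%g))) //.
exact: res_chi0.
Qed.

(** Degree 1 comes first: the characters of the larger group restrict to 0, so [e] is not a
    restriction and its transfer is the nonzero class e'. Then e'^2 is the transfer of [e] times the
    restriction of e', hence 0, and the powers of a lift of [c] are handled by the projection
    formula. *)
Lemma cyclic_step : exists c',
  [/\ cyclic_ring e' c', e' ^+ 2 = 0, res (inc d) c' = c &
      forall k, tr d (e * c ^+ k) = e' * c' ^+ k].
Proof.
have [e1 c2 span neq0] := H_cyclic.
have tre : tr d e = e'.
  have [] := H1 (tr_degree d e1) => // tre.
  have [b b1 eb] := tr_eq0 e1 tre.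
  have := neq0 1%N; rewrite /cyclic_gen expr1 expr0 mulr1 eb.
  by case: (H1 b1) => ->; rewrite ?rmorph0 ?res_sgn eqxx.
have ee : e' * e' = 0 by rewrite -{1}tre -trM res_sgn mulr0 tr0.
have H2 a : in_degree 2 a -> res (inc d) a = 0 -> a = 0.
  move=> a2 /(res_eq0 a2)[b /H1[]-> ->]; rewrite ?mulr0 //.
have [c' c'2 rc'] : exists2 c', in_degree 2 c' & res (inc d) c' = c.
  (* If the transfer of [c] vanishes, the Gysin sequence lifts [c]. Otherwise the transfer itself is
     a lift, because restriction is injective in degree 2 and [c] is the only nonzero class
     there. *)
  have [trc|trc] := eqVneq (tr d c) 0.
    by have [c' c'2 cE] := tr_eq0 c2 trc; exists c'.
  exists (tr d c); first exact: tr_degree.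
  have /span[r0|->] : in_degree 2 (res (inc d) (tr d c)).
    by apply: pull_degree; exact: tr_degree.
  - by move: trc; rewrite (H2 _ _ r0) ?eqxx //; exact: tr_degree.
  - by rewrite /cyclic_gen expr0 mul1r.
have trec k : tr d (e * c ^+ k) = e' * c' ^+ k by rewrite -rc' -rmorphXn trM tre.
have trc k : tr d (c ^+ k) = 0 by rewrite -rc' -rmorphXn tr_res.
have c'k k : c' ^+ k != 0.
  apply/eqP => ck0; have := neq0 k.*2.
  rewrite /cyclic_gen odd_double doubleK mul1r -rc'.
  by rewrite -[X in X != 0]rmorphXn ck0 rmorph0 eqxx.
have gen_even k : cyclic_gen e c k.*2 = c ^+ k.
  by rewrite /cyclic_gen odd_double doubleK mul1r.
have gen_odd k : cyclic_gen e c k.*2.+1 = e * c ^+ k.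
  by rewrite /cyclic_gen /= odd_double /= uphalf_double expr1.
have e'c'k k : e' * c' ^+ k != 0.
  apply/eqP => /(@sgn_eq0 _ _ d (k.*2)); case.
    by rewrite -mul2n; exact: in_degreeX.
  move=> b /span[->|->]; first by rewrite tr0 => /eqP; apply/negP.
  by rewrite gen_even trc => /eqP; apply/negP.
exists c'; split=> //; split=> //; first exact: chi_degree; last first.
  by move=> n; rewrite /cyclic_gen; case: (odd n); rewrite ?mul1r.
elim/ltn_ind=> -[_ a /degree0P[]->|n IH a an]; [by left|by right; rewrite /cyclic_gen !expr0 mulr1|].
have nE := odd_double_half n.+1.
have div b : in_degree n b -> a = e' * b -> a = 0 \/ a = cyclic_gen e' c' n.+1.
  move=> /(IH _ (ltnSn n))[->|->] ->; first by left; rewrite mulr0.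
  rewrite /cyclic_gen /=; case: (boolP (odd n)) => on.
    by left; rewrite mulrA expr1 ee mul0r.
  by right; rewrite mul1r expr1 uphalf_half (negPf on).
have [r0|rE] := span _ _ (pull_degree (Bmap (inc d)) an).
  by have [b bn ab] := res_eq0 an r0; exact: div ab.
(* In odd degree the generator has a nonzero transfer, so it is not a restriction. *)
case: (boolP (odd n.+1)) nE => on nE.
  have := tr_res d a; rewrite rE -nE gen_odd trec => /eqP.
  by rewrite (negPf (e'c'k _)).
have genE : cyclic_gen e' c' n.+1 = c' ^+ n.+1./2.
  by rewrite /cyclic_gen (negPf on) mul1r.
have g_deg : in_degree n.+1 (cyclic_gen e' c' n.+1).
  by apply: cyclic_gen_degree; first exact: chi_degree.
have rg : res (inc d) (a + cyclic_gen e' c' n.+1) = 0.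
  rewrite rmorphD /= rE genE rmorphXn /= rc' /cyclic_gen (negPf on) mul1r.
  exact: addHH.
have [b bn abE] := res_eq0 (in_degreeD an g_deg) rg.
have [b0|bE] := IH _ (ltnSn n) b bn.
  by right; apply: addHC_eq0; rewrite abE b0 mulr0.
right; apply: addHC_eq0; rewrite abE bE /cyclic_gen.
move: on; rewrite /= negbK => ->.
by rewrite mulrA expr1 ee mul0r.
Qed.

End CyclicStep.

Section Trivial.
Variable gT : finGroupType.
Hypothesis gT1 : forall x : gT, x = 1%g.

Let simplicesE (x y : simplices (nerve gT)) : tag x = tag y -> x = y.
Proof.
case: x y => n s [m t] /= nm; rewrite nm in s *.
by congr existT; apply: nerve_simplexP => i j; rewrite (gT1 (label s i j)) (gT1 (label t i j)).
Qed.

(** Cochains are not normalized: there is one simplex in each dimension, and the coboundary out of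
    degree m is multiplication by m + 2, alternately 0 and an isomorphism. *)
Lemma trivial_positive_degree n (a : H gT) : in_degree n.+1 a -> a = 0.
Proof.
case=> z zn ->; have [dz _] := cocycleP z; apply/cls_eq0.
have cobE (f : cochain (nerve gT)) m (s : simplex (nerve gT) m.+1) (x : simplices (nerve gT)) : tag x = m ->
    coboundary f (existT (simplex (nerve gT)) m.+1 s) = f x *+ m.+2.
  move=> xm; rewrite /= (eq_bigr (fun=> f x)) ?sumr_const ?card_ord // => k _.
  by congr f; apply: simplicesE; rewrite /= size_rem ?mem_enum // size_enum_ord.
have mul2 (c : 'F_2) m : c *+ m = c *+ odd m.
  rewrite -{1}[m]odd_double_half mulrnDr -addnn mulrnDr.
  by rewrite addF2 addr0.
pose simp m : simplices (nerve gT) :=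
  existT (simplex (nerve gT)) m (Defs.act (fun=> ord0) (vertex (nerve gT))).
case: (boolP (odd n)) => on.
  exists (fun x => if tag x == n then cochain_of z (simp n.+1) else 0).
  apply: funext => x; have [xn|xn] := eqVneq (tag x) n.+1; last first.
    rewrite zn // (@coboundary_local _ _ 0) ?coboundary0 // => y yx.
    by case: eqP => // yn; rewrite -yx yn eqxx in xn.
  rewrite (simplicesE (x := x) (y := simp n.+1)) // (cobE _ _ _ (simp n)) // eqxx.
  by rewrite mul2 /= on.
exists 0; rewrite coboundary0; apply: funext => x.
have [xn|] := eqVneq (tag x) n.+1; last exact: zn.
have := congr1 (fun h => h (simp n.+2)) dz; rewrite /simp (cobE _ _ _ x) // mul2 /=.
by rewrite (negPf on).
Qed.

End Trivial.

Section CyclicGroups.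

Lemma zmul_subproof p q k : (q.+1 %| k * p.+1)%N ->
  forall x y : 'I_p.+1, inZp (k * (x * y)%g) = (inZp (k * x) * inZp (k * y))%g :> 'I_q.+1.
Proof.
move=> qkp x y; apply: val_inj => /=; rewrite modnDm -mulnDr.
rewrite [in RHS](divn_eq (x + y) p.+1).
move: ((x + y) %/ p.+1)%N ((x + y) %% p.+1)%N => a b.
by rewrite mulnDr (mulnC a) mulnA -[RHS]modnDml (eqP (dvdn_mulr _ qkp)).
Qed.

Definition zmul p q k (qkp : (q.+1 %| k * p.+1)%N) : ghom 'I_p.+1 'I_q.+1 :=
  GHom (zmul_subproof qkp).

Lemma zp_power q (x : 'I_q.+1) : x = (inZp 1 ^+ x)%g.
Proof. by rewrite Zp_expg; apply: val_inj; rewrite /= modnMml mul1n modn_small. Qed.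

Section Double.
Variables (p q : nat) (qp : q.+1 = (2 * p.+1)%N).

Lemma zdouble_subproof : (q.+1 %| 2 * p.+1)%N.
Proof. by rewrite qp. Qed.

Lemma zparity_subproof : (2 %| 1 * q.+1)%N.
Proof. by rewrite qp mul1n dvdn_mulr. Qed.

Definition zdouble : ghom 'I_p.+1 'I_q.+1 := zmul zdouble_subproof.
Definition zparity : ghom 'I_q.+1 'F_2 := @zmul q 1 1 zparity_subproof.

Lemma val_zdouble x : zdouble x = (2 * x)%N :> nat.
Proof. by rewrite /= modn_small // qp ltn_pmul2l. Qed.

Lemma zdouble_inj : injective zdouble.
Proof.
move=> x y /(congr1 (@nat_of_ord _)); rewrite !val_zdouble => /eqP.
by rewrite eqn_mul2l /= => /eqP/val_inj.
Qed.

Lemma zparity_double x : zparity (zdouble x) = 0.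
Proof. by apply: val_inj; rewrite /= mul1n modn_dvdm ?modnMr // qp dvdn_mulr. Qed.

Lemma zparity_ker y : zparity y = 0 -> exists x, zdouble x = y.
Proof.
move/(congr1 val); rewrite /= mul1n => y2.
have yp : (y %/ 2 < p.+1)%N by rewrite ltn_divLR // mulnC -qp.
exists (Ordinal yp); apply: ord_inj; rewrite val_zdouble /= mulnC divnK //.
exact/eqP.
Qed.

Lemma zparity1 : zparity (inZp 1) = 1.
Proof. by apply: val_inj; rewrite /= mul1n modn_dvdm // qp dvdn_mulr. Qed.

Definition cyclic_index2 : index2 'I_p.+1 'I_q.+1 :=
  Index2 zdouble_inj zparity_double zparity_ker zparity1.

Lemma cyclic_chars (chi : ghom 'I_q.+1 'F_2) :
  (forall x, chi x = 0) \/ chi =1 zparity.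
Proof.
have [c0|c1] := F2P (chi (inZp 1)); [left|right] => x; rewrite (zp_power x) ghomX.
  by rewrite c0 expg1n.
by rewrite c1 ghomX zparity1.
Qed.

End Double.

Definition idF2 : ghom 'F_2 'F_2 := GHom (fun x y : 'F_2 => erefl (x * y)%g).
Definition tF2 : H 'F_2 := chi_class idF2.

Lemma F2_trivial_subproof (x y : 'I_1) : (0 : 'F_2) = ((0 : 'F_2) * (0 : 'F_2))%g.
Proof. exact: val_inj. Qed.

Definition F2_index2 : index2 'I_1 'F_2.
Proof.
refine (@Index2 'I_1 'F_2 (@GHom 'I_1 'F_2 (fun=> 0) F2_trivial_subproof) idF2 (1%R : 'F_2) _ _ _ _) => //.
- by move=> x y _; rewrite [x]ord1 [y]ord1.
- by move=> g /= g0; exists ord0.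
Defined.

Lemma I1_positive_degree n (a : H 'I_1) : in_degree n.+1 a -> a = 0.
Proof. by apply: trivial_positive_degree => x; rewrite [x]ord1 [RHS]ord1. Qed.

(** The Gysin sequence of the trivial subgroup: its cohomology vanishes in positive degrees and its
    unit is a restriction, with transfer 0, so multiplication by t is bijective from each degree to
    the next. *)
Lemma F2_cyclic : cyclic_ring tF2 (tF2 ^+ 2).
Proof.
have genE n : cyclic_gen tF2 (tF2 ^+ 2) n = tF2 ^+ n.
  by rewrite /cyclic_gen -exprM -exprD mul2n odd_double_half.
have t1 : in_degree 1 tF2 by exact: chi_degree.
split=> //; first exact: (in_degreeX 2 t1); move=> n; last first.
  rewrite genE; elim: n => [|n IH]; first by rewrite expr0 oner_neq0.
  apply/eqP => /esym; rewrite exprS => /esym tn0.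
  have tn : in_degree n (tF2 ^+ n) by have := in_degreeX n t1; rewrite mul1n.
  have [b bn tb] := @sgn_eq0 _ _ F2_index2 _ _ tn tn0; move: IH; rewrite tb.
  case: n bn {tn tn0 tb} => [/degree0P[]->|n /I1_positive_degree ->].
  - by rewrite tr0 eqxx.
  - by rewrite -(rmorph1 (res (inc F2_index2))) tr_res eqxx.
  - by rewrite tr0 eqxx.
rewrite genE; elim: n => [|n IH] a; first exact: degree0P.
move=> an; have [] := @res_eq0 _ _ F2_index2 _ _ an.
  by apply: (@I1_positive_degree n); exact: pull_degree.
move=> b /IH[->|->] ->; first by left; rewrite mulr0.
by right; rewrite exprS.
Qed.

End CyclicGroups.

(** * Steenrod squares on products with Z/2 *)

Section Product.
Variable B : finGroupType.

Lemma pair0_subproof (x y : B) :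
  ((x * y)%g, (0 : 'F_2)) = ((x, 0 : 'F_2) * (y, 0 : 'F_2))%g.
Proof. by congr pair; apply: val_inj. Qed.
Definition inl_hom : ghom B (B * 'F_2)%type := GHom pair0_subproof.
Definition fst_hom : ghom (B * 'F_2)%type B :=
  GHom (fun x y : B * 'F_2 => erefl (x * y)%g.1).
Definition snd_hom : ghom (B * 'F_2)%type 'F_2 :=
  GHom (fun x y : B * 'F_2 => erefl (x * y)%g.2).

Definition prod_index2 : index2 B (B * 'F_2)%type.
Proof.
refine (@Index2 B (B * 'F_2)%type inl_hom snd_hom (1%g, 1%R : 'F_2) _ _ _ _) => //.
- by move=> x y [].
- by move=> [x y] /= ->; exists x.
Defined.

Local Notation t := (chi_class snd_hom).

Lemma res_inl_snd : res inl_hom t = 0.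
Proof. exact: (res_sgn prod_index2). Qed.

Lemma res_inl_fst a : res inl_hom (res fst_hom a) = a.
Proof. by rewrite (res_comp (h := GHom (fun x y : B => erefl (x * y)%g))) ?res_id. Qed.

Lemma prod_decomp n a : in_degree n.+1 a ->
  exists2 b, in_degree n b & a = res fst_hom (res inl_hom a) + t * b.
Proof.
move=> an; have an' : in_degree n.+1 (a + res fst_hom (res inl_hom a)).
  by apply: in_degreeD => //; do 2!apply: pull_degree.
have [|b bn ab] := @res_eq0 _ _ prod_index2 _ _ an'.
  by rewrite rmorphD /= res_inl_fst addHH.
exists b => //; rewrite -[t * b]ab.
by rewrite addrCA addHH addr0.
Qed.

Lemma prod_degree0 a : in_degree 0 a -> a = res fst_hom (res inl_hom a).
Proof. by move=> /degree0P[]->; rewrite ?rmorph0 ?rmorph1. Qed.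

(** The kernel of t consists of transfers, and every class of B is a restriction, whose transfer is
    0. *)
Lemma prod_inj n a : in_degree n a -> t * a = 0 -> a = 0.
Proof.
move=> an /(@sgn_eq0 _ _ prod_index2 _ _ an)[b bn ->].
by rewrite -(res_inl_fst b) tr_res.
Qed.

End Product.

(** * Simplices of the nerve given by their vertices *)

Section PointSimplices.
Variable gT : finGroupType.
Implicit Types (L : seq gT) (f g : cochain (nerve gT)).

Lemma pt_label_subproof L (i j k : 'I_(size L).-1.+1) :
  ((nth 1 L i)^-1 * nth 1 L j * ((nth 1 L j)^-1 * nth 1 L k) =
   (nth 1 L i)^-1 * nth 1 L k)%g.
Proof. by rewrite !mulgA mulgK. Qed.

(** Homogeneous bar notation, with group elements at the vertices and their quotients on the edges;
    whence the invariance under left translation in [eval_pt_translate]. *)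
Definition pt_simplex L : simplices (nerve gT) :=
  existT (simplex (nerve gT)) (size L).-1 (NerveSimplex (@pt_label_subproof L)).

Definition eval_pt f L : 'F_2 := if L is [::] then 0 else f (pt_simplex L).

Lemma existT_nerve m n (s : nerve_simplex gT m) (s' : nerve_simplex gT n) :
  m = n -> (forall (i j : 'I_m.+1) (i' j' : 'I_n.+1), i = i' :> nat -> j = j' :> nat ->
    label s i j = label s' i' j') ->
  existT (simplex (nerve gT)) m s = existT (simplex (nerve gT)) n s'.
Proof.
move=> mn; case: n / mn s' => s' ss'; congr existT.
by apply: nerve_simplexP => i j; exact: ss'.
Qed.

Lemma eval_pt_face f L (e : seq 'I_(size L).-1.+1) : L != [::] ->
  @eval_face (nerve gT) f _ (projT2 (pt_simplex L)) e = eval_pt f [seq nth 1%g L (val i) | i <- e].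
Proof.
move=> L0; case: e => [|v e] //; rewrite /eval_face /eval_pt -[LHS]/(f _) /=; congr f.
apply: existT_nerve; first by rewrite /= size_map.
move=> i j i' j' /= ii jj.
have E (k : 'I_(size e).+1) (k' : 'I_(size [seq nth 1%g L (val i) | i <- e]).+1) :
    k = k' :> nat -> nth 1%g L (nth ord0 (v :: e) k) =
    nth 1%g (nth 1%g L v :: [seq nth 1%g L (val i) | i <- e]) k'.
  move=> <-; rewrite -[RHS](_ : nth 1%g [seq nth 1%g L (val i) | i <- v :: e] k = _) //.
  by rewrite (nth_map ord0) // ltn_ord.
by rewrite (E i i') ?(E j j').
Qed.

Lemma pt_enum L : L != [::] ->
  [seq nth 1%g L (val i) | i <- enum 'I_(size L).-1.+1] = L.
Proof.
move=> L0; have s0 : (0 < size L)%N by rewrite lt0n size_eq0.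
apply: (@eq_from_nth _ 1%g); first by rewrite size_map size_enum_ord prednK.
move=> i; rewrite size_map => iL; rewrite (nth_map ord0) //=.
by rewrite nth_enum_ord // -[X in (_ < X)%N](size_enum_ord (size L).-1.+1).
Qed.

Lemma eval_pt_enum f L : L != [::] ->
  eval_pt f L = @eval_face (nerve gT) f _ (projT2 (pt_simplex L)) (enum 'I_(size L).-1.+1).
Proof. by move=> L0; rewrite eval_pt_face // pt_enum. Qed.

Lemma eval_pt_coboundary f L :
  eval_pt (coboundary f) L = \sum_(t <- dels L) eval_pt f t.
Proof.
have [->|L0] := eqVneq L [::]; first by rewrite big_nil.
rewrite eval_pt_enum // eval_coboundary -[in RHS](pt_enum L0).
rewrite [in RHS]dels_map [RHS]big_map.
by apply: eq_bigr => t _; rewrite eval_pt_face.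
Qed.

Lemma eval_pt_cupi i f g L : eval_pt (cupi i f g) L =
  \sum_(p <- blocks i.+1 false L) eval_pt f p.1 * eval_pt g p.2.
Proof.
have [->|L0] := eqVneq L [::]; first by rewrite big_nil.
rewrite eval_pt_enum // cupi_eval -[in RHS](pt_enum L0).
rewrite [in RHS]blocks_map [RHS]big_map.
by apply: eq_bigr => p _; rewrite !eval_pt_face.
Qed.

Lemma eval_pt_chi chi L : eval_pt (chi_cochain chi) L =
  if L is [:: v; w] then chi v + chi w else 0.
Proof.
by case: L => [|v [|w [|x L]]] //; rewrite /eval_pt /chi_cochain /= chiM chiV.
Qed.

Lemma eval_pt_translate f (g : gT) L : eval_pt f [seq (g * x)%g | x <- L] = eval_pt f L.
Proof.
case: L => [|v L] //; rewrite /eval_pt -[LHS]/(f (pt_simplex _)); congr f.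
apply: existT_nerve; first by rewrite /= size_map.
move=> i j i' j' ii jj; rewrite /= -/(map _ (v :: L)) -ii -jj.
have lt k : (k < (size [seq (g * x)%g | x <- v :: L]).-1.+1)%N -> (k < size (v :: L))%N.
  by rewrite size_map.
rewrite !(nth_map 1%g) ?lt ?ltn_ord //.
by rewrite invMg -mulgA mulKg.
Qed.

Lemma eval_pt_component n f L : eval_pt (component n f) L =
  if size L == n.+1 then eval_pt f L else 0.
Proof. by case: L => [|v L]; rewrite /eval_pt /component //= eqSS. Qed.

End PointSimplices.

(** * The square Sq^2 of s^2 t^2 on the Klein four-group *)

Section KleinFour.
Let V : finGroupType := ('F_2 * 'F_2)%type.
Local Notation s := (chi_class (fst_hom 'F_2)).
Local Notation t := (chi_class (snd_hom 'F_2)).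

Definition bF2 (b : bool) : 'F_2 := b%:R.
Lemma bF2_add a b : bF2 (a (+) b) = bF2 a + bF2 b.
Proof. by case: a b => [] []; rewrite /bF2 /= ?addF2 ?addr0 ?add0r. Qed.
Lemma bF2_mul a b : bF2 (a && b) = bF2 a * bF2 b.
Proof. by case: a b => [] []; rewrite /bF2 /= ?mul0r ?mul1r ?mulr0. Qed.

Definition bV (b : bool * bool) : V := (bF2 b.1, bF2 b.2).
Definition bxor (a b : bool * bool) := (a.1 (+) b.1, a.2 (+) b.2).
Lemma bV_mul a b : bV (bxor a b) = (bV a * bV b)%g.
Proof. by rewrite /bV !bF2_add. Qed.

Definition xorall (T : Type) (F : T -> bool) (r : seq T) := foldr (fun x b => F x (+) b) false r.
Lemma bF2_xorall (T : Type) (F : T -> bool) (r : seq T) :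
  bF2 (xorall F r) = \sum_(x <- r) bF2 (F x).
Proof. by elim: r => [|x r IH]; rewrite ?big_nil // big_cons /= bF2_add IH. Qed.

(** The cup-i product of Boolean copies of cochains, which [vm_compute] can evaluate, unlike
    cochains on the nerve. *)
Definition bcupi i (F G : seq (bool * bool) -> bool) L :=
  xorall (fun p => F p.1 && G p.2) (blocks i.+1 false L).

Lemma eval_bcupi i f g (F G : seq (bool * bool) -> bool) :
  (forall L, @eval_pt V f (map bV L) = bF2 (F L)) ->
  (forall L, @eval_pt V g (map bV L) = bF2 (G L)) ->
  forall L, @eval_pt V (cupi i f g) (map bV L) = bF2 (bcupi i F G L).
Proof.
move=> fF gG L; rewrite eval_pt_cupi blocks_map big_map bF2_xorall.
by apply: eq_bigr => p _; rewrite bF2_mul -fF -gG.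
Qed.

Definition bs (L : seq (bool * bool)) := if L is [:: v; w] then v.1 (+) w.1 else false.
Definition bt (L : seq (bool * bool)) := if L is [:: v; w] then v.2 (+) w.2 else false.
Definition bsstt L := (size L == 5) && bcupi 0 (bcupi 0 bs bs) (bcupi 0 bt bt) L.

Fixpoint shuffles (T : Type) (p : seq T) : seq T -> seq (seq T) :=
  fix shuffles_p q := match p, q with
  | [::], _ => [:: q]
  | _, [::] => [:: p]
  | x :: p', y :: q' =>
      map (cons x) (shuffles p' q) ++ map (cons y) (shuffles_p q')
  end.

Fixpoint vertices (v : bool * bool) (p : seq (bool * bool)) :=
  v :: if p is g :: p' then vertices (bxor v g) p' else [::].

(* The shuffle product of cycles dual to t^4 and t^2 in the unnormalized
   bar complex of Z/2, whence the degenerate simplices. *)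
Definition klein_cycle : seq (seq (bool * bool)) :=
  let i b := (b, false) in let j b := (false, b) in
  flatten [seq [seq vertices (false, false) p | p <- shuffles (map i q.1) (map j q.2)] |
    q <- [seq (q1, q2) |
      q1 <- [:: [:: true; true; true; true]; [:: false; false; false; false];
                [:: false; false; true; true]; [:: true; true; false; true]],
      q2 <- [:: [:: true; true]; [:: false; false]]]].

(** Translates the first vertex to the identity, each element being its own inverse. A cochain takes
    the same value on both simplices, so faces of different simplices can be compared in this
    form. *)
Definition bnorm (L : seq (bool * bool)) := map (bxor (head (false, false) L)) L.

Lemma sum_even (T : eqType) (r : seq T) (F : T -> 'F_2) :
  all (fun x => ~~ odd (count_mem x r)) r -> \sum_(x <- r) F x = 0.
Proof.
move=> /allP r_even; rewrite -big_undup_iterop_count big1_seq // => x /andP[_].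
rewrite mem_undup => /r_even xr; rewrite Monoid.iteropE.
have iterE m (y : 'F_2) : iter m.*2 (+%R y) 0 = 0.
  by elim: m => //= m ->; rewrite addr0 addF2.
by rewrite -[count_mem x r]odd_double_half (negPf xr) iterE.
Qed.

(** The square is represented by the cup-2 square of a 4-cocycle. Its value on the chain
    [klein_cycle] is 1, whereas a coboundary has value 0 there, because up to translation every face
    occurs an even number of times. *)
Lemma Sq2_klein_neq0 : Sq 2 (s ^+ 2 * t ^+ 2) != 0.
Proof.
rewrite /chi_class expr2 clsM expr2 clsM clsM Sq_cls; apply/eqP => /cls_eq0[h] /=.
set z := cupi 0 _ _ => zh.
have evs L : @eval_pt V (chi_cochain (fst_hom 'F_2)) (map bV L) = bF2 (bs L).
  by rewrite eval_pt_chi; case: L => [|v [|w [|x L]]] //=; rewrite bF2_add.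
have evt L : @eval_pt V (chi_cochain (snd_hom 'F_2)) (map bV L) = bF2 (bt L).
  by rewrite eval_pt_chi; case: L => [|v [|w [|x L]]] //=; rewrite bF2_add.
have evz L : @eval_pt V (component 4 z) (map bV L) = bF2 (bsstt L).
  rewrite eval_pt_component size_map /bsstt; case: eqP => //= _.
  by apply: eval_bcupi => L'; apply: eval_bcupi.
have evSq L : size L = 7 ->
    @eval_pt V (coboundary h) (map bV L) = bF2 (bcupi 2 bsstt bsstt L).
  move=> L7; rewrite -(eval_bcupi 2 evz evz) -zh.
  have sqE x : tag x = 6 -> sq_cochain 2 z x = cupi 2 (component 4 z) (component 4 z) x.
    by rewrite /sq_cochain => ->.
  case: L L7 => // v L [L6]; rewrite -[LHS]/(sq_cochain 2 z _) sqE //.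
  by rewrite /= size_map L6.
have sz : all (fun L => size L == 7) klein_cycle by vm_compute.
have : \sum_(L <- klein_cycle) @eval_pt V (coboundary h) (map bV L) = 1.
  rewrite (eq_big_seq (fun L => bF2 (bcupi 2 bsstt bsstt L))); last first.
    by move=> L /(allP sz)/eqP/evSq.
  by rewrite -bF2_xorall (_ : xorall _ _ = true) //; vm_compute.
rewrite (_ : \sum_(_ <- _) _ = 0) => [/eqP|]; first by rewrite eq_sym oner_eq0.
pose K L := @eval_pt V h (map bV L).
have K_norm L : K L = K (bnorm L).
  rewrite /K /bnorm; set g := head _ L.
  rewrite -[LHS](eval_pt_translate h (bV g)) -!map_comp; congr eval_pt.
  by apply: eq_map => x /=; rewrite bV_mul.
under eq_bigr do rewrite eval_pt_coboundary dels_map big_map.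
rewrite (eq_bigr (fun L => \sum_(M <- map bnorm (dels L)) K M)); last first.
  by move=> L _; rewrite big_map; apply: eq_bigr => M _; rewrite -K_norm.
rewrite -(big_map (fun L => map bnorm (dels L)) xpredT (fun r => \sum_(M <- r) K M)).
rewrite -big_flatten; apply: sum_even.
by vm_compute.
Qed.

End KleinFour.

Lemma sqrHD (X : sset) (a b : cohomology X) : (a + b) ^+ 2 = a ^+ 2 + b ^+ 2.
Proof. by rewrite sqrrD mulr2n addHH addr0. Qed.

Section KleinFourRing.
Let V : finGroupType := ('F_2 * 'F_2)%type.
Local Notation s := (chi_class (fst_hom 'F_2)).
Local Notation t := (chi_class (snd_hom 'F_2)).

(** A homogeneous polynomial in s and t, given by its coefficients in the order of increasing powers
    of t. *)
Fixpoint klein_poly (l : seq bool) : H V :=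
  if l is x :: l' then s ^+ size l' *+ x + t * klein_poly l' else 0.

Lemma in_degree_mulb (X : sset) n (a : cohomology X) (b : bool) :
  in_degree n a -> in_degree n (a *+ b).
Proof. by case: b => // _; exact: in_degree0. Qed.

Lemma in_degree_power (X : sset) n (a : cohomology X) : in_degree 1 a -> in_degree n (a ^+ n).
Proof. by move=> a1; have := in_degreeX n a1; rewrite mul1n. Qed.

Lemma klein_poly_degree l : in_degree (size l).-1 (klein_poly l).
Proof.
elim: l => [|x l IH] /=; first exact: in_degree0.
apply: in_degreeD; first exact/in_degree_mulb/in_degree_power/chi_degree.
case: l IH => [|y l] IH; first by rewrite mulr0; exact: in_degree0.
by apply: (@in_degreeM _ 1); [exact: chi_degree | exact: IH].
Qed.

Lemma res_fst_t2 : res (fst_hom 'F_2) tF2 = s.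
Proof. exact: res_chi. Qed.

Lemma res_inl_s : res (inl_hom 'F_2) s = tF2.
Proof. exact: res_chi. Qed.

Lemma tF2_power_neq0 n : tF2 ^+ n != 0.
Proof.
have := cyclic_neq0 F2_cyclic n.
by rewrite /cyclic_gen -exprM -exprD mul2n odd_double_half.
Qed.

Lemma mulb_addr (X : sset) (a : cohomology X) (b b' : bool) : a *+ b + a *+ b' = a *+ (b (+) b').
Proof. by case: b b' => [] [] //=; rewrite ?addHH ?addr0 ?add0r. Qed.

Lemma klein_polyD l l' : size l = size l' -> 
  klein_poly l + klein_poly l' = klein_poly [seq p.1 (+) p.2 | p <- zip l l'].
Proof.
elim: l l' => [|x l IH] [|y l'] //=; first by rewrite addr0.
move=> [ll']; rewrite -IH // mulrDr -mulb_addr size_map size_zip ll' minnn.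
by rewrite addrACA.
Qed.

(** Setting t = 0 by restriction isolates the first coefficient, and t can be cancelled from the
    rest. *)
Lemma klein_poly_eq0 l : klein_poly l = 0 -> l = nseq (size l) false.
Proof.
elim: l => [|x l IH] //= lE.
have := congr1 (res (inl_hom 'F_2)) lE.
rewrite rmorph0 rmorphD /= rmorphM /= res_inl_snd mul0r addr0 rmorphMn /= rmorphXn /= res_inl_s.
case: x lE => [_ /eqP|]; first by rewrite (negPf (tF2_power_neq0 _)).
rewrite mulr0n add0r => lE _; congr cons; apply: IH.
exact: (prod_inj (klein_poly_degree l) lE).
Qed.

Lemma klein_poly_inj l l' : size l = size l' -> klein_poly l = klein_poly l' -> l = l'.
Proof.
move=> ll' E; have := klein_polyD ll'; rewrite E addHH => /esym/klein_poly_eq0.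
elim: l l' ll' {E} => [|x l IH] [|y l'] //= [ll'] [xy E].
by rewrite (IH l') //; case: x y xy => [] [].
Qed.

(** The coefficients at odd powers of s vanish. This is the shape of restrictions from C16 x Z/2,
    since classes of odd degree of C16 die on its subgroup of order 2. *)
Fixpoint even_poly_seq (l : seq bool) : bool :=
  if l is x :: l' then (odd (size l') ==> ~~ x) && even_poly_seq l' else true.

End KleinFourRing.

(** * The cyclic groups of order 4, 8 and 16, and their products with Z/2 *)

Notation C4 := 'I_4.
Notation C8 := 'I_8.
Notation C16 := 'I_16.

Definition C4_index2 : index2 'F_2 C4 := @cyclic_index2 1 3 erefl.
Definition C8_index2 : index2 C4 C8 := @cyclic_index2 3 7 erefl.
Definition C16_index2 : index2 C8 C16 := @cyclic_index2 7 15 erefl.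

Definition e4 : H C4 := chi_class (sgn C4_index2).
Definition e8 : H C8 := chi_class (sgn C8_index2).
Definition e16 : H C16 := chi_class (sgn C16_index2).

Definition c4_subproof := @cyclic_step _ _ C4_index2 _ _ F2_cyclic (@cyclic_chars 1 3 erefl).
Definition c4 : H C4 := sval (cid c4_subproof).
Lemma C4P : [/\ cyclic_ring e4 c4, e4 ^+ 2 = 0, res (inc C4_index2) c4 = tF2 ^+ 2 &
  forall k, tr C4_index2 (tF2 * (tF2 ^+ 2) ^+ k) = e4 * c4 ^+ k].
Proof. exact: (svalP (cid c4_subproof)). Qed.

Definition C4_cyclic : cyclic_ring e4 c4 := let: And4 p _ _ _ := C4P in p.
Definition c8_subproof := @cyclic_step _ _ C8_index2 _ _ C4_cyclic (@cyclic_chars 3 7 erefl).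
Definition c8 : H C8 := sval (cid c8_subproof).
Lemma C8P : [/\ cyclic_ring e8 c8, e8 ^+ 2 = 0, res (inc C8_index2) c8 = c4 &
  forall k, tr C8_index2 (e4 * c4 ^+ k) = e8 * c8 ^+ k].
Proof. exact: (svalP (cid c8_subproof)). Qed.

Definition C8_cyclic : cyclic_ring e8 c8 := let: And4 p _ _ _ := C8P in p.
Definition c16_subproof := @cyclic_step _ _ C16_index2 _ _ C8_cyclic (@cyclic_chars 7 15 erefl).
Definition c16 : H C16 := sval (cid c16_subproof).
Lemma C16P : [/\ cyclic_ring e16 c16, e16 ^+ 2 = 0, res (inc C16_index2) c16 = c8 &
  forall k, tr C16_index2 (e8 * c8 ^+ k) = e16 * c16 ^+ k].
Proof. exact: (svalP (cid c16_subproof)). Qed.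

Definition C16_cyclic : cyclic_ring e16 c16 := let: And4 p _ _ _ := C16P in p.

Definition F2_C8 : ghom 'F_2 C8 := @zmul 1 7 4 isT.
Definition F2_C16 : ghom 'F_2 C16 := @zmul 1 15 8 isT.

Lemma res_F2_c8 : res F2_C8 c8 = tF2 ^+ 2.
Proof.
have [_ _ <- _] := C4P; have [_ _ <- _] := C8P.
rewrite (@res_comp _ _ _ (inc C4_index2) (inc C8_index2) F2_C8) //.
by case=> [[|[|//]] ?]; apply: val_inj.
Qed.

Lemma res_F2_c16 : res F2_C16 c16 = tF2 ^+ 2.
Proof.
rewrite -res_F2_c8; have [_ _ <- _] := C16P.
rewrite (@res_comp _ _ _ F2_C8 (inc C16_index2) F2_C16) //.
by case=> [[|[|//]] ?]; apply: val_inj.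
Qed.

Section Extend.
Variables (hT gT : finGroupType) (f : ghom hT gT).
Lemma extend_subproof (x y : hT * 'F_2) :
  (f (x * y)%g.1, (x * y)%g.2) = ((f x.1, x.2) * (f y.1, y.2))%g.
Proof. by rewrite ghomM. Qed.
Definition extend_hom : ghom (hT * 'F_2)%type (gT * 'F_2)%type := GHom extend_subproof.

Lemma res_extend_fst a : res extend_hom (res (fst_hom gT) a) = res (fst_hom hT) (res f a).
Proof.
have E x y : f (x * y : hT * 'F_2)%g.1 = (f x.1 * f y.1)%g by rewrite ghomM.
by rewrite !(res_comp (h := GHom E)).
Qed.

Lemma res_extend_snd : res extend_hom (chi_class (snd_hom gT)) = chi_class (snd_hom hT).
Proof. exact: res_chi. Qed.

Lemma res_extend_inl a : res (inl_hom hT) (res extend_hom a) = res f (res (inl_hom gT) a).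
Proof.
have E x y : (f (x * y)%g, (0 : 'F_2)) = ((f x, 0 : 'F_2) * (f y, 0 : 'F_2))%g.
  by rewrite ghomM; congr pair; apply: val_inj.
by rewrite !(res_comp (h := GHom E)).
Qed.
End Extend.

Lemma res_inc_e16 : res (inc C16_index2) e16 = 0.
Proof. exact: (res_sgn C16_index2). Qed.

Lemma cyclic_gen_even (gT : finGroupType) (e c : H gT) n : ~~ odd n ->
  cyclic_gen e c n = c ^+ n./2.
Proof. by rewrite /cyclic_gen => /negPf ->; rewrite mul1r. Qed.

Lemma cyclic_gen_odd (gT : finGroupType) (e c : H gT) n : odd n ->
  cyclic_gen e c n = e * c ^+ n./2.
Proof. by rewrite /cyclic_gen => ->. Qed.

Lemma C16_res_F2 n (a : H C16) : in_degree n a -> exists b : bool,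
  res F2_C16 a = tF2 ^+ n *+ b /\ (odd n ==> ~~ b).
Proof.
move=> /(cyclic_span C16_cyclic)[->|->].
  by exists false; rewrite rmorph0 implybT.
case: (boolP (odd n)) => on; [exists false|exists true]; split=> //.
  rewrite cyclic_gen_odd // rmorphM /= (res_chi0 (f := F2_C16)) ?mul0r //.
  by case=> [[|[|//]] ?]; apply: val_inj.
by rewrite cyclic_gen_even // rmorphXn /= res_F2_c16 -exprM mul2n even_halfK.
Qed.

(** The subgroup of order 2 misses only multiples of [e16], and these vanish on C8 as well. *)
Lemma C16_res_eq0 n (a : H C16) : in_degree n a -> res F2_C16 a = 0 -> res (inc C16_index2) a = 0.
Proof.
move=> /(cyclic_span C16_cyclic)[->|->]; first by rewrite !rmorph0.
case: (boolP (odd n)) => on.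
  by rewrite cyclic_gen_odd // !rmorphM /= res_inc_e16 !mul0r.
rewrite cyclic_gen_even // !rmorphXn /= res_F2_c16 -exprM => /eqP.
by rewrite (negPf (tF2_power_neq0 _)).
Qed.

Local Notation jV := (extend_hom F2_C16).
Local Notation jA := (extend_hom (inc C16_index2)).

Lemma res_klein_even n (a : H (C16 * 'F_2)%type) : in_degree n a ->
  exists l, [/\ size l = n.+1, res jV a = klein_poly l & even_poly_seq l].
Proof.
elim: n a => [|n IH] a an.
  rewrite (prod_degree0 an) res_extend_fst.
  have [b [-> bn]] := C16_res_F2 (pull_degree (Bmap (inl_hom C16)) an).
  exists [:: b]; split=> //=.
  by rewrite mulr0 addr0 !expr0 rmorphMn /= rmorph1.
have [b bn ->] := prod_decomp an.
rewrite rmorphD rmorphM /= res_extend_fst res_extend_snd.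
have [x [-> xn]] := C16_res_F2 (pull_degree (Bmap (inl_hom C16)) an).
have [l [ls -> lev]] := IH _ bn.
exists (x :: l); split=> /=; rewrite ?ls //; last by rewrite xn.
by rewrite rmorphMn /= rmorphXn /= res_fst_t2.
Qed.

Lemma klein_detect n (a : H (C16 * 'F_2)%type) : in_degree n a ->
  res jV a = 0 -> res jA a = 0.
Proof.
elim: n a => [|n IH] a an a0; have h0 : res F2_C16 (res (inl_hom C16) a) = 0.
- by rewrite -res_extend_inl a0 rmorph0.
- rewrite (prod_degree0 an) res_extend_fst.
  by rewrite (C16_res_eq0 (pull_degree _ an) h0) rmorph0.
- by rewrite -res_extend_inl a0 rmorph0.
have [b bn aE] := prod_decomp an; move: a0; rewrite aE !rmorphD !rmorphM /=.
rewrite !res_extend_fst !res_extend_snd h0 (C16_res_eq0 (pull_degree _ an) h0) !rmorph0 !add0r.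
move=> /(prod_inj (pull_degree _ bn)) /(IH _ bn) ->.
by rewrite mulr0.
Qed.

Section Twist.
Variables (B : finGroupType) (f : ghom 'F_2 B).
Hypothesis B_comm : forall x y : B, (x * y = y * x)%g.

Lemma twist_subproof (x y : B * 'F_2) :
  ((x * y)%g.1 * f (x * y)%g.2 = (x.1 * f x.2) * (y.1 * f y.2))%g.
Proof.
rewrite ghomM /= -!mulgA; congr (_ * _)%g.
by rewrite !mulgA (B_comm y.1).
Qed.

(** Pullback along it tensors a representation with the sign character of Z/2, provided that the
    nontrivial value of [f] acts by -1. *)
Definition twist_hom : ghom (B * 'F_2)%type B := GHom twist_subproof.
End Twist.

Definition C8_twist : ghom (C8 * 'F_2)%type C8 := twist_hom F2_C8 (@Zp_mulgC 7).
Definition C16_twist : ghom (C16 * 'F_2)%type C16 := twist_hom F2_C16 (@Zp_mulgC 15).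

(** * The squares of the product of two Euler classes *)

Section KleinSquares.
Let V : finGroupType := ('F_2 * 'F_2)%type.
Local Notation s := (chi_class (fst_hom 'F_2)).
Local Notation t := (chi_class (snd_hom 'F_2)).
Local Notation jV := (extend_hom F2_C16).
Local Notation jA := (extend_hom (inc C16_index2)).

(** With [c16] seen as the mod 2 Euler class of a faithful plane, this is w_4 of the sum of that
    plane and its twist by the sign of Z/2; r_8 has this shape on the subgroups C8 x Z/2. *)
Let W16 := res (fst_hom C16) c16 * res C16_twist c16.

Lemma swap_subproof (x y : V) : (((x * y)%g.2, (x * y)%g.1) : V) = (((x.2, x.1) : V) * (y.2, y.1))%g.
Proof. by []. Qed.
Definition swap_hom : ghom V V := GHom swap_subproof.
Lemma res_swap_s : res swap_hom s = t. Proof. exact: res_chi. Qed.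
Lemma res_swap_t : res swap_hom t = s. Proof. exact: res_chi. Qed.

Lemma shear_subproof (x y : V) :
  (((x * y)%g.1 + (x * y)%g.2, (x * y)%g.2) : V) = (((x.1 + x.2, x.2) : V) * (y.1 + y.2, y.2))%g.
Proof. by congr pair; rewrite [LHS]addrACA. Qed.
Definition shear_hom : ghom V V := GHom shear_subproof.

Lemma F2_comm (x y : 'F_2) : (x * y = y * x)%g.
Proof. exact: addrC. Qed.
Definition sum_hom : ghom V 'F_2 := twist_hom idF2 F2_comm.

Lemma sum_class : chi_class sum_hom = s + t.
Proof. exact: chi_classD. Qed.

Lemma res_shear_s : res shear_hom s = s + t.
Proof. by rewrite -sum_class; exact: res_chi. Qed.
Lemma res_shear_t : res shear_hom t = t. Proof. exact: res_chi. Qed.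

Lemma res_W16 : res jV W16 = s ^+ 2 * (s + t) ^+ 2.
Proof.
rewrite rmorphM /= res_extend_fst res_F2_c16 rmorphXn /= res_fst_t2; congr (_ * _).
have E (x y : V) : (F2_C16 (sum_hom (x * y)%g) = F2_C16 (sum_hom x) * F2_C16 (sum_hom y))%g.
  by rewrite !ghomM.
rewrite (res_comp (h := GHom E)); last by move=> x; exact: ghomM.
rewrite -(res_comp (f := sum_hom) (g := F2_C16)) // res_F2_c16 rmorphXn /=.
by rewrite -sum_class (res_chi (chi' := sum_hom)).
Qed.

Lemma klein_squares_C : s ^+ 2 * (s + t) ^+ 2 = (s ^+ 4 : H V) + s ^+ 2 * t ^+ 2.
Proof. by rewrite sqrHD mulrDr -exprD. Qed.

Lemma res_shear_C : res shear_hom (s ^+ 2 * (s + t) ^+ 2) = s ^+ 2 * (s + t) ^+ 2.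
Proof.
rewrite rmorphM !rmorphXn rmorphD /= res_shear_s res_shear_t.
by rewrite -addrA addHH addr0 mulrC.
Qed.

(** The summand s^4 comes from the first factor, so its square is the term at t^0; all the remaining
    terms belong to the square of s^2 t^2. *)
Lemma Sq_klein k x l : Sq k (s ^+ 2 * (s + t) ^+ 2) = klein_poly (x :: l) ->
  Sq k (s ^+ 2 * t ^+ 2) = t * klein_poly l.
Proof.
move=> CE; have := CE; rewrite klein_squares_C SqD.
have -> : s ^+ 4 = res (fst_hom 'F_2) (res (inl_hom 'F_2) (s ^+ 2 * (s + t) ^+ 2)).
  rewrite [res (inl_hom _) _](_ : _ = tF2 ^+ 4); first by rewrite rmorphXn /= res_fst_t2.
  by rewrite rmorphM !rmorphXn rmorphD /= res_inl_s res_inl_snd addr0 -exprD.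
rewrite -!pull_Sq CE /= rmorphD rmorphM /= res_inl_snd mul0r addr0.
rewrite !rmorphMn /= !rmorphXn /= res_inl_s res_fst_t2 => /addrI.
exact.
Qed.

Lemma klein_swap l : res swap_hom (klein_poly l) = klein_poly (rev l).
Proof.
have revE x l' : klein_poly (rcons l' x) = s * klein_poly l' + t ^+ size l' *+ x.
  elim: l' => [|y l' IH] /=; first by rewrite !mulr0 !expr0 addr0 add0r.
  by rewrite IH size_rcons exprS mulrDr mulrnAr mulrDr addrA mulrCA [in RHS]exprS mulrnAr.
elim: l => [|x l IH]; first by rewrite rmorph0.
rewrite rev_cons revE /= rmorphD rmorphM /= res_swap_t IH rmorphMn /= rmorphXn /= res_swap_s.
by rewrite size_rev addrC.
Qed.

(** The class s^2 t^2 is symmetric in s and t, so the coefficients of its square form a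
    palindrome. *)
Lemma Sq_klein_swap k x l : Sq k (s ^+ 2 * (s + t) ^+ 2) = klein_poly (x :: l) ->
  rcons (rev l) false = false :: l.
Proof.
move=> /Sq_klein E; apply: klein_poly_inj; first by rewrite size_rcons size_rev.
have E' : klein_poly (false :: l) = Sq k (s ^+ 2 * t ^+ 2) by rewrite E /= add0r.
rewrite -rev_cons -klein_swap E' pull_Sq rmorphM !rmorphXn /= res_swap_s res_swap_t.
by rewrite mulrC.
Qed.

Lemma klein_Sq_even k : exists l, [/\ size l = k.+1.+4,
  Sq k (s ^+ 2 * (s + t) ^+ 2) = klein_poly l & even_poly_seq l].
Proof.
have W4 : in_degree 4 W16.
  by apply: (@in_degreeM _ 2 2); apply: pull_degree; exact: (cyclic_deg2 C16_cyclic).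
have [l [ls lE lev]] := res_klein_even (Sq_degree k W4).
by exists l; split; rewrite // -lE pull_Sq res_W16.
Qed.

(** In an odd total degree one of the two exponents of a monomial is odd, so evenness in s and
    symmetry together exclude all monomials. *)
Lemma Sq1_klein : Sq 1 (s ^+ 2 * (s + t) ^+ 2) = 0.
Proof.
have [l [ls lE lev]] := klein_Sq_even 1.
case: l ls lev lE => [|x0 [|x1 [|x2 [|x3 [|x4 [|x5 [|]]]]]]] // _.
rewrite [even_poly_seq _]/= !andbT => /and3P[/negPf-> /negPf-> /negPf->] lE.
have : [:: x5; false; x3; false; x1; false] = [:: false; x1; false; x3; false; x5].
  exact: Sq_klein_swap lE.
case=> x5E x1E x3E _ _ _; rewrite lE x5E -x1E x3E.
by rewrite /= !mulr0n !(mulr0, addr0).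
Qed.

Lemma Sq3_klein : Sq 3 (s ^+ 2 * (s + t) ^+ 2) = 0.
Proof.
have [l [ls lE lev]] := klein_Sq_even 3.
case: l ls lev lE => [|x0 [|x1 [|x2 [|x3 [|x4 [|x5 [|x6 [|x7 [|]]]]]]]]] // _.
rewrite [even_poly_seq _]/= !andbT => /and4P[/negPf-> /negPf-> /negPf-> /negPf->] lE.
have : [:: x7; false; x5; false; x3; false; x1; false] =
         [:: false; x1; false; x3; false; x5; false; x7] by exact: Sq_klein_swap lE.
case=> x7E x1E x5E x3E _ _ _ _; rewrite lE x7E -x1E x5E -x3E.
by rewrite /= !mulr0n !(mulr0, addr0).
Qed.

Lemma Sq2_klein : Sq 2 (s ^+ 2 * (s + t) ^+ 2) = s ^+ 2 * (s + t) ^+ 2 * t ^+ 2.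
Proof.
have [l [ls lE lev]] := klein_Sq_even 2.
case: l ls lev lE => [|x0 [|x1 [|x2 [|x3 [|x4 [|x5 [|x6 [|]]]]]]]] // _.
rewrite [even_poly_seq _]/= !andbT => /and3P[/negPf-> /negPf-> /negPf->] lE.
have KE := Sq_klein lE.
have : [:: x6; false; x4; false; x2; false; false] =
         [:: false; false; x2; false; x4; false; x6] by exact: Sq_klein_swap lE.
case=> x6E x4E _ _; rewrite x6E x4E {x6E x4E} in lE KE.
(* Evenness and symmetry leave the coefficient at s^6 and a common one at s^4 t^2 and s^2 t^4; the
   explicit cycle decides the latter. *)
have x2_true : x2 = true.
  case: x2 KE {lE} => // KE; have := Sq2_klein_neq0; rewrite KE.
  by rewrite /= !mulr0n !(mulr0, addr0) eqxx.
move: lE; rewrite x2_true {KE x2 x2_true} => lE.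
have pE x : klein_poly [:: x; false; true; false; true; false; false] =
    s ^+ 6 *+ x + (s ^+ 4 * t ^+ 2 + s ^+ 2 * t ^+ 4).
  by rewrite /= !mulr0n !mulr1n; ring.
(* The shear s -> s + t fixes s^2 (s + t)^2. With a term s^6, invariance of the square would force
   t^6 = s^4 t^2 + s^2 t^4, which fails at s = 0. *)
have x0_false : x0 = false.
  case: x0 lE => // lE; have := pull_Sq (Bmap shear_hom) 2 (s ^+ 2 * (s + t) ^+ 2).
  rewrite res_shear_C lE pE mulr1n !(rmorphD, rmorphM, rmorphXn) /= res_shear_s res_shear_t.
  move=> E; suff : t ^+ 6 = s ^+ 4 * t ^+ 2 + s ^+ 2 * t ^+ 4 :> H V.
    have E1 k m : res (inl_hom 'F_2) (res swap_hom (s ^+ k * t ^+ m)) = 0 ^+ k * tF2 ^+ m.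
      by rewrite !rmorphM /= !rmorphXn /= res_swap_t res_swap_s res_inl_s res_inl_snd.
    move/(congr1 (res swap_hom))/(congr1 (res (inl_hom 'F_2))).
    rewrite !rmorphD /= !E1 !expr0n !mul0r addr0 -[t ^+ 6]mul1r (E1 0%N 6) mul1r => /eqP.
    by rewrite (negPf (tF2_power_neq0 _)).
  move/eqP: E; rewrite -subr_eq0 => /eqP.
  move: (chi_class (fst_hom _)) (chi_class (snd_hom _)) => p q E.
  rewrite -[LHS]addr0 -[0]E.
  (* Half of an integer polynomial all of whose coefficients are even; it enters as y + y and
     disappears mod 2. *)
  pose y := p ^+ 6 *+ 0 + p ^+ 5 * q *+ 3 + p ^+ 4 * q ^+ 2 *+ 7 + p ^+ 3 * q ^+ 3 *+ 12 +
    p ^+ 2 * q ^+ 4 *+ 10 + p * q ^+ 5 *+ 6 + q ^+ 6 *+ 2.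
  rewrite [LHS](_ : _ = p ^+ 4 * q ^+ 2 + p ^+ 2 * q ^+ 4 + (y + y)); first by rewrite addHH addr0.
  by rewrite /y; ring.
move: lE; rewrite x0_false pE mulr0n add0r => ->.
by rewrite sqrHD; ring.
Qed.

Let W8 := res (fst_hom C8) c8 * res C8_twist c8.

Lemma res_W16_C8 : res jA W16 = W8.
Proof.
have [_ _ rc _] := C16P.
rewrite rmorphM /= res_extend_fst rc; congr (_ * _).
have E (x y : C8 * 'F_2) : (inc C16_index2 (C8_twist (x * y)%g) =
    inc C16_index2 (C8_twist x) * inc C16_index2 (C8_twist y))%g.
  exact: etrans (congr1 _ (ghomM C8_twist x y)) (ghomM _ _ _).
rewrite (res_comp (h := GHom E)) -?rc ?(res_comp (h := GHom E)) // => x.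
rewrite -[LHS]/(inc C16_index2 (x.1 * F2_C8 x.2)%g) ghomM; congr (_ * _)%g.
by rewrite -[RHS]/(F2_C16 x.2); case: x.2 => [[|[|//]] ?]; apply: val_inj.
Qed.

(* Classes of C16 x Z/2 that vanish on (Z/2)^2 need not be 0, but they vanish on
   C8 x Z/2, because e16 does; hence the detour through C16. *)
Lemma Sq_W8 k (b : H (C16 * 'F_2)%type) : in_degree (4 + k) b ->
  Sq k (s ^+ 2 * (s + t) ^+ 2) = res jV b -> Sq k W8 = res jA b.
Proof.
move=> bk E; have W4 : in_degree 4 W16.
  by apply: (@in_degreeM _ 2 2); apply: pull_degree; exact: (cyclic_deg2 C16_cyclic).
apply: addHC_eq0; rewrite -res_W16_C8 -pull_Sq -rmorphD.
apply: (klein_detect (in_degreeD (Sq_degree k W4) bk)).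
by rewrite rmorphD /= pull_Sq res_W16 E addHH.
Qed.

Lemma Sq1_W8 : Sq 1 W8 = 0.
Proof.
rewrite (@Sq_W8 1 0); first by rewrite rmorph0.
  exact: in_degree0.
by rewrite Sq1_klein rmorph0.
Qed.

Lemma Sq3_W8 : Sq 3 W8 = 0.
Proof.
rewrite (@Sq_W8 3 0); first by rewrite rmorph0.
  exact: in_degree0.
by rewrite Sq3_klein rmorph0.
Qed.

Lemma Sq2_W8 : Sq 2 W8 = W8 * chi_class (snd_hom C8) ^+ 2.
Proof.
rewrite (@Sq_W8 2 (W16 * chi_class (snd_hom C16) ^+ 2)).
- by rewrite rmorphM rmorphXn /= res_W16_C8 res_extend_snd.
- apply: (@in_degreeM _ 4 2); last exact/in_degree_power/chi_degree.
  by apply: (@in_degreeM _ 2 2); apply: pull_degree; exact: (cyclic_deg2 C16_cyclic).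
- by rewrite Sq2_klein rmorphM rmorphXn /= res_W16 res_extend_snd.
Qed.

End KleinSquares.

(** * Stiefel-Whitney classes of representations *)

Section LineBundles.
Variable R : realType.
Local Open Scope classical_set_scope.

Lemma vertex0_subproof : (\row_(j < 1) 1 : 'rV[R]_1) \in @std_simplex R 0.
Proof.
apply/mem_set; split=> [i|]; first by rewrite mxE ler01.
by rewrite big_ord1 mxE.
Qed.

Definition vertex0 : @std_simplex R 0 := exist (fun u => u \in @std_simplex R 0) _ vertex0_subproof.
Definition first_vertex n : @std_simplex R n := affine (fun=> ord0) vertex0.

(** Extends the segment between two points of the simplex to a map on all of R, so that the
    intermediate value theorem for real functions applies. *)
Definition clamp (x : R) : R := Num.max 0 (Num.min 1 x).

Lemma clamp_ge0 x : 0 <= clamp x.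
Proof. by rewrite le_max lexx. Qed.

Lemma clamp_le1 x : clamp x <= 1.
Proof. by rewrite ge_max ler01 ge_min lexx. Qed.

Lemma clamp_continuous : continuous clamp.
Proof.
move=> x.
apply: (@normed_module.continuous_max R R (fun=> 0) (fun y => Num.min 1 y)).
  exact: cst_continuous.
by apply: (@normed_module.continuous_min R R (fun=> 1) id); [exact: cst_continuous | exact: id].
Qed.

Section Segment.
Variables (n : nat) (p q : @std_simplex R n).
Let pt (x : R) : 'rV[R]_n.+1 := \row_j ((1 - clamp x) * (set_val p : 'rV[R]_n.+1) 0 j +
  clamp x * (set_val q : 'rV[R]_n.+1) 0 j).

Lemma segment_subproof x : pt x \in @std_simplex R n.
Proof.
have [p0 p1] := set_valP p; have [q0 q1] := set_valP q.
apply/mem_set; split=> [i|].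
  by rewrite mxE addr_ge0 ?mulr_ge0 ?p0 ?q0 ?clamp_ge0 // subr_ge0 clamp_le1.
under eq_bigr do rewrite mxE.
by rewrite big_split /= -!mulr_sumr p1 q1 !mulr1 subrK.
Qed.

Definition segment (x : R) : @std_simplex R n :=
  exist (fun u => u \in @std_simplex R n) _ (segment_subproof x).

Lemma segment_continuous : continuous segment.
Proof.
apply: continuous_comp_initial; apply: continuous_mx => i j.
rewrite [X in continuous X](_ : _ = fun x => (1 - clamp x) * (set_val p : 'rV[R]_n.+1) 0 j +
  clamp x * (set_val q : 'rV[R]_n.+1) 0 j); last first.
  by apply: funext => x; rewrite -[LHS]/(pt x i j) mxE.
move=> x; apply: (@normed_module.continuousD R R R
  (fun y => (1 - clamp y) * (set_val p : 'rV[R]_n.+1) 0 j)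
  (fun y => clamp y * (set_val q : 'rV[R]_n.+1) 0 j)).
- apply: (@normed_module.continuousM R R (fun y => 1 - clamp y) (fun=> (set_val p : 'rV[R]_n.+1) 0 j)); last exact: cst_continuous.
  apply: (@normed_module.continuousB R R R (fun=> 1) clamp); first exact: cst_continuous.
  exact: clamp_continuous.
- apply: (@normed_module.continuousM R R clamp (fun=> (set_val q : 'rV[R]_n.+1) 0 j)); last exact: cst_continuous.
  exact: clamp_continuous.
Qed.
End Segment.

(** The simplex is convex, and along a segment the entry is a continuous function of square 1, so it
    cannot pass through 0. *)
Lemma sign_constant n (g : @std_simplex R n -> 'M[R]_1) (p q : @std_simplex R n) :
  continuous g -> (forall t, g t *m (g t)^T = 1%:M) -> (g p 0 0 < 0) = (g q 0 0 < 0).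
Proof.
move=> gc gO; have g2 t : g t 0 0 * g t 0 0 = 1.
  have := congr1 (fun M : 'M[R]_1 => M 0 0) (gO t).
  by rewrite !mxE big_ord1 mxE.
wlog pq : p q / g p 0 0 < 0 /\ 0 <= g q 0 0.
  move=> th; case: (ltP (g p 0 0) 0) => [p0|p0]; case: (ltP (g q 0 0) 0) => [q0|q0] //.
    by have := th p q (conj p0 q0); rewrite p0 (le_gtF q0).
  by have := th q p (conj q0 p0); rewrite q0 (le_gtF p0).
case: pq => p0 q0; exfalso.
pose f x := g (segment p q x) 0 0.
have seg0 : segment p q 0 = p.
  apply: val_inj; apply/rowP => j; rewrite [LHS]mxE /clamp min_r ?ler01 // max_l //.
  by rewrite subr0 mul1r mul0r addr0.
have seg1 : segment p q 1 = q.
  apply: val_inj; apply/rowP => j; rewrite [LHS]mxE /clamp min_l // max_r ?ler01 //.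
  by rewrite subrr mul0r mul1r add0r.
have fc : continuous f.
  move=> x; apply: (@continuous_comp _ _ _ (segment p q) (fun t => g t 0 0)).
    exact: segment_continuous.
  apply: (@continuous_comp _ _ _ g (fun M : 'M[R]_1 => M 0 0)); first exact: gc.
  exact: matrix_normedtype.coord_continuous.
have [||c _ fc0] := @normed_module.IVT R f 0 1 0 ler01.
- exact: continuous_subspaceT.
- by rewrite /f seg0 seg1 ge_min (ltW p0) le_max q0 orbT.
by have /eqP := g2 (segment p q c); rewrite -/(f c) fc0 mul0r eq_sym oner_eq0.
Qed.

End LineBundles.

Section Representations.
Variable R : realType.

Section Builder.
Variables (gT : finGroupType) (k : nat) (f : gT -> 'M[R]_k).
Hypothesis f1 : f 1%g = 1%:M.
Hypothesis fM : forall x y, f (x * y)%g = f x *m f y.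
Hypothesis fO : forall x, f x *m (f x)^T = 1%:M.

Definition build_rep : orthogonal_rep R gT k :=
  @OrthogonalRep R gT k (MxRepresentation (conj f1 (fun x y _ _ => fM x y) : mx_repr [set: gT] f)) fO.

End Builder.

Lemma rep_homM (gT : finGroupType) k (r : orthogonal_rep R gT k) x y : r (x * y)%g = r x *m r y.
Proof. by rewrite repr_mxM ?inE. Qed.

Lemma rep_hom1 (gT : finGroupType) k (r : orthogonal_rep R gT k) : r 1%g = 1%:M.
Proof. exact: repr_mx1. Qed.

Definition restrict_rep (hT gT : finGroupType) (f : ghom hT gT) k (r : orthogonal_rep R gT k) :
  orthogonal_rep R hT k.
Proof.
refine (@build_rep hT k (fun x => r (f x)) _ _ _).
- by rewrite ghom1 rep_hom1.
- by move=> x y; rewrite ghomM rep_homM.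
- by move=> x; exact: rep_orthogonal.
Defined.

Definition sum_rep (gT : finGroupType) k l (r : orthogonal_rep R gT k) (r' : orthogonal_rep R gT l) :
  orthogonal_rep R gT (k + l).
Proof.
refine (@build_rep gT (k + l) (fun x => block_diag (r x) (r' x)) _ _ _).
- by rewrite !rep_hom1 /block_diag -scalar_mx_block.
- by move=> x y; rewrite !rep_homM block_diagM.
- by move=> x; apply: block_diag_orthogonal; exact: rep_orthogonal.
Defined.

Lemma orthogonalC k (Q : 'M[R]_k) : Q *m Q^T = 1%:M -> Q^T *m Q = 1%:M.
Proof. exact: mulmx1C. Qed.

Lemma conj_rep_orthogonal k (Q A : 'M[R]_k) : Q *m Q^T = 1%:M -> A *m A^T = 1%:M ->
  (Q *m A *m Q^T) *m (Q *m A *m Q^T)^T = 1%:M.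
Proof.
move=> QQ AA; rewrite !trmx_mul trmxK !mulmxA -(mulmxA _ Q^T) (orthogonalC QQ) mulmx1.
by rewrite -(mulmxA _ A) AA mulmx1.
Qed.

Variable w : forall k : nat, nat -> cohomology (BO R k).
Hypothesis w_universal : stiefel_whitney w.

Section Classes.
Variable gT : finGroupType.

Lemma sw_0 k (r : orthogonal_rep R gT k) : sw w 0 r = 1.
Proof. by rewrite /sw (sw_unit w_universal) rmorph1. Qed.

Lemma sw_above k (r : orthogonal_rep R gT k) j : (k < j)%N -> sw w j r = 0.
Proof. by move=> kj; rewrite /sw (sw_rank w_universal) // rmorph0. Qed.

Lemma sw_in k (r : orthogonal_rep R gT k) j : in_degree j (sw w j r).
Proof. by apply: pull_degree; exact: (sw_degree w_universal). Qed.

Lemma sw_sum_rep j k l (r : orthogonal_rep R gT k) (r' : orthogonal_rep R gT l)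
    (r'' : orthogonal_rep R gT (k + l)) : (forall x, r'' x = block_diag (r x) (r' x)) ->
  sw w j r'' = \sum_(i < j.+1) sw w i r * sw w (j - i)%N r'.
Proof.
move=> rE.
(* The pair of classifying maps; followed by the block sum it is the classifying map of the sum. *)
pose P : smap (nerve gT) (prod_sset (BO R k) (BO R l)) :=
  @SMap (nerve gT) (prod_sset (BO R k) (BO R l)) (fun n s => (Brep r n s, Brep r' n s))
    (fun m n f s => f_equal2 pair (smap_act (Brep r) f s) (smap_act (Brep r') f s)).
have -> : sw w j r'' = pullback P (pullback (BO_sum R k l) (w (k + l)%N j)).
  apply/esym/pull_comp => n s; apply: BO_simplexP => a b t /=; exact: rE.
rewrite (sw_sum w_universal) rmorph_sum; apply: eq_bigr => i _.
by rewrite rmorphM /=; congr (_ * _); exact: pull_comp.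
Qed.

End Classes.

Lemma sw_res (hT gT : finGroupType) (f : ghom hT gT) j k (r : orthogonal_rep R gT k)
    (r' : orthogonal_rep R hT k) : (forall x, r' x = r (f x)) ->
  res f (sw w j r) = sw w j r'.
Proof. by move=> rE; apply: pull_comp => n s; apply: BO_simplexP => a b t /=. Qed.

Section Conjugate.
Variables (gT : finGroupType) (k : nat) (Q : 'M[R]_k) (r : orthogonal_rep R gT k).
Hypothesis QQ : Q *m Q^T = 1%:M.

Definition conj_weight (b : bool) : 'M[R]_k := if b then Q else 1%:M.

Lemma conj_weightP b : conj_weight b *m (conj_weight b)^T = 1%:M.
Proof. by case: b; rewrite /= ?trmx1 ?mulmx1. Qed.

Definition conj_homotopy_simplex n (s : simplex (prod_sset (nerve gT) interval) n) :
  BO_simplex R k n.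
Proof.
refine (@BOSimplex R k n (fun i j _ =>
  conj_weight (s.2 i) *m r (label s.1 i j) *m (conj_weight (s.2 j))^T) _ _ _).
- by move=> i j; exact: cst_continuous.
- move=> i j t; rewrite !trmx_mul trmxK !mulmxA -(mulmxA _ (conj_weight _)^T (conj_weight _)) (orthogonalC (conj_weightP _)) mulmx1.
  by rewrite -(mulmxA _ (r _)) rep_orthogonal mulmx1 conj_weightP.
- move=> i j l t; rewrite -(labelM s.1 i j l) rep_homM !mulmxA.
  by rewrite -(mulmxA _ (conj_weight _)^T (conj_weight _)) (orthogonalC (conj_weightP _)) mulmx1.
Defined.

Definition conj_homotopy : smap (prod_sset (nerve gT) interval) (BO R k).
Proof.
refine (@SMap (prod_sset (nerve gT) interval) (BO R k) conj_homotopy_simplex _).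
by move=> m n f s; exact: BO_simplexP.
Defined.

(** The homotopy inserts Q at the vertices marked [true]. It is a simplicial one, so no path from Q
    to the identity is involved and the determinant of Q may be -1. *)
Lemma sw_conj j (r' : orthogonal_rep R gT k) : (forall x, r' x = Q *m r x *m Q^T) ->
  sw w j r' = sw w j r.
Proof.
move=> rE; apply/esym; apply: (homotopic_pullback (H := conj_homotopy)) => n s;
  apply: BO_simplexP => a b t /=; first by rewrite mul1mx trmx1 mulmx1.
by rewrite rE.
Qed.
End Conjugate.

Definition neg_hom_fun (x : 'F_2) : 'M[R]_1 := ((-1) ^+ x)%:M.

Lemma neg_hom_funM x y : neg_hom_fun (x * y)%g = neg_hom_fun x *m neg_hom_fun y.
Proof.
rewrite /neg_hom_fun -scalar_mxM -exprD; congr _%:M.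
by case: (F2P x) => ->; case: (F2P y) => ->; rewrite /= ?expr0 ?expr1 // sqrrN expr1n.
Qed.

Lemma neg_hom_funO x : neg_hom_fun x *m (neg_hom_fun x)^T = 1%:M.
Proof.
rewrite /neg_hom_fun tr_scalar_mx -scalar_mxM -exprD addnn -mul2n exprM.
by rewrite sqrrN !expr1n.
Qed.

Definition line_rep : orthogonal_rep R 'F_2 1 :=
  build_rep (erefl : neg_hom_fun 1%g = 1%:M) neg_hom_funM neg_hom_funO.

Lemma neg_sign (b : bool) : (neg_hom_fun (bF2 b)) 0 0 = if b then -1 else 1.
Proof. by rewrite !mxE eqxx mulr1n; case: b. Qed.

Section BO1.
Variables (n : nat) (s : BO_simplex R 1 n).
(** By [sign_constant] the sign may be read off at any point of the simplex; it turns simplices of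
    BO(1) into simplices of the nerve of Z/2. *)
Definition BO1_label (i j : 'I_n.+1) : 'F_2 :=
  bF2 (sing_label s i j (@first_vertex R n) 0 0 < 0).

Lemma BO1_labelE i j t : sing_label s i j t = neg_hom_fun (BO1_label i j).
Proof.
apply/matrixP => a b; rewrite !ord1 /BO1_label neg_sign.
rewrite (sign_constant (first_vertex R n) t (@sing_continuous _ _ _ s i j)); last first.
  exact: sing_orthogonal.
have := congr1 (fun M : 'M[R]_1 => M 0 0) (sing_orthogonal s i j t).
rewrite !mxE big_ord1 mxE eqxx => /eqP; rewrite -expr2 sqrf_eq1 => /orP[]/eqP ->.
  by rewrite ltNge ler01.
by rewrite oppr_lt0 ltr01.
Qed.

End BO1.

Lemma neg_hom_fun_inj : injective neg_hom_fun.
Proof.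
have one_neq : (1 == -1 :> R) = false by rewrite -addr_eq0 (pnatr_eq0 R 2).
move=> x y /(congr1 (fun M : 'M[R]_1 => M 0 0)); rewrite /neg_hom_fun !mxE eqxx !mulr1n.
case: (F2P x) => ->; case: (F2P y) => ->; rewrite ?expr0 ?expr1 // => /eqP.
  by rewrite one_neq.
by rewrite eq_sym one_neq.
Qed.

Lemma BO1_labelM n (s : BO_simplex R 1 n) i j k :
  (BO1_label s i j * BO1_label s j k)%g = BO1_label s i k.
Proof.
apply: neg_hom_fun_inj; rewrite neg_hom_funM -!(BO1_labelE s _ _ (first_vertex R n)).
exact: sing_labelM.
Qed.

Definition BO1_nerve : smap (BO R 1) (nerve 'F_2).
Proof.
refine (@SMap (BO R 1) (nerve 'F_2) (fun n s => NerveSimplex (@BO1_labelM n s)) _).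
move=> m n f s; apply: nerve_simplexP => i j; apply: neg_hom_fun_inj.
by rewrite /= -!(BO1_labelE _ _ _ (first_vertex R m)) -(BO1_labelE _ _ _ (affine f (first_vertex R m))).
Defined.

(** The composite of BO(1) -> BZ/2 -> BO(1) is the identity, so the universal w_1 is pulled back
    from w_1 of the sign line. The latter is nonzero by the axiom [sw_line], and Z/2 has a single
    nonzero class of degree 1. *)
Lemma sw1_line_rep : sw w 1 line_rep = tF2.
Proof.
have wE : w 1%N 1%N = pullback BO1_nerve (sw w 1 line_rep).
  rewrite /sw (@pull_comp _ _ _ _ _ (smap_id (BO R 1))) ?pull_id // => n s.
  by apply: BO_simplexP => i j t /=; rewrite (BO1_labelE s i j t).
have /degree1P[chi chiE] := sw_in line_rep 1.
have [|cE] := cyclic_chars (p := 0) (q := 1) erefl chi.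
  move=> c0; case/eqP: (sw_line w_universal); rewrite wE chiE.
  have -> : chi_class chi = 0.
    rewrite -[LHS](res_id (f := GHom (fun x y : 'F_2 => erefl (x * y)%g))) //.
    exact: res_chi0.
  exact: rmorph0.
rewrite chiE; apply: chi_class_ext => x; rewrite cE /=.
by case: (F2P x) => ->; apply: val_inj.
Qed.

Lemma sw1_line (gT : finGroupType) (r : orthogonal_rep R gT 1) (chi : ghom gT 'F_2) :
  (forall x, r x = neg_hom_fun (chi x)) -> sw w 1 r = chi_class chi.
Proof.
move=> rE; rewrite -(@sw_res _ _ chi 1 1 line_rep r) // sw1_line_rep.
exact: res_chi.
Qed.

Lemma sw_sgn_sum k (r' : orthogonal_rep R 'F_2 k) (r : orthogonal_rep R 'F_2 (1 + k)) :
  (forall x, r x = block_diag (neg_hom_fun x) (r' x)) ->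
  sw w k.+1 r = tF2 * sw w k r'.
Proof.
move=> rE; rewrite (@sw_sum_rep _ _ _ _ line_rep r') // !big_ord_recl big1.
  by rewrite sw1_line_rep subn0 subn1 /= addr0 (sw_above r') ?mulr0 ?add0r.
by move=> i _; rewrite sw_above ?mul0r.
Qed.

(** The representation is a sum of k sign lines, and in the top degree the Whitney formula retains
    only the product of the top classes. *)
Lemma sw_scalar (k : nat) (r : orthogonal_rep R 'F_2 k) :
  (forall x : 'F_2, r x = ((-1) ^+ x)%:M) -> sw w k r = tF2 ^+ k.
Proof.
elim: k r => [|k IH] r rE; first by rewrite sw_0 expr0.
pose f (x : 'F_2) : 'M[R]_k := ((-1) ^+ x)%:M.
have fM x y : f (x * y)%g = f x *m f y.
  rewrite /f -scalar_mxM -exprD; congr _%:M.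
  by case: (F2P x) => ->; case: (F2P y) => ->; rewrite /= ?expr0 ?expr1 // sqrrN expr1n.
have fO x : f x *m (f x)^T = 1%:M.
  by rewrite /f tr_scalar_mx -scalar_mxM -exprD addnn -mul2n exprM sqrrN !expr1n.
rewrite (@sw_sgn_sum k (build_rep (erefl : f 1%g = 1%:M) fM fO)) ?IH ?exprS // => x.
by rewrite rE /block_diag -scalar_mx_block.
Qed.

End Representations.

(** * Orthogonal matrices acting on row vectors *)

Section OrthogonalMatrices.
Variable R : realType.

Definition dot n (u v : 'rV[R]_n) : R := (u *m v^T) 0 0.

Lemma dotE n (u v : 'rV[R]_n) : dot u v = \sum_i u 0 i * v 0 i.
Proof. by rewrite /dot mxE; apply: eq_bigr => i _; rewrite mxE. Qed.

Lemma dot_mx n (u v : 'rV[R]_n) : u *m v^T = (dot u v)%:M.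
Proof. by apply/matrixP => i j; rewrite !ord1 [RHS]mxE eqxx mulr1n. Qed.

Lemma dotC n (u v : 'rV[R]_n) : dot u v = dot v u.
Proof. by rewrite !dotE; apply: eq_bigr => i _; rewrite mulrC. Qed.

Lemma dotDl n (u u' v : 'rV[R]_n) : dot (u + u') v = dot u v + dot u' v.
Proof. by rewrite /dot mulmxDl mxE. Qed.

Lemma dotZl n a (u v : 'rV[R]_n) : dot (a *: u) v = a * dot u v.
Proof. by rewrite /dot -scalemxAl mxE. Qed.

Lemma dotNl n (u v : 'rV[R]_n) : dot (- u) v = - dot u v.
Proof. by rewrite /dot mulNmx mxE. Qed.

Lemma dotDr n (u v v' : 'rV[R]_n) : dot u (v + v') = dot u v + dot u v'.
Proof. by rewrite dotC dotDl !(dotC u). Qed.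

Lemma dotZr n a (u v : 'rV[R]_n) : dot u (a *: v) = a * dot u v.
Proof. by rewrite dotC dotZl dotC. Qed.

Lemma dotNr n (u v : 'rV[R]_n) : dot u (- v) = - dot u v.
Proof. by rewrite dotC dotNl dotC. Qed.

Lemma dot_gt0 n (v : 'rV[R]_n) : v != 0 -> 0 < dot v v.
Proof.
move=> v0; rewrite dotE lt_def sumr_ge0 ?andbT => [|i _]; last by rewrite -expr2 sqr_ge0.
apply: contra v0; rewrite psumr_eq0 => [/allP v0|i _]; last by rewrite -expr2 sqr_ge0.
apply/eqP/rowP => i; rewrite mxE; apply/eqP.
by have := v0 i (mem_index_enum _); rewrite -expr2 sqrf_eq0.
Qed.

Lemma dot_orthogonal n (A : 'M[R]_n) (u v : 'rV[R]_n) : A *m A^T = 1%:M ->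
  dot (u *m A) (v *m A) = dot u v.
Proof. by move=> AA; rewrite /dot trmx_mul mulmxA -(mulmxA u) AA mulmx1. Qed.

Lemma normalize n (v : 'rV[R]_n) : v != 0 -> exists2 a : R, a != 0 & dot (a *: v) (a *: v) = 1.
Proof.
move=> /dot_gt0 v0; exists (Num.sqrt (dot v v))^-1.
  by rewrite invr_eq0 sqrtr_eq0 -ltNge.
by rewrite dotZl dotZr mulrA -expr2 exprVn sqr_sqrtr ?ltW // mulVf // gt_eqF.
Qed.

(** For distinct unit vectors, the reflection in the hyperplane orthogonal to v - e exchanges
    them. *)
Lemma householder n (e v : 'rV[R]_n) : dot e e = 1 -> dot v v = 1 ->
  exists2 Q : 'M[R]_n, Q *m Q^T = 1%:M & e *m Q = v.
Proof.
move=> ee vv; have [->|ev] := eqVneq e v.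
  by exists 1%:M; rewrite ?trmx1 mulmx1.
have [u uE] : {u | u = v - e} by exists (v - e).
have u0 : u != 0 by rewrite uE subr_eq0 eq_sym.
have uu : dot u u = - 2 * dot e u.
  rewrite uE !(dotDl, dotDr, dotNl, dotNr) ee vv (dotC v e).
  by ring.
have uu0 : dot u u != 0 by rewrite gt_eqF ?dot_gt0.
pose c := 2 / dot u u; pose Q := 1%:M - c *: (u^T *m u).
have QT : Q^T = Q by rewrite /Q linearB /= linearZ /= trmx1 trmx_mul trmxK.
exists Q.
  have NN : (u^T *m u) *m (u^T *m u) = dot u u *: (u^T *m u).
    by rewrite mulmxA -(mulmxA u^T) dot_mx mul_mx_scalar -scalemxAl.
  rewrite QT /Q mulmxBl mul1mx mulmxBr mulmx1 -scalemxAl -scalemxAr NN !scalerA.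
  rewrite -scalerBl -addrA -opprD -scalerDl (_ : c + _ = 0) ?scale0r ?subr0 //.
  by rewrite /c; field.
rewrite /Q mulmxBr mulmx1 -scalemxAr mulmxA dot_mx mul_scalar_mx scalerA.
have du : dot e u = - (dot u u / 2) by rewrite uu; field.
have -> : c * dot e u = - 1 by rewrite /c du; field.
by rewrite scaleN1r opprK uE addrCA subrr addr0.
Qed.

Lemma orthogonal_row_frame k (v : 'rV[R]_(1 + k)) : dot v v = 1 ->
  exists2 Q : 'M[R]_(1 + k), Q *m Q^T = 1%:M & row_mx 1%:M 0 *m Q = v.
Proof.
move=> vv; apply: householder => //.
by rewrite /dot tr_row_mx trmx1 trmx0 mul_row_col mulmx1 mulmx0 addr0 mxE eqxx.
Qed.

Lemma orthogonal_frame2 k (v v' : 'rV[R]_(1 + (1 + k))) : dot v v = 1 -> dot v' v' = 1 ->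
  dot v v' = 0 -> exists Q : 'M[R]_(1 + (1 + k)), [/\ Q *m Q^T = 1%:M,
    row_mx 1%:M 0 *m Q = v & row_mx 0 (row_mx 1%:M 0) *m Q = v'].
Proof.
move=> vv vv' v0; have [Q QQ Qv] := orthogonal_row_frame vv.
pose y := v' *m Q^T.
have yy : dot y y = 1.
  rewrite (@dot_orthogonal _ Q^T) // trmxK; exact: orthogonalC.
have y0 : lsubmx y = 0.
  rewrite [LHS](_ : _ = y *m (row_mx 1%:M 0)^T).
    by rewrite /y -mulmxA -trmx_mul Qv dot_mx dotC v0 raddf0.
  by rewrite -[y in RHS]hsubmxK tr_row_mx mul_row_col trmx1 trmx0 mulmx1 mulmx0 addr0.
have yr : dot (rsubmx y) (rsubmx y) = 1.
  by rewrite -yy -[y in RHS]hsubmxK y0 /dot tr_row_mx mul_row_col mul0mx add0r.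
have [P PP Py] := orthogonal_row_frame yr.
exists (block_mx 1%:M 0 0 P *m Q); split.
- have BB := @block_diag_orthogonal R 1 (1 + k) _ _ (orthogonal1 R 1) PP.
  by rewrite trmx_mul mulmxA -(mulmxA _ Q) QQ mulmx1.
- by rewrite mulmxA mul_row_block !mul1mx !mul0mx !addr0 Qv.
- rewrite mulmxA mul_row_block !mul0mx !mulmx0 addr0 add0r Py.
  by rewrite -y0 hsubmxK /y -mulmxA (orthogonalC QQ) mulmx1.
Qed.

Lemma orthogonal_block_eq0 m k (M : 'M[R]_m) (C : 'M[R]_(k, m)) (D : 'M[R]_k) :
  M *m M^T = 1%:M -> block_mx M 0 C D *m (block_mx M 0 C D)^T = 1%:M -> C = 0.
Proof.
move=> MM; rewrite tr_block_mx mulmx_block scalar_mx_block => /eq_block_mx[_ _ + _].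
rewrite trmx0 mulmx0 addr0 => CM.
by rewrite -[C]mulmx1 -(orthogonalC MM) mulmxA CM mul0mx.
Qed.

Definition rot (c s : R) : 'M[R]_(1 + 1) := block_mx c%:M s%:M (- s)%:M c%:M.

Lemma rotM c s c' s' : rot c s *m rot c' s' = rot (c * c' - s * s') (c * s' + s * c').
Proof.
rewrite /rot mulmx_block -!scalar_mxM -!raddfD /=.
by congr block_mx; congr _%:M; ring.
Qed.

Lemma rot1 : rot 1 0 = 1%:M.
Proof.
rewrite /rot oppr0 [RHS]scalar_mx_block (_ : 0%:M = 0) //.
by apply/matrixP => i j; rewrite !mxE mul0rn.
Qed.

Lemma rot_tr c s : (rot c s)^T = rot c (- s).
Proof. by rewrite /rot tr_block_mx !tr_scalar_mx opprK. Qed.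

Lemma rot_orthogonal c s : c ^+ 2 + s ^+ 2 = 1 -> rot c s *m (rot c s)^T = 1%:M.
Proof.
move=> cs; rewrite rot_tr rotM -rot1; congr rot; last by ring.
by rewrite -cs; ring.
Qed.

(** Half-angle formulas: since s >= 0 the angle can be taken in [0, pi], and both the cosine and the
    sine of its half are nonnegative square roots. *)
Lemma rot_sqrt c s : 0 <= s -> c ^+ 2 + s ^+ 2 = 1 ->
  exists c' s', c' ^+ 2 + s' ^+ 2 = 1 /\ rot c s = rot c' s' *m rot c' s'.
Proof.
move=> s0 cs; have c1 : c ^+ 2 <= 1 by rewrite -cs lerDl sqr_ge0.
have /andP[cm1 cp1] : -1 <= c <= 1.
  by rewrite -ler_norml -(@expr_le1 _ 2) // real_normK ?num_real.
pose p := (1 + c) / 2; pose q := (1 - c) / 2.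
have p0 : 0 <= p by rewrite divr_ge0 ?ler0n // -lerBlDl sub0r.
have q0 : 0 <= q by rewrite divr_ge0 ?ler0n // subr_ge0.
exists (Num.sqrt p), (Num.sqrt q); rewrite rotM -!expr2 !sqr_sqrtr //; split.
  by rewrite /p /q; field.
congr rot; first by rewrite /p /q; field.
have pq : Num.sqrt p * Num.sqrt q = s / 2.
  rewrite -sqrtrM // (_ : p * q = (s / 2) ^+ 2); last first.
    have -> : p * q = (1 - c ^+ 2) / 4 by rewrite /p /q; field.
    have -> : 1 - c ^+ 2 = s ^+ 2 by rewrite -cs addrC addKr.
    by field.
  by rewrite sqrtr_sqr ger0_norm // divr_ge0 ?ler0n.
by rewrite (mulrC (Num.sqrt q)) pq; field.
Qed.

End OrthogonalMatrices.

Section Splitting.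
Variable R : realType.

Definition root_half : R := Num.sqrt 2^-1.
Local Notation h := root_half.

Lemma root_half_sqr : h ^+ 2 = 2^-1.
Proof. by rewrite sqr_sqrtr // invr_ge0 ler0n. Qed.

(** The real factorization of X^8 - 1: the roots of q c have real part c, and h is the cosine of
    pi/4. *)
Lemma order8_factors : let q (c : R) := 'X ^+ 2 - (2 * c)%:P * 'X + 1 : {poly R} in
  ('X - 1) * ('X + 1) * q 0 * q h * q (- h) = 'X^8 - 1.
Proof.
move=> q; have qq : q h * q (- h) = 'X^4 + 1.
  rewrite /q mulrN !polyCN mulNr opprK.
  have -> : ((2 * h)%:P : {poly R}) = 2 * h%:P by rewrite polyCM -polyC_natr.
  have : h%:P ^+ 2 *+ 2 = 1 :> {poly R}.
    by rewrite -rmorphXn /= root_half_sqr -rmorphMn /= -mulr_natl mulfV ?pnatr_eq0.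
  move: (h%:P) => p pE.
  rewrite [LHS](_ : _ = 'X^4 + 1 + 2 * 'X^2 * (1 - p ^+ 2 *+ 2)); last by ring.
  by rewrite pE subrr mulr0 addr0.
rewrite -mulrA qq /q mulr0 polyC0 mul0r subr0.
by ring.
Qed.

Variable k : nat.
Implicit Types (A : 'M[R]_k.+1) (v : 'rV[R]_k.+1).

(** The factors of X^8 - 1, evaluated at A, are applied to a vector one after the other. The last
    nonzero image is killed by the next factor, so it is an eigenvector or satisfies a quadratic
    relation without real roots. *)
Lemma order8_vector A : A ^+ 8 = 1 ->
  exists2 v : 'rV[R]_k.+1, v != 0 & v *m A = v \/ v *m A = - v \/
    exists2 c : R, c ^+ 2 < 1 & v *m A *m A = (2 * c) *: (v *m A) - v.
Proof.
move=> A8; pose q (c : R) := 'X ^+ 2 - (2 * c)%:P * 'X + 1 : {poly R}.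
pose ev p := horner_mx A p.
have evq c : ev (q c) = A *m A - (2 * c) *: A + 1%:M.
  by rewrite /ev /q rmorphD rmorphB rmorphXn rmorphM /= horner_mx_X horner_mx_C rmorph1 expr2 -!mulmxE mul_scalar_mx.
have v0 : delta_mx 0 0 != 0 :> 'rV[R]_k.+1.
  by apply/eqP => /matrixP/(_ 0 0)/eqP; rewrite !mxE !eqxx oner_eq0.
have quad v c : v != 0 -> c ^+ 2 < 1 -> v *m ev (q c) = 0 ->
    exists2 v : 'rV[R]_k.+1, v != 0 & v *m A = v \/ v *m A = - v \/
    exists2 c : R, c ^+ 2 < 1 & v *m A *m A = (2 * c) *: (v *m A) - v.
  move=> vn0 c1 vq; exists v => //; right; right; exists c => //.
  move: vq; rewrite evq mulmxDr mulmxBr mulmx1 mulmxA -scalemxAr => /eqP.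
  by rewrite -addrA addr_eq0 opprD opprK => /eqP.
set v := delta_mx 0 0 in v0.
have [v1|v1] := eqVneq (v *m ev ('X - 1)) 0.
  exists v => //; left; move: v1.
  by rewrite /ev rmorphB /= horner_mx_X rmorph1 mulmxBr mulmx1 => /eqP; rewrite subr_eq0 => /eqP.
have [v2|v2] := eqVneq (v *m ev ('X - 1) *m ev ('X + 1)) 0.
  exists (v *m ev ('X - 1)) => //; right; left; move: v2.
  by rewrite {2}/ev rmorphD /= horner_mx_X rmorph1 mulmxDr mulmx1 => /eqP; rewrite addr_eq0 => /eqP.
have [v3|v3] := eqVneq (v *m ev ('X - 1) *m ev ('X + 1) *m ev (q 0)) 0.
  by apply: quad v3; rewrite // expr0n ltr01.
have h1 : h ^+ 2 < 1 by rewrite root_half_sqr invf_lt1 ?ltr0n // ltr1n.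
have [v4|v4] := eqVneq (v *m ev ('X - 1) *m ev ('X + 1) *m ev (q 0) *m ev (q h)) 0.
  exact: quad v4.
apply: (quad _ (- h) v4); first by rewrite sqrrN.
rewrite -!mulmxA !mulmxE /ev -!rmorphM /= !mulrA order8_factors rmorphB /= rmorph1.
by rewrite rmorphXn /= horner_mx_X A8 subrr mulmx0.
Qed.

End Splitting.

Section SplittingOff.
Variable R : realType.

Lemma block_diag_of_rows m k (M : 'M[R]_m) (B : 'M[R]_(m + k)) : M *m M^T = 1%:M ->
  B *m B^T = 1%:M -> usubmx B = row_mx M 0 -> exists A' : 'M[R]_k, B = block_diag M A'.
Proof.
move=> MM BB Bu; have BE : B = block_mx M 0 (dlsubmx B) (drsubmx B).
  by rewrite -[LHS]vsubmxK Bu -[dsubmx B]hsubmxK.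
exists (drsubmx B); rewrite [LHS]BE /block_diag; congr block_mx.
by apply: (orthogonal_block_eq0 (D := drsubmx B) MM); rewrite -BE.
Qed.

(** In the quadratic case v and v A span an invariant plane, and Gram-Schmidt gives an orthonormal
    basis in which A is a rotation. The choice s >= 0 prepares for [rot_sqrt]. *)
Lemma split_order8 k (A : 'M[R]_k.+1) : A *m A^T = 1%:M -> A ^+ 8 = 1 ->
  (exists (M : 'M[R]_1) (Q : 'M[R]_(1 + k)) (A' : 'M[R]_k),
    Q *m Q^T = 1%:M /\ Q *m A *m Q^T = block_diag M A') \/
  (exists l (e : k.+1 = (1 + 1 + l)%N) c s (Q : 'M[R]_(1 + 1 + l)) (A' : 'M[R]_l),
    [/\ 0 <= s, c ^+ 2 + s ^+ 2 = 1, Q *m Q^T = 1%:M &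
        Q *m (castmx (e, e) A) *m Q^T = block_diag (rot c s) A']).
Proof.
move=> AA A8; have [v0 v0n0 vP] := order8_vector A8.
have [a an0] := normalize v0n0; set v := a *: v0 => vv.
have line (b : R) : b ^+ 2 = 1 -> v *m A = b *: v ->
   exists (M : 'M[R]_1) (Q : 'M[R]_(1 + k)) (A' : 'M[R]_k),
    Q *m Q^T = 1%:M /\ Q *m A *m Q^T = block_diag M A'.
  move=> b2 vA; have [Q QQ Qv] := orthogonal_row_frame (k := k) vv.
  have [|||A' QE] := @block_diag_of_rows 1 k b%:M (Q *m A *m Q^T).
  - by rewrite tr_scalar_mx -scalar_mxM -expr2 b2.
  - exact: conj_rep_orthogonal.
  - rewrite [LHS](_ : _ = row_mx 1%:M 0 *m (Q *m A *m Q^T)).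
      rewrite !mulmxA Qv vA -scalemxAl -Qv -mulmxA QQ mulmx1 scale_row_mx scalemx1.
      by rewrite scaler0.
    by rewrite -[_ *m Q^T in RHS]vsubmxK mul_row_col mul1mx mul0mx addr0.
  by exists b%:M, Q, A'.
case: vP => [vA|[vA|[c c1 vA]]]; [left|left|right].
- by apply: (line 1); rewrite ?expr1n // scale1r /v -scalemxAl vA.
- by apply: (line (-1)); rewrite ?sqrrN ?expr1n // scaleN1r /v -scalemxAl vA scalerN.
have vA2 : v *m A *m A = (2 * c) *: (v *m A) - v.
  rewrite /v -!scalemxAl vA scalerBr !scalerA; congr (_ *: _ - _).
  by rewrite mulrC.
clear line vA; clearbody v.
(* Pairing the quadratic relation with the unit vector v A gives dot v (v A) = 2 c - dot v (v A). *)
have dvA : dot v (v *m A) = c.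
  have := dot_orthogonal (v *m A) v AA; rewrite vA2 dotDl dotZl dotNl.
  rewrite (dot_orthogonal _ _ AA) vv (dotC (v *m A)) => E.
  have : dot v (v *m A) *+ 2 = c *+ 2 by rewrite mulr2n -{1}E; ring.
  by move/eqP; rewrite eqr_pMn2r // => /eqP.
pose s := Num.sqrt (1 - c ^+ 2).
have s2 : s ^+ 2 = 1 - c ^+ 2 by rewrite sqr_sqrtr // subr_ge0 ltW.
have s0 : 0 < s by rewrite sqrtr_gt0 subr_gt0.
have sn0 : s != 0 by rewrite gt_eqF.
have [v' v'def] : {v' | v' = s^-1 *: (v *m A - c *: v)} by exists (s^-1 *: (v *m A - c *: v)).
have vAE : v *m A = c *: v + s *: v'.
  by rewrite v'def scalerA divff // scale1r addrCA subrr addr0.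
have v'E : v' *m A = s^-1 *: (c *: (v *m A) - v).
  rewrite v'def -scalemxAl mulmxBl -scalemxAl vA2 addrAC -scalerBl.
  by rewrite mulrC mulr_natr mulr2n addrK.
have vv' : dot v v' = 0.
  by rewrite v'def dotZr dotDr dotNr dotZr dvA vv mulr1 subrr mulr0.
have v'v' : dot v' v' = 1.
  rewrite {1}v'def dotZl dotDl dotNl dotZl vv' mulr0 subr0 vAE dotDl !dotZl vv' mulr0 add0r.
  have : dot (v *m A) (v *m A) = 1 by rewrite dot_orthogonal.
  rewrite {1}vAE dotDl !dotZl dvA vAE dotDr !dotZr (dotC v') vv' mulr0 add0r => E.
  have ss : s * s = 1 - c * c by rewrite -!expr2.
  have : s * s * dot v' v' = s * s by rewrite [RHS]ss -E; ring.
  rewrite -[RHS]mulr1 => /mulfI -> //; last by rewrite mulf_neq0.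
  by rewrite mulr1 mulVf.
have v'A : v' *m A = (- s) *: v + c *: v'.
  rewrite v'E vAE; apply/rowP => j; rewrite !mxE.
  have cc : c * c - 1 = - (s * s) by rewrite -!expr2 s2 opprB.
  move: (v 0 j) (v' 0 j) => x y.
  rewrite [c * _ - x](_ : _ = (c * c - 1) * x + c * s * y); last by ring.
  by rewrite cc; field.
case: k A AA A8 v v0 v0n0 an0 vv vA2 dvA v' v'def vAE v'E vv' v'v' v'A => [|l] A AA A8 v v0 v0n0 an0 vv vA2 dvA v' v'def vAE v'E vv' v'v' v'A.
  (* There is no room for two orthonormal vectors in dimension 1. *)
  move: vv' v'v' vv; rewrite !dotE !big_ord1 => /eqP; rewrite mulf_eq0 => /orP[]/eqP ->.
    by move=> _ /eqP; rewrite mul0r eq_sym oner_eq0.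
  by move=> /eqP; rewrite mul0r eq_sym oner_eq0.
have [Q [QQ Qv Qv']] := orthogonal_frame2 (k := l) vv v'v' vv'.
exists l, erefl, c, s, Q.
have cs : c ^+ 2 + s ^+ 2 = 1 by rewrite s2 addrCA subrr addr0.
rewrite castmx_id.
have [|||A' QE] := @block_diag_of_rows (1 + 1) l (rot c s) (Q *m A *m Q^T).
- exact: rot_orthogonal.
- exact: conj_rep_orthogonal.
- have top (x y : R) : row_mx x%:M (row_mx y%:M 0) *m Q = x *: v + y *: v' :> 'rV_(1 + (1 + l)).
    rewrite -Qv -Qv' !scalemxAl -mulmxDl; congr (_ *m _).
    by rewrite !scale_row_mx !scalemx1 !scaler0 add_row_mx addr0 add0r.
  have row_rot (x y : R) (w : 'rV[R]_(1 + (1 + l))) : w *m A = x *: v + y *: v' ->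
      w *m A *m Q^T = row_mx x%:M (row_mx y%:M 0).
    by move=> ->; rewrite -top -mulmxA QQ mulmx1.
  pose B := Q *m A *m Q^T.
  have B0 : row_mx 1%:M 0 *m B = row_mx c%:M (row_mx s%:M 0) by rewrite /B !mulmxA Qv (row_rot _ _ _ vAE).
  have B1 : row_mx 0 (row_mx 1%:M 0) *m B = row_mx (- s)%:M (row_mx c%:M 0).
    by rewrite /B !mulmxA Qv' (row_rot _ _ _ v'A).
  have uB : usubmx (B : 'M_(1 + (1 + l))) = row_mx c%:M (row_mx s%:M 0).
    by rewrite -B0 -[B in RHS](@vsubmxK _ 1 (1 + l)) mul_row_col mul1mx mul0mx addr0.
  have dB : usubmx (dsubmx (B : 'M_(1 + (1 + l)))) = row_mx (- s)%:M (row_mx c%:M 0).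
    rewrite -B1 -[B in RHS](@vsubmxK _ 1 (1 + l)) mul_row_col mul0mx add0r.
    by rewrite -[dsubmx B in RHS](@vsubmxK _ 1 l) mul_row_col mul1mx mul0mx addr0.
  have rowE (x y : R) : row_mx (row_mx x%:M y%:M : 'rV_(1 + 1)) (0 : 'rV_l) =
      row_mx x%:M (row_mx y%:M 0) :> 'rV_(1 + (1 + l)).
    by rewrite row_mxA castmx_id.
  have BE : Q *m A *m Q^T = B by [].
  rewrite BE -[LHS](@vsubmxK _ 1 1) /rot -[X in row_mx _ X](@col_mx0 _ 1 1).
  rewrite -[RHS]block_mxEh block_mxEv !rowE -uB -dB.
  move: (B) => B2; congr col_mx; apply/matrixP => i j; rewrite !mxE; congr (B2 _ _); exact: val_inj.
- by exists A'; split; rewrite // ltW.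
Qed.

End SplittingOff.

(** * Orthogonal representations of cyclic groups *)

Section CyclicReps.
Variable R : realType.

Lemma orthogonalX k (A : 'M[R]_k) n : A *m A^T = 1%:M -> (A ^+ n) *m (A ^+ n)^T = 1%:M.
Proof.
move=> AA; elim: n => [|n IH]; first by rewrite expr0 trmx1 mulmx1.
by rewrite exprS -mulmxE trmx_mul mulmxA -(mulmxA A) IH mulmx1.
Qed.

Section Build.
Variables (q k : nat) (A : 'M[R]_k).
Hypotheses (AA : A *m A^T = 1%:M) (Aq : A ^+ q.+1 = 1).

Lemma cyclic_rep1 : A ^+ (1%g : 'I_q.+1) = 1%:M.
Proof. by rewrite expr0. Qed.

Lemma cyclic_repM (x y : 'I_q.+1) : A ^+ (x * y)%g = A ^+ x *m A ^+ y.
Proof. by rewrite mulmxE -exprD [LHS]expr_mod. Qed.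

Definition cyclic_rep : orthogonal_rep R 'I_q.+1 k :=
  build_rep (f := fun x : 'I_q.+1 => A ^+ x) cyclic_rep1 cyclic_repM (fun x => orthogonalX x AA).
End Build.

Lemma rep_power (gT : finGroupType) k (r : orthogonal_rep R gT k) x n : r (x ^+ n)%g = r x ^+ n.
Proof.
elim: n => [|n IH]; first by rewrite expg0 expr0 rep_hom1.
by rewrite expgS rep_homM IH exprS mulmxE.
Qed.

Lemma rep_cyclic q k (r : orthogonal_rep R 'I_q.+1 k) (x : 'I_q.+1) : r x = r (inZp 1) ^+ x.
Proof. by rewrite {1}(zp_power x) rep_power. Qed.

Lemma rep_cyclic_order q k (r : orthogonal_rep R 'I_q.+1 k) : r (inZp 1) ^+ q.+1 = 1.
Proof.
rewrite -rep_power (_ : (_ ^+ _)%g = 1%g) ?rep_hom1 //.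
by rewrite Zp_expg; apply: val_inj; rewrite /= modnMl.
Qed.

Lemma block_diagX k l (A : 'M[R]_k) (B : 'M[R]_l) n :
  block_diag A B ^+ n = block_diag (A ^+ n) (B ^+ n).
Proof.
elim: n => [|n IH]; first by rewrite !expr0 /block_diag -scalar_mx_block.
by rewrite !exprS IH -!mulmxE block_diagM.
Qed.

Lemma conjX k (Q A : 'M[R]_k) n : Q *m Q^T = 1%:M ->
  Q *m (A ^+ n) *m Q^T = (Q *m A *m Q^T) ^+ n.
Proof.
move=> QQ; elim: n => [|n IH]; first by rewrite !expr0 mulmx1.
by rewrite !exprS -IH -!mulmxE !mulmxA -(mulmxA _ Q^T Q) (orthogonalC QQ) mulmx1.
Qed.

Lemma block_diag_inj k l (A A' : 'M[R]_k) (B B' : 'M[R]_l) :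
  block_diag A B = block_diag A' B' -> A = A' /\ B = B'.
Proof. by case/eq_block_mx. Qed.

Variable w : forall k : nat, nat -> cohomology (BO R k).
Hypothesis w_universal : stiefel_whitney w.

Lemma sqr_degree1_C8 (a : H C8) : in_degree 1 a -> a ^+ 2 = 0.
Proof.
have [_ e2 _ _] := C8P.
move=> /(cyclic_span C8_cyclic)[->|->]; first by rewrite expr0n.
by rewrite /cyclic_gen expr0 mulr1 expr1.
Qed.

Lemma sw1_rot c s (r : orthogonal_rep R C8 (1 + 1)) : 0 <= s -> c ^+ 2 + s ^+ 2 = 1 ->
  r (inZp 1) = rot c s -> sw w 1 r = 0.
Proof.
move=> s0 cs rE; have [c' [s' [cs' rotE]]] := rot_sqrt s0 cs.
have T16 : rot c' s' ^+ 16 = 1.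
  rewrite (exprM _ 2 8) expr2 -[_ * _]rotE -rE.
  exact: rep_cyclic_order.
pose r16 : orthogonal_rep R C16 (1 + 1) := cyclic_rep (rot_orthogonal cs') T16.
have -> : sw w 1 r = res (inc C16_index2) (sw w 1 r16).
  apply/esym/sw_res => x; rewrite rep_cyclic rE rotE.
  rewrite [RHS]/= -[_ *m _]/(_ ^+ 2) -exprM; congr (_ ^+ _).
  by rewrite [RHS]modn_small // (@ltn_pmul2l 2 x 8) ?ltn_ord.
have := sw_in w_universal r16 1.
move=> /(cyclic_span C16_cyclic)[->|->]; first by rewrite rmorph0.
by rewrite /cyclic_gen expr1 expr0 mulr1 res_inc_e16.
Qed.

(** The equality w_3 = w_1 w_2 is what Wu's formula for Sq^1 w_2 becomes where Sq^1 is 0 in degree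
    2. It passes to the sum because squares of classes of degree 1 vanish on C8. *)
Lemma sw3_sum k l (r : orthogonal_rep R C8 k) (r' : orthogonal_rep R C8 l)
    (r'' : orthogonal_rep R C8 (k + l)) : (forall x, r'' x = block_diag (r x) (r' x)) ->
  sw w 3 r = 0 -> sw w 1 r * sw w 2 r = 0 -> sw w 3 r' = sw w 1 r' * sw w 2 r' ->
  sw w 3 r'' = sw w 1 r'' * sw w 2 r''.
Proof.
move=> rE a3 a12 b3; rewrite !(sw_sum_rep w_universal _ rE) !big_ord_recl !big_ord0 /=.
rewrite /bump /= !subn0 !add1n !subn1 !subSS !subn0 /= a3 b3 !(sw_0 w_universal).
have a2 := sqr_degree1_C8 (sw_in w_universal r 1).
have b2 := sqr_degree1_C8 (sw_in w_universal r' 1).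
move: (sw w 1 r) (sw w 2 r) (sw w 1 r') (sw w 2 r') a12 a2 b2 => a a' b b' aa' aa bb.
rewrite [LHS](_ : _ = b * b' + (a * b' + a' * b)); last by ring.
rewrite [RHS](_ : _ = b * b' + (a * b' + a' * b) + (a * a' + a ^+ 2 * b + a * b ^+ 2)); last by ring.
by rewrite aa' aa bb mul0r mulr0 !addr0.
Qed.

(* Both sides vanish for lines and for planes (a rotation of C8 extends to C16, from
   which w_1 restricts to 0), and the equality passes to sums with these. *)
Lemma sw3_C8 k (r : orthogonal_rep R C8 k) : sw w 3 r = sw w 1 r * sw w 2 r.
Proof.
elim/ltn_ind: k r => -[|k] IH r.
  by rewrite !(sw_above w_universal) // mul0r.
pose A : 'M[R]_k.+1 := r (inZp 1).
have AA : A *m A^T = 1%:M by exact: rep_orthogonal.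
have A8 : A ^+ 8 = 1 by exact: rep_cyclic_order.
have pieces m l (M : 'M[R]_m) (A' : 'M[R]_l) (Q B : 'M[R]_(m + l)) : Q *m Q^T = 1%:M ->
    B *m B^T = 1%:M -> B ^+ 8 = 1 -> Q *m B *m Q^T = block_diag M A' ->
    [/\ M *m M^T = 1%:M, A' *m A'^T = 1%:M, M ^+ 8 = 1 & A' ^+ 8 = 1].
  move=> QQ BB B8 QE; have := conj_rep_orthogonal QQ BB; rewrite QE.
  rewrite /block_diag tr_block_mx mulmx_block !trmx0 !mulmx0 !mul0mx !addr0 !add0r.
  rewrite -[1%:M in RHS]/1%:M scalar_mx_block => /block_diag_inj[MM AA'].
  have := conjX B 8 QQ; rewrite QE B8 mulmx1 QQ block_diagX scalar_mx_block.
  by move=> /esym/block_diag_inj[M8 A'8]; split; rewrite ?MM ?AA' ?M8 ?A'8.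
case: (split_order8 AA A8) => [[M [Q [A' [QQ QE]]]]|[l [e [c [s [Q [A' [s0 cs QQ QE]]]]]]]].
  have [MM AA' M8 A'8] := pieces 1%N k M A' Q A QQ AA A8 QE.
  pose r1 : orthogonal_rep R C8 1 := cyclic_rep (q := 7) MM M8.
  pose r2 : orthogonal_rep R C8 k := cyclic_rep (q := 7) AA' A'8.
  have rE x : sum_rep r1 r2 x = Q *m r x *m Q^T.
    by rewrite (rep_cyclic r x) conjX // -/A QE block_diagX.
  rewrite -!(sw_conj w QQ _ rE).
  apply: (@sw3_sum _ _ r1 r2) => //; first by rewrite (sw_above w_universal).
    by rewrite [sw w 2 r1](sw_above w_universal) ?mulr0.
  by apply: IH.
have kE : k = l.+1 by case: (e).
subst k; rewrite castmx_id in QE.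
have [MM AA' M8 A'8] := pieces _ _ _ A' Q A QQ AA A8 QE.
pose r1 : orthogonal_rep R C8 (1 + 1) := cyclic_rep (q := 7) MM M8.
pose r2 : orthogonal_rep R C8 l := cyclic_rep (q := 7) AA' A'8.
have rE x : sum_rep r1 r2 x = Q *m r x *m Q^T.
  by rewrite (rep_cyclic r x) conjX // -/A QE block_diagX.
rewrite -!(sw_conj w QQ _ rE).
apply: (@sw3_sum _ _ r1 r2) => //; first by rewrite (sw_above w_universal).
  by rewrite (sw1_rot s0 cs) ?mul0r.
by apply: IH; rewrite leqW.
Qed.

End CyclicReps.

(** * Four-dimensional representations of C8 x Z/2 *)

Section FourDimensional.
Variable R : realType.
Variable w : forall k : nat, nat -> cohomology (BO R k).
Hypothesis w_universal : stiefel_whitney w.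
Local Notation h := (root_half R).

Lemma rot8_sqr : rot h h ^+ 2 = rot 0 1.
Proof.
rewrite expr2 -mulmxE rotM -!expr2 root_half_sqr subrr.
by congr rot; field.
Qed.

Lemma rot8_4 : rot h h ^+ 4 = - 1%:M.
Proof.
have rotN c s : rot (- c) (- s) = - rot c s :> 'M[R]_(1 + 1).
  by rewrite /rot opp_block_mx !raddfN.
rewrite (exprM _ 2 2) rot8_sqr expr2 -mulmxE rotM -rot1 -rotN oppr0.
by congr rot; ring.
Qed.

Lemma rot8_8 : rot h h ^+ 8 = 1.
Proof. by rewrite (exprM _ 4 2) rot8_4 sqrrN expr1n. Qed.

Lemma rot8_orthogonal : rot h h *m (rot h h)^T = 1%:M.
Proof. by apply: rot_orthogonal; rewrite root_half_sqr; field. Qed.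

Definition lambda8 : orthogonal_rep R C8 (1 + 1) := cyclic_rep (q := 7) rot8_orthogonal rot8_8.

(** Only 0 and [c8] are possible in degree 2, and the restriction to the subgroup of order 2, which
    acts by -1, is t^2. *)
Lemma sw2_lambda8 : sw w 2 lambda8 = c8.
Proof.
have := sw_in w_universal lambda8 2.
move=> /(cyclic_span C8_cyclic)[E|->]; last by rewrite /cyclic_gen expr0 mul1r expr1.
have := congr1 (res F2_C8) E; rewrite rmorph0 (@sw_res _ w _ _ F2_C8 2 _ lambda8 (restrict_rep F2_C8 lambda8)) //.
rewrite (sw_scalar w_universal) => [/eqP|x]; first by rewrite (negPf (tF2_power_neq0 _)).
rewrite /= -[LHS]/(rot h h ^+ F2_C8 x).
have [->|->] := F2P x; first by rewrite !expr0.
by rewrite (_ : nat_of_ord (F2_C8 1) = 4) // rot8_4 expr1 raddfN.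
Qed.

Section Eigenframe.
Variables (rho : orthogonal_rep R (C8 * 'F_2)%type 4) (g : 'M[R]_4).
Let one8 : C8 := inZp 1.
Let Z := rho (one8, 0).
Let T := rho (1%g, 1).
Hypotheses (Z4 : Z ^+ 4 = - 1%:M) (Zh : Z = h *: (1%:M + Z ^+ 2)).
Hypotheses (gg : g *m g^T = 1%:M) (gZ : g *m Z = Z *m g) (gT : g *m T = - (T *m g)).

Let T2 : T *m T = 1%:M.
Proof.
rewrite /T -rep_homM (_ : (_ * _)%g = 1%g) ?rep_hom1 //.
by congr pair; apply: val_inj.
Qed.

Let TT : T^T = T.
Proof. by rewrite -[LHS]mul1mx -T2 -mulmxA [T *m T^T]rep_orthogonal mulmx1. Qed.

Let rhoE x : rho x = Z ^+ x.1 *m T ^+ x.2.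
Proof.
rewrite /Z /T -!rep_power -rep_homM; congr (rho _); case: x => i j.
have E n : ((one8, 0 : 'F_2) ^+ n = ((inZp 1 : C8) ^+ n, 0 : 'F_2))%g.
  elim: n => [|n IH]; first by rewrite !expg0.
  by rewrite !expgS IH; congr pair; apply: val_inj.
have E' n : ((1 : C8, 1%R : 'F_2) ^+ n = (1 : C8, (1%R : 'F_2) ^+ n))%g.
  elim: n => [|n IH]; first by rewrite !expg0.
  by rewrite !expgS IH; congr pair; apply: val_inj.
rewrite E E' -(zp_power i) -[RHS]/((i * 1)%g, ((0%R : 'F_2) * ((1%R : 'F_2) ^+ j))%g) mulg1.
by congr pair; have [->|->] := F2P j; apply: val_inj.
Qed.

(* rho is the sum of the planes spanned by v, vJ and by their images under g, where
   v is fixed by T; on both Z is a rotation of order 8. *)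
Lemma eigenframe : sw w 4 rho = res (fst_hom C8) c8 * res C8_twist c8.
Proof.
(* If 1 + T were 0, then T = -1 would both commute and anticommute with g, forcing g = 0. As T is an
   involution, it fixes x (1 + T). *)
have [x xn0] : exists x : 'rV[R]_4, x *m (1%:M + T) != 0.
  apply: contrapT => /forallNP E.
  have T1 : 1%:M + T = 0.
    by apply/row_matrixP => i; rewrite rowE row0; apply/eqP/negPn/negP/E.
  have TE : T = - 1%:M by apply/eqP; rewrite -addr_eq0 addrC T1.
  have : g *+ 2 = 0.
    by rewrite mulr2n; move: gT; rewrite TE mulmxN mulmx1 mulNmx mul1mx opprK => {1}<-; rewrite addNr.
  move/matrixP => g0; have g00 : g = 0.
    apply/matrixP => i j; have := g0 i j; rewrite !mxE -mulr2n -mulr_natl => /eqP.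
    by rewrite mulf_eq0 pnatr_eq0 => /eqP.
  by move: gg; rewrite g00 mul0mx => /matrixP/(_ 0 0)/eqP; rewrite !mxE eqxx eq_sym oner_eq0.
have [a an0] := normalize xn0; set v := a *: _ => vv.
have vT : v *m T = v by rewrite /v -scalemxAl -mulmxA mulmxDl mul1mx T2 addrC.
clearbody v; clear a an0 x xn0.
pose J := Z ^+ 2.
have JJ : J *m J = - 1%:M by rewrite mulmxE -exprD.
have JO : J *m J^T = 1%:M by apply: orthogonalX; exact: rep_orthogonal.
have JT : J^T = - J by rewrite -[LHS]mul1mx -[1%:M]opprK -JJ mulNmx -mulmxA JO mulmx1.
have ZTc : Z *m T = T *m Z.
  rewrite /Z /T -!rep_homM; congr (rho _).
  by congr pair; rewrite /= ?mulg1 ?mul1g //; apply: val_inj.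
have gJ : g *m J = J *m g by rewrite /J expr2 -mulmxE mulmxA gZ -(mulmxA Z g) gZ mulmxA.
have JTc : J *m T = T *m J by rewrite /J expr2 -mulmxE -(mulmxA Z Z) ZTc mulmxA ZTc -(mulmxA T).
have ZE : Z = h *: (1%:M + J) by [].
have vJ : dot v (v *m J) = 0.
  have : dot v (v *m J) = - dot v (v *m J).
    by rewrite {1}/dot trmx_mul JT mulNmx mulmxN mulmxA dot_mx (dotC (v *m J)) !mxE eqxx.
  by move=> /eqP; rewrite -subr_eq0 opprK -mulr2n mulrn_eq0 /= => /eqP.
have JvJv : dot (v *m J) (v *m J) = 1 by rewrite dot_orthogonal.
have [U UE] : {U : 'M[R]_(1 + 1, 4) | U = col_mx v (v *m J)} by exists (col_mx v (v *m J)).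
have UU : U *m U^T = 1%:M.
  rewrite UE tr_col_mx mul_col_row !dot_mx (dotC (v *m J)) vJ vv JvJv raddf0.
  by rewrite [RHS]scalar_mx_block.
have UZ : U *m Z = rot h h *m U.
  rewrite UE mul_col_mx /rot mul_block_col !mul_scalar_mx ZE -!scalemxAr !mulmxDr !mulmx1.
  by rewrite -mulmxA JJ mulmxN mulmx1 !scalerDr scalerN scaleNr [in RHS](addrC (- _)).
have UT : U *m T = U by rewrite UE mul_col_mx -mulmxA JTc mulmxA vT.
have [V VE] : {V : 'M[R]_(1 + 1, 4) | V = U *m g} by exists (U *m g).
have VZ : V *m Z = rot h h *m V by rewrite VE -mulmxA gZ !mulmxA UZ.
have VT : V *m T = - V by rewrite VE -mulmxA gT mulmxN mulmxA UT.
have VV : V *m V^T = 1%:M by rewrite VE trmx_mul mulmxA -(mulmxA U) gg mulmx1.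
(* T is symmetric and acts by 1 on U and by -1 on V, so the two planes are orthogonal. *)
have UV : U *m V^T = 0.
  have : U *m V^T = - (U *m V^T).
    by rewrite -{1}UT -mulmxA -{1}TT -trmx_mul VT linearN mulmxN.
  move=> E; apply/matrixP => i j; rewrite [RHS]mxE.
  move: E => /matrixP/(_ i j); move: (U *m V^T) => M; rewrite [(- M) i j]mxE => /eqP.
  by rewrite -subr_eq0 opprK -mulr2n mulrn_eq0 /= => /eqP.
have VU : V *m U^T = 0 by rewrite -[LHS]trmxK trmx_mul trmxK UV trmx0.
pose Q : 'M[R]_4 := (col_mx U V : 'M[R]_(1 + 1 + (1 + 1), 4)).
have QQ : Q *m Q^T = 1%:M.
  have E : col_mx U V *m (col_mx U V)^T = 1%:M :> 'M[R]_(1 + 1 + (1 + 1)).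
    by rewrite tr_col_mx mul_col_row UU VV UV VU -scalar_mx_block.
  exact: E.
have conj_block (M N : 'M[R]_(1 + 1)) (X : 'M[R]_4) : U *m X = M *m U -> V *m X = N *m V ->
    Q *m X *m Q^T = (block_diag M N : 'M[R]_(1 + 1 + (1 + 1))).
  move=> UX VX.
  have E : col_mx U V *m X = block_diag M N *m col_mx U V.
    by rewrite mul_col_mx UX VX /block_diag mul_block_col !mul0mx addr0 add0r.
  have QX : Q *m X = (block_diag M N : 'M[R]_(1 + 1 + (1 + 1))) *m Q by exact: E.
  by rewrite QX -mulmxA QQ mulmx1.
have QZ := conj_block _ _ _ UZ VZ.
have QT : Q *m T *m Q^T = (block_diag 1%:M (- 1%:M) : 'M[R]_(1 + 1 + (1 + 1))).
  by apply: conj_block; rewrite ?mulNmx ?mul1mx.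
pose r1 := restrict_rep (fst_hom C8) lambda8.
pose r2 := restrict_rep C8_twist lambda8.
have rE x : sum_rep r1 r2 x = Q *m rho x *m Q^T.
  have -> : Q *m rho x *m Q^T = (Q *m Z *m Q^T) ^+ x.1 *m (Q *m T *m Q^T) ^+ x.2.
    by rewrite -!conjX // rhoE !mulmxA -(mulmxA _ Q^T Q) (orthogonalC QQ) mulmx1.
  rewrite QZ QT.
  have E : block_diag (r1 x) (r2 x) = (block_diag (rot h h) (rot h h)) ^+ x.1 *m
      (block_diag 1%:M (- 1%:M)) ^+ x.2 :> 'M[R]_(1 + 1 + (1 + 1)).
    rewrite !block_diagX block_diagM expr1n mulmx1.
    rewrite -[r2 x]/(lambda8 (x.1 * F2_C8 x.2)%g) rep_homM; congr block_diag.
    congr (_ *m _); rewrite -[LHS]/(rot h h ^+ F2_C8 x.2).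
    have [->|->] := F2P x.2; first by rewrite !expr0.
    by rewrite (_ : nat_of_ord (F2_C8 1) = 4) // rot8_4 expr1.
  exact: E.
have rE' x : sum_rep r1 r2 x = block_diag (r1 x) (r2 x) by [].
apply: etrans (esym (sw_conj w QQ 4 rE)) _; apply: etrans (sw_sum_rep w_universal 4 rE') _.
(* Both summands have rank 2, so only the middle term of the Whitney formula survives. *)
rewrite (bigD1 (inord 2 : 'I_5)) //= big1 ?addr0; last first.
  move=> [[|[|[|[|[|//]]]]] i5] i2; rewrite /=.
  - by rewrite [X in _ * X](sw_above w_universal) ?mulr0.
  - by rewrite [X in _ * X](sw_above w_universal) ?mulr0.
  - by case/eqP: i2; apply: val_inj; rewrite /= inordK.
  - by rewrite (sw_above w_universal) ?mul0r.
  - by rewrite (sw_above w_universal) ?mul0r.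
rewrite inordK // -sw2_lambda8; congr (_ * _); apply/esym.
  exact: (@sw_res _ w _ _ (fst_hom C8) 2 _ lambda8 r1).
exact: (@sw_res _ w _ _ C8_twist 2 _ lambda8 r2).
Qed.

End Eigenframe.
End FourDimensional.

(** * The central product of C8 and the dihedral group *)

(* The central product of C8 and the dihedral group of order 8: the triple
   (i, j, k) stands for z ^ i d ^ j s ^ k where z generates C8, d and s are
   involutions and s d = z ^ 4 d s. *)
Definition Gam : Type := (C8 * ('F_2 * 'F_2))%type.
HB.instance Definition _ := Finite.on Gam.

Section GamGroup.
Implicit Types x y : Gam.

Definition gam_mul x y : Gam :=
  ((x.1 * y.1 * F2_C8 (x.2.2 * y.2.1)%R)%g, (x.2.1 + y.2.1, x.2.2 + y.2.2)).
Definition gam_one : Gam := (1%g, (0, 0)).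
Definition gam_inv x : Gam := ((x.1^-1 * F2_C8 (x.2.2 * x.2.1)%R)%g, x.2).

Lemma F2_C8D (a b : 'F_2) : F2_C8 (a + b) = (F2_C8 a * F2_C8 b)%g.
Proof. exact: ghomM. Qed.

Lemma F2_C8_0 : F2_C8 0 = 1%g.
Proof. exact: val_inj. Qed.

Lemma gam_mulA : associative gam_mul.
Proof.
move=> [i [j k]] [i' [j' k']] [i'' [j'' k'']]; rewrite /gam_mul.
move: (ghom_fun F2_C8) F2_C8D => f fD /=; rewrite !addrA mulrDl mulrDr !fD.
congr pair; rewrite -!mulgA; congr (_ * (_ * _))%g.
rewrite [RHS]mulgA [(f (k * j')%R * i'')%g]Zp_mulgC -mulgA; congr (_ * _)%g.
by rewrite [LHS]Zp_mulgC -mulgA.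
Qed.

Lemma gam_mul1 : left_id gam_one gam_mul.
Proof.
move=> [i [j k]]; rewrite /gam_mul; move: (ghom_fun F2_C8) F2_C8_0 => f f0 /=.
by rewrite mul0r f0 mul1g mulg1 !add0r.
Qed.

Lemma gam_mulV : left_inverse gam_one gam_inv gam_mul.
Proof.
move=> [i [j k]]; rewrite /gam_mul /gam_inv.
move: (ghom_fun F2_C8) F2_C8D F2_C8_0 => f fD f0 /=; rewrite !addF2; congr pair.
by rewrite (Zp_mulgC i^-1%g) -!mulgA mulKg -fD addF2.
Qed.

HB.instance Definition _ := Finite_isGroup.Build Gam gam_mulA gam_mul1 gam_mulV.

Lemma gamM x y : (x * y)%g =
  ((x.1 * y.1 * F2_C8 (x.2.2 * y.2.1)%R)%g, (x.2.1 + y.2.1, x.2.2 + y.2.2)) :> Gam.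
Proof. by []. Qed.

End GamGroup.

Definition gam_x : ghom Gam 'F_2 := GHom (fun x y : Gam => erefl (x * y)%g.2.1).
Definition gam_y : ghom Gam 'F_2 := GHom (fun x y : Gam => erefl (x * y)%g.2.2).
Lemma gam_xy_subproof (x y : Gam) : (x * y)%g.2.1 + (x * y)%g.2.2 = (x.2.1 + x.2.2) + (y.2.1 + y.2.2).
Proof. exact: addrACA. Qed.
Definition gam_xy : ghom Gam 'F_2 := GHom gam_xy_subproof.

Section Relation.

(** For the integer lift I of the C8 coordinate, dI = 8 carry - 4 k j', whence 2 d(carry) = d(k j').
    So the coboundary of the carry mod 2 is the Bockstein Sq^1 (y x) = y x (x + y). *)
Definition gam_carry (x y : Gam) : nat := ((x.1 + y.1 + 4 * (x.2.2 * y.2.1)) %/ 8)%N.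

Lemma gam_carry_check : all (fun i => all (fun i' => all (fun i'' =>
  all (fun k => all (fun j' => all (fun k' => all (fun j'' =>
  let m (i k i' j' : nat) := ((i + i' + 4 * (k * j')) %/ 8)%N in
  let r (i k i' j' : nat) := ((i + i' + 4 * (k * j')) %% 8)%N in
  odd (m i' k' i'' j'' + m (r i k i' j') ((k + k') %% 2)%N i'' j'' +
       m i k (r i' k' i'' j'') ((j' + j'') %% 2)%N + m i k i' j')%N ==
  odd (k * (k' * j'') + k * (j' * j''))%N)
  (iota 0 2)) (iota 0 2)) (iota 0 2)) (iota 0 2)) (iota 0 8)) (iota 0 8)) (iota 0 8).
Proof. by vm_compute. Qed.

Lemma bF2_odd_add m n : bF2 (odd (m + n)) = bF2 (odd m) + bF2 (odd n).
Proof. by rewrite oddD bF2_add. Qed.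

Lemma bF2_odd_mul m n : bF2 (odd (m * n)) = bF2 (odd m) * bF2 (odd n).
Proof. by rewrite oddM bF2_mul. Qed.

Lemma bF2_odd (a : 'F_2) : bF2 (odd a) = a.
Proof. by have [->|->] := F2P a. Qed.

Lemma gam_carryP (x y z : Gam) :
  bF2 (odd (gam_carry y z)) + bF2 (odd (gam_carry (x * y)%g z)) +
  bF2 (odd (gam_carry x (y * z)%g)) + bF2 (odd (gam_carry x y)) =
  gam_y x * (gam_y y * gam_x z) + gam_y x * (gam_x y * gam_x z).
Proof.
rewrite -!bF2_odd_add -(bF2_odd (gam_y x)) -(bF2_odd (gam_y y)) -(bF2_odd (gam_x z)).
rewrite -(bF2_odd (gam_x y)) -!bF2_odd_mul -bF2_odd_add; congr bF2; apply/eqP.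
have io n (i : 'I_n) : (i : nat) \in iota 0 n by rewrite mem_iota ltn_ord.
have := gam_carry_check.
move/allP/(_ _ (io _ x.1))/allP/(_ _ (io _ y.1))/allP/(_ _ (io _ z.1)).
move/allP/(_ _ (io _ x.2.2))/allP/(_ _ (io _ y.2.1))/allP/(_ _ (io _ y.2.2))/allP/(_ _ (io _ z.2.1)).
have rE (a b : Gam) : (a * b)%g.1 = ((a.1 + b.1 + 4 * (a.2.2 * b.2.1)) %% 8)%N :> nat.
  by rewrite gamM; case: (F2P a.2.2) => ->; case: (F2P b.2.1) => ->; rewrite [LHS]modnDml.
by rewrite /gam_carry !rE.
Qed.

Definition carry_cochain : cochain (nerve Gam) := fun s =>
  if tag s == 2 then bF2 (odd (gam_carry (label (projT2 s) ord0 (inord 1))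
                                         (label (projT2 s) (inord 1) ord_max))) else 0.

Lemma eval_carry n (s : nerve_simplex Gam n) (e : seq 'I_n.+1) :
  @eval_face (nerve Gam) carry_cochain n s e =
  if e is [:: u; v; w] then bF2 (odd (gam_carry (label s u v) (label s v w))) else 0.
Proof.
case: e => [|u [|v [|w [|? e]]]] //.
by rewrite /eval_face /carry_cochain /= !inordK.
Qed.

(* The parity of the carry is a cochain whose coboundary represents the relation. *)
Lemma gam_relation : chi_class gam_y * (chi_class gam_x * (chi_class gam_x + chi_class gam_y)) = 0.
Proof.
have E : chi_class gam_y * (chi_class gam_y * chi_class gam_x) +
    chi_class gam_y * (chi_class gam_x * chi_class gam_x) = 0.
  rewrite [chi_class gam_y * chi_class gam_x]clsM [chi_class gam_x * chi_class gam_x]clsM.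
  rewrite !clsM -clsD; apply/cls_eq0; exists carry_cochain => /=.
  apply: cochainP => n s e e0; rewrite !eval_faceE // eval_coboundary eval_faceD.
  under eq_bigr do rewrite eval_carry.
  case: e e0 => // u [|v [|w [|x [|y e]]]] _.
  - by rewrite !eval_cup_chi1 /= big_seq1 addr0.
  - by rewrite !eval_cup_chi !eval_cup_chi1 !mulr0 !big_cons big_nil /= !addr0.
  - by rewrite !eval_cup_chi !eval_chi !mulr0 !big_cons big_nil /= !addr0.
  - rewrite !eval_cup_chi !eval_chi !big_cons big_nil addr0.
    rewrite -(labelM s u v w) -(labelM s v w x) -gam_carryP.
    by rewrite !addrA.
  - rewrite !eval_cup_chi !eval_chi !mulr0 addr0 big1_seq // => t /size_dels /=.
    by case: t => [|? [|? [|? [|? ?]]]].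
by rewrite -E; move: (chi_class gam_x) (chi_class gam_y) => p q; ring.
Qed.

End Relation.

Section GamSubgroups.

Definition gam (i : C8) (j k : 'F_2) : Gam := (i, (j, k)).

Lemma gam_gam i j k i' j' k' : (gam i j k * gam i' j' k')%g =
  gam (i * i' * F2_C8 (k * j')%R)%g (j + j') (k + k').
Proof. by []. Qed.

(** The product d s has square z^4; multiplied by z^2 it becomes an involution, which generates the
    factor Z/2 of the third subgroup. *)
Definition twice (j : 'F_2) : C8 := inZp (2 * j).

Lemma twiceM (j j' : 'F_2) : (twice j * twice j' * F2_C8 (j * j')%R)%g = twice (j + j').
Proof. by have [->|->] := F2P j; have [->|->] := F2P j'; apply: val_inj. Qed.

Lemma gam_inc1_subproof (x y : C8 * 'F_2) :
  gam (x * y)%g.1 (x * y)%g.2 0 = (gam x.1 x.2 0 * gam y.1 y.2 0)%g.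
Proof. by rewrite gam_gam mul0r F2_C8_0 mulg1 addr0. Qed.

Lemma gam_inc2_subproof (x y : C8 * 'F_2) :
  gam (x * y)%g.1 0 (x * y)%g.2 = (gam x.1 0 x.2 * gam y.1 0 y.2)%g.
Proof. by rewrite gam_gam mulr0 F2_C8_0 mulg1 addr0. Qed.

Lemma gam_inc3_subproof (x y : C8 * 'F_2) :
  gam ((x * y)%g.1 * twice (x * y)%g.2)%g (x * y)%g.2 (x * y)%g.2 =
  (gam (x.1 * twice x.2)%g x.2 x.2 * gam (y.1 * twice y.2)%g y.2 y.2)%g.
Proof.
rewrite gam_gam -[(x * y)%g.2]/(x.2 + y.2) -twiceM; congr gam.
rewrite -[(x * y)%g.1]/(x.1 * y.1)%g -!mulgA; congr (_ * _)%g.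
by rewrite [RHS]mulgA [(twice x.2 * y.1)%g]Zp_mulgC -!mulgA.
Qed.

Definition gam_inc1 := GHom gam_inc1_subproof.
Definition gam_inc2 := GHom gam_inc2_subproof.
Definition gam_inc3 := GHom gam_inc3_subproof.

Definition gam_index1 : index2 (C8 * 'F_2)%type Gam.
Proof.
refine (@Index2 _ Gam gam_inc1 gam_y (gam 1%g 0 1) _ _ _ _) => //.
- by move=> [i j] [i' j'] [-> ->].
- by move=> [i [j k]] /= ->; exists (i, j).
Defined.

Definition gam_index2 : index2 (C8 * 'F_2)%type Gam.
Proof.
refine (@Index2 _ Gam gam_inc2 gam_x (gam 1%g 1 0) _ _ _ _) => //.
- by move=> [i j] [i' j'] [-> ->].
- by move=> [i [j k]] /= ->; exists (i, k).
Defined.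

Definition gam_index3 : index2 (C8 * 'F_2)%type Gam.
Proof.
refine (@Index2 _ Gam gam_inc3 gam_xy (gam 1%g 1 0) _ _ _ _) => //.
- move=> [i j] [i' j'] E; have jj : j = j' := congr1 (fun g : Gam => g.2.1) E.
  have : (i * twice j = i' * twice j')%g := congr1 (fun g : Gam => g.1) E.
  by rewrite jj => /mulIg ->.
- by move=> [i j]; exact: addF2.
- move=> [i [j k]] /addF2_eq0 /= ->; exists ((i * (twice k)^-1)%g, k).
  by rewrite -[LHS]/(gam (i * (twice k)^-1 * twice k)%g k k) mulgKV.
- by rewrite /= addr0.
Defined.

Local Notation X := (chi_class gam_x).
Local Notation Y := (chi_class gam_y).

Lemma gam_xy_class : chi_class gam_xy = X + Y.
Proof. exact: chi_classD. Qed.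

(* A class vanishing on the three subgroups is divisible by X Y (X + Y) = 0. *)
Lemma gam_detect n (a : H Gam) : in_degree n.+3 a -> res gam_inc1 a = 0 ->
  res gam_inc2 a = 0 -> res gam_inc3 a = 0 -> a = 0.
Proof.
move=> an a1 a2 a3; have [b bn aE] := res_eq0 (d := gam_index1) an a1.
have b2 : res gam_inc2 b = 0.
  apply: (prod_inj (pull_degree _ bn)); rewrite -[RHS]a2 aE rmorphM /=.
  by congr (_ * _); apply/esym/res_chi.
have [c cn bE] := res_eq0 (d := gam_index2) bn b2.
have c3 : res gam_inc3 c = 0.
  apply: (prod_inj (pull_degree _ cn)); apply: (@prod_inj _ n.+2).
    by apply: (@in_degreeM _ 1 n.+1); [exact: chi_degree | exact: pull_degree].
  rewrite -[RHS]a3 aE bE !rmorphM /=.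
  by congr (_ * (_ * _)); apply/esym/res_chi.
have [d dn cE] := res_eq0 (d := gam_index3) cn c3.
move: aE; rewrite bE cE -[sgn gam_index3]/gam_xy gam_xy_class => ->.
by rewrite !mulrA -(mulrA Y) gam_relation mul0r.
Qed.

Lemma gam_Sq k (W b : H Gam) : in_degree 4 W -> in_degree (4 + k) b -> (0 < k)%N ->
  let W8 := res (fst_hom C8) c8 * res C8_twist c8 in
  res gam_inc1 W = W8 -> res gam_inc2 W = W8 -> res gam_inc3 W = W8 ->
  res gam_inc1 b = Sq k W8 -> res gam_inc2 b = Sq k W8 -> res gam_inc3 b = Sq k W8 ->
  Sq k W = b.
Proof.
move=> W4 bk k0 W8 W1 W2 W3 b1 b2 b3; apply: addHC_eq0; case: k k0 bk b1 b2 b3 => // k _ bk b1 b2 b3.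
apply: (@gam_detect k.+2) => //; first exact: (in_degreeD (Sq_degree k.+1 W4) bk).
- by rewrite rmorphD /= pull_Sq W1 b1 addHH.
- by rewrite rmorphD /= pull_Sq W2 b2 addHH.
- by rewrite rmorphD /= pull_Sq W3 b3 addHH.
Qed.

(** The quadratic factor restricts to t^2 on all three subgroups, where (X, Y) becomes (t, 0), (0,
    t) and (t, t). *)
Lemma gam_squares (W : H Gam) : in_degree 4 W ->
  let W8 := res (fst_hom C8) c8 * res C8_twist c8 in
  res gam_inc1 W = W8 -> res gam_inc2 W = W8 -> res gam_inc3 W = W8 ->
  [/\ Sq 1 W = 0, Sq 2 W = W * (X ^+ 2 + X * Y + Y ^+ 2) & Sq 3 W = 0].
Proof.
move=> W4 W8 W1 W2 W3; split.
- by apply: gam_Sq; rewrite ?rmorph0 ?Sq1_W8 //; exact: in_degree0.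
- have X1 := chi_degree gam_x; have Y1 := chi_degree gam_y.
  have resE (f : ghom (C8 * 'F_2)%type Gam) x y : res f W = W8 ->
      res f X = x -> res f Y = y -> x ^+ 2 + x * y + y ^+ 2 = chi_class (snd_hom C8) ^+ 2 ->
      res f (W * (X ^+ 2 + X * Y + Y ^+ 2)) = Sq 2 W8.
    move=> fW <- <- E; rewrite Sq2_W8 -E rmorphM /= fW !rmorphD !rmorphXn /=.
    by rewrite rmorphM.
  apply: gam_Sq => //.
  + apply: (in_degreeM W4); apply: in_degreeD; last exact: in_degree_power.
    by apply: in_degreeD; [exact: in_degree_power | exact: (in_degreeM X1 Y1)].
  + apply: (resE _ (chi_class (snd_hom C8)) 0) => //; first exact: res_chi.
      exact: res_chi0.
    by rewrite expr0n mulr0 !addr0.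
  + apply: (resE _ 0 (chi_class (snd_hom C8))) => //; first exact: res_chi0.
      exact: res_chi.
    by rewrite expr0n mul0r !add0r.
  + apply: (resE _ (chi_class (snd_hom C8)) (chi_class (snd_hom C8))) => //; try exact: res_chi.
    by rewrite -expr2 addHH add0r.
- by apply: gam_Sq; rewrite ?rmorph0 ?Sq3_W8 //; exact: in_degree0.
Qed.

End GamSubgroups.

(** * The modular group of order 16 *)

Definition parity8 : ghom C8 'F_2 := sgn C8_index2.

(** Conjugation by b multiplies a^i by a^(4 i), which depends only on the parity of i. *)
Lemma parity8_bit (i : C8) : (4 * i = 4 * parity8 i %[mod 8])%N.
Proof.
by case: i => [[|[|[|[|[|[|[|[|//]]]]]]]] ?].
Qed.

Section ModularGroup.
Variables (gT : finGroupType) (a b : gT).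
Hypotheses (card_G : #|gT| = 16%N) (gen_G : <<[set a; b]>>%g = [set: gT]).
Hypotheses (a8 : (a ^+ 8 = 1)%g) (b2 : (b ^+ 2 = 1)%g) (bab : (b * a * b^-1 = a ^+ 5)%g).

Lemma a_mod n : (a ^+ (n %% 8) = a ^+ n)%g.
Proof. by rewrite [in RHS](divn_eq n 8) expgD mulnC expgM a8 expg1n mul1g. Qed.

Lemma b_mul_a n : (b * a ^+ n = a ^+ (n + 4 * n) * b)%g.
Proof.
have ba : (b * a = a ^+ 5 * b)%g by rewrite -bab mulgKV.
elim: n => [|n IH]; first by rewrite mulg1 mul1g.
by rewrite expgSr mulgA IH -mulgA ba mulgA -expgD; congr (a ^+ _ * b)%g; clear; lia.
Qed.

Definition word (x : C8 * 'F_2) : gT := (a ^+ x.1 * b ^+ x.2)%g.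

Lemma word_mul x y : (word x * word y)%g =
  word ((x.1 * y.1 * F2_C8 (x.2 * parity8 y.1)%R)%g, x.2 + y.2).
Proof.
case: x y => [i j] [i' j'].
rewrite -[LHS]/((a ^+ i * b ^+ j) * (a ^+ i' * b ^+ j'))%g.
rewrite -[RHS]/(a ^+ (((i + i') %% 8 + (4 * ((j * parity8 i')%R)) %% 8) %% 8)%N * b ^+ (j + j')%R)%g.
rewrite a_mod expgD !a_mod expgD.
have bE : (b ^+ (j + j')%R = b ^+ j * b ^+ j')%g.
  by case: (F2P j) => ->; case: (F2P j') => -> //=; rewrite ?mulg1 ?mul1g // -expgS b2.
rewrite bE !mulgA; congr (_ * _)%g; rewrite -!mulgA; congr (_ * _)%g.
have [->|->] := F2P j.
  by rewrite mul0r -[LHS]/(1 * a ^+ i')%g -[RHS]/(a ^+ i' * (1 * 1))%g mul1g !mulg1.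
rewrite mul1r -[LHS]/(b * a ^+ i')%g b_mul_a expgD -!mulgA; congr (_ * (_ * _))%g.
by rewrite -(a_mod (4 * i')) parity8_bit a_mod.
Qed.

Lemma word_surj g : exists x, word x = g.
Proof.
have group_im : group_set [set word x | x : C8 * 'F_2].
  apply/group_setP; split.
    by apply/imsetP; exists (1%g, 0); rewrite // /word mul1g.
  by move=> _ _ /imsetP[x _ ->] /imsetP[y _ ->]; rewrite word_mul imset_f.
have sG : [set: gT] \subset Group group_im.
  rewrite -gen_G gen_subG; apply/fintype.subsetP => c; rewrite !inE => /orP[]/eqP ->; apply/imsetP.
    by exists (inZp 1, 0); rewrite // /word /= mulg1 expg1.
  by exists (1%g, 1); rewrite // /word mul1g expg1.
have gG : g \in [set word x | x : C8 * 'F_2].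
  by apply: (fintype.subsetP sG); rewrite inE.
by case/imsetP: gG => x _ ->; exists x.
Qed.

(** Sixteen words cover the sixteen elements of the group. *)
Lemma word_inj : injective word.
Proof.
suff /imset_injP W : #|[set word x | x in [set: C8 * 'F_2]]| == #|[set: C8 * 'F_2]|.
  by move=> x y; apply: W; rewrite inE.
rewrite cardsT card_prod !card_ord -[_ == _]/(#|_| == 16)%N -card_G -cardsT; apply/eqP; apply: eq_card => g.
rewrite inE; have [x <-] := word_surj g.
by rewrite imset_f // inE.
Qed.

Definition unword g : C8 * 'F_2 := sval (cid (word_surj g)).

Lemma unwordK g : word (unword g) = g.
Proof. exact: (svalP (cid (word_surj g))). Qed.

Lemma wordK x : unword (word x) = x.
Proof. by apply: word_inj; rewrite unwordK. Qed.

(** a goes to z d and b to s. Indeed s (z d) s^-1 = z^5 d = (z d)^5, as z is central and d an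
    involution. *)
Definition to_gam_fun g : Gam := gam (unword g).1 (parity8 (unword g).1) (unword g).2.

Lemma to_gamM g g' : to_gam_fun (g * g')%g = (to_gam_fun g * to_gam_fun g')%g.
Proof.
rewrite /to_gam_fun -[in LHS](unwordK g) -[in LHS](unwordK g') word_mul wordK gam_gam.
move: (unword g) (unword g') => x y; congr gam.
rewrite [LHS]ghomM [X in (X * _)%g]ghomM -[RHS]mulg1; congr (_ * _)%g.
by have [->|->] := F2P (x.2 * parity8 y.1)%R; apply: val_inj.
Qed.

Definition to_gam : ghom gT Gam := GHom to_gamM.

Lemma to_gam_word x : to_gam (word x) = gam x.1 (parity8 x.1) x.2.
Proof. by rewrite /= /to_gam_fun wordK. Qed.

Definition chi_z : ghom gT 'F_2 := GHom (fun g g' => congr1 (fun x : Gam => x.2.1) (to_gamM g g')).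
Definition chi_y : ghom gT 'F_2 := GHom (fun g g' => congr1 (fun x : Gam => x.2.2) (to_gamM g g')).

Lemma chi_z_word x : chi_z (word x) = parity8 x.1.
Proof. by rewrite /= /to_gam_fun wordK. Qed.
Lemma chi_y_word x : chi_y (word x) = x.2.
Proof. by rewrite /= /to_gam_fun wordK. Qed.

Lemma inc_a_subproof (i i' : C8) : (a ^+ (i * i')%g = a ^+ i * a ^+ i')%g.
Proof. by rewrite -expgD [LHS]a_mod. Qed.
Definition inc_a : ghom C8 gT := GHom inc_a_subproof.

Lemma inc_a_word i : inc_a i = word (i, 0).
Proof. by rewrite /word mulg1. Qed.

Definition index_a : index2 C8 gT.
Proof.
refine (@Index2 C8 gT inc_a chi_y b _ _ _ _).
- by move=> i i'; rewrite !inc_a_word => /word_inj[].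
- by move=> i; rewrite inc_a_word chi_y_word.
- move=> g; have [[i j] <-] := word_surj g; rewrite chi_y_word /= => ->.
  by exists i; exact: inc_a_word.
- by rewrite -[b](_ : word (1%g, 1) = b) ?chi_y_word // /word mul1g.
Defined.

Lemma inc_K_subproof (x y : C4 * 'F_2) :
  word (inc C8_index2 (x * y)%g.1, (x * y)%g.2) =
  (word (inc C8_index2 x.1, x.2) * word (inc C8_index2 y.1, y.2))%g.
Proof.
rewrite word_mul /parity8 (sgn_inc C8_index2) mulr0 F2_C8_0 mulg1.
by rewrite -ghomM.
Qed.
Definition inc_K : ghom (C4 * 'F_2)%type gT := GHom inc_K_subproof.

Lemma a_word : a = word (inZp 1, 0).
Proof. by rewrite /word /= mulg1 expg1. Qed.

Definition index_K : index2 (C4 * 'F_2)%type gT.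
Proof.
refine (@Index2 (C4 * 'F_2)%type gT inc_K chi_z a _ _ _ _).
- move=> [i j] [i' j'] /word_inj E; have jj : j = j' := congr1 snd E.
  by rewrite jj (@index2_inj _ _ C8_index2 i i' (congr1 fst E)).
- by move=> x; rewrite [inc_K x]/= chi_z_word (sgn_inc C8_index2).
- move=> g; have [[i j] <-] := word_surj g; rewrite chi_z_word.
  case/(@inc_ker _ _ C8_index2) => i' iE; exists (i', j).
  by rewrite -[LHS]/(word (inc C8_index2 i', j)) iE.
- by rewrite [X in chi_z X]a_word chi_z_word; apply: val_inj.
Defined.

End ModularGroup.

(** * Extension of r_8 to the central product *)

Section ExtendRep.
Variables (gT : finGroupType) (a b : gT).
Hypotheses (card_G : #|gT| = 16%N) (gen_G : <<[set a; b]>>%g = [set: gT]).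
Hypotheses (a8 : (a ^+ 8 = 1)%g) (b2 : (b ^+ 2 = 1)%g) (bab : (b * a * b^-1 = a ^+ 5)%g).
Variables (R : realType) (r : orthogonal_rep R gT 4).
Hypothesis r4 : r (a ^+ 4)%g = - 1%:M.
Local Notation h := (root_half R).

Let J := r (a ^+ 2)%g.
(* A square root of J in the commutant, so that r a = Z D with D an involution. *)
Let Z := h *: (1%:M + J).
Let D := r a *m Z^T.
Let S := r b.

Let JJ : J *m J = - 1%:M.
Proof. by rewrite -rep_homM -expgD. Qed.

Let JT : J^T = - J.
Proof. by rewrite -[LHS]mul1mx -[1%:M]opprK -JJ mulNmx -mulmxA [J *m J^T]rep_orthogonal mulmx1. Qed.

Let ZT : Z^T = h *: (1%:M - J).
Proof. by rewrite /Z linearZ /= linearD /= trmx1 JT. Qed.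

Let hh : h * h = 2^-1. Proof. by rewrite -expr2 root_half_sqr. Qed.

Let ZZ : Z *m Z^T = 1%:M.
Proof.
rewrite ZT /Z -scalemxAl -scalemxAr scalerA hh mulmxDl mul1mx mulmxBr mulmx1 JJ opprK.
have -> : 1%:M - J + (J + 1%:M) = 2 *: 1%:M by rewrite scaler_nat mulr2n addrA subrK.
rewrite scalerA mulVf ?scale1r //.
by rewrite pnatr_eq0.
Qed.

Let Z2 : Z *m Z = J.
Proof.
rewrite /Z -scalemxAl -scalemxAr scalerA hh mulmxDl mul1mx mulmxDr mulmx1 JJ.
have -> : 1%:M + J + (J - 1%:M) = 2 *: J by rewrite scaler_nat mulr2n addrC addrA subrK.
rewrite scalerA mulVf ?scale1r //.
by rewrite pnatr_eq0.
Qed.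

Let Zcomm x : r x *m J = J *m r x -> r x *m Z = Z *m r x.
Proof. by move=> xJ; rewrite /Z -scalemxAl -scalemxAr mulmxDl mulmxDr xJ mulmx1 mul1mx. Qed.

Let aJ : r a *m J = J *m r a.
Proof. by rewrite -!rep_homM -expgS -expgSr. Qed.

Let bJ : r b *m J = J *m r b.
Proof.
rewrite -!rep_homM (b_mul_a bab) -(a_mod a8).
by [].
Qed.

Let aZ := Zcomm aJ.
Let bZ := Zcomm bJ.

Let commT A : A *m Z = Z *m A -> A *m Z^T = Z^T *m A.
Proof.
move=> AZ; have ZZ' := orthogonalC ZZ.
by rewrite -[LHS]mul1mx -ZZ' -mulmxA (mulmxA Z) -AZ -[A *m Z *m _]mulmxA ZZ mulmx1.
Qed.

Let aZT := commT aZ.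
Let bZT := commT bZ.

Let DZ : D *m Z = Z *m D.
Proof. by rewrite /D -mulmxA (orthogonalC ZZ) mulmx1 mulmxA -aZ -mulmxA ZZ mulmx1. Qed.

Let DD : D *m D = 1%:M.
Proof.
rewrite /D mulmxA -(mulmxA (r a)) -aZT !mulmxA -rep_homM -expg2 -/J -Z2.
by rewrite -(mulmxA Z) ZZ mulmx1 ZZ.
Qed.

Let SS : S *m S = 1%:M.
Proof. by rewrite /S -rep_homM -expg2 b2 rep_hom1. Qed.

Let SD : S *m D = - (D *m S).
Proof.
have ba : (b * a = a ^+ 4 * (a * b))%g.
  by rewrite mulgA -expgSr -(b_mul_a bab 1).
rewrite /S /D mulmxA -rep_homM ba rep_homM r4 (rep_homM _ a) !mulNmx mul1mx -!mulmxA.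
by rewrite bZT.
Qed.

Let DO : D *m D^T = 1%:M.
Proof. by rewrite /D trmx_mul trmxK mulmxA -(mulmxA (r a)) (orthogonalC ZZ) mulmx1 rep_orthogonal. Qed.

Let Z4 : Z ^+ 4 = - 1%:M.
Proof. by rewrite (exprM _ 2 2) !expr2 -!mulmxE Z2 JJ. Qed.

Let Z8 : Z ^+ 8 = 1.
Proof. by rewrite (exprM _ 4 2) Z4 sqrrN expr1n. Qed.

(** The generators z, d and s act by Z, D and S; the relation s d = z^4 d s holds because Z^4 = -1
    and S D = - D S. *)
Definition gam_rep_fun (x : Gam) : 'M[R]_4 := Z ^+ x.1 *m (D ^+ x.2.1 *m S ^+ x.2.2).

Let commX A n : A *m Z = Z *m A -> A *m Z ^+ n = Z ^+ n *m A.
Proof.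
move=> AZ; elim: n => [|n IH]; first by rewrite expr0 mulmx1 mul1mx.
by rewrite exprS -mulmxE mulmxA AZ -mulmxA IH mulmxA.
Qed.

Let DS_Z j k : D ^+ j *m S ^+ k *m Z = Z *m (D ^+ j *m S ^+ k).
Proof.
have pw (A : 'M[R]_4) n : A *m Z = Z *m A -> A ^+ n *m Z = Z *m A ^+ n.
  move=> AZ; elim: n => [|n IH]; first by rewrite expr0 mulmx1 mul1mx.
  by rewrite exprS -mulmxE -mulmxA IH mulmxA AZ mulmxA.
by rewrite -mulmxA (pw S k bZ) mulmxA (pw D j DZ) mulmxA.
Qed.

Let DS_mul (j k j' k' : 'F_2) : (D ^+ j *m S ^+ k) *m (D ^+ j' *m S ^+ k') =
  Z ^+ (F2_C8 (k * j')) *m (D ^+ (j + j')%R *m S ^+ (k + k')%R).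
Proof.
have E1 (A : 'M[R]_4) (i i' : 'F_2) : A *m A = 1%:M -> A ^+ i *m A ^+ i' = A ^+ (i + i')%R.
  move=> AA; have [->|->] := F2P i; have [->|->] := F2P i';
    by rewrite ?expr0 ?expr1 ?mul1mx ?mulmx1 // AA.
rewrite -mulmxA (mulmxA (S ^+ k)).
suff -> : S ^+ k *m D ^+ j' = Z ^+ (F2_C8 (k * j')) *m (D ^+ j' *m S ^+ k).
  rewrite -(E1 _ _ _ DD) -(E1 _ _ _ SS) !mulmxA; congr (_ *m _); congr (_ *m _).
  congr (_ *m _); apply: commX; have := DS_Z j 0%N; rewrite expr0 mulmx1; exact.
have e0 : Z ^+ F2_C8 0 = 1%:M by rewrite F2_C8_0.
have e1 : Z ^+ F2_C8 1 = - 1%:M by rewrite -Z4.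
have [->|->] := F2P k; first by rewrite mul0r e0 mul1mx expr0 mulmx1 mul1mx.
have [->|->] := F2P j'; first by rewrite mulr0 e0 mul1mx expr0 mulmx1 mul1mx.
by rewrite mulr1 e1 mulNmx mul1mx !expr1 SD.
Qed.

Lemma gam_rep1 : gam_rep_fun 1%g = 1%:M.
Proof. by rewrite /gam_rep_fun /= !expr0 !mulmx1. Qed.

Lemma gam_repM x y : gam_rep_fun (x * y)%g = gam_rep_fun x *m gam_rep_fun y.
Proof.
case: x y => [i [j k]] [i' [j' k']].
rewrite -[LHS]/(Z ^+ (i * i' * F2_C8 (k * j')%R)%g *m (D ^+ (j + j')%R *m S ^+ (k + k')%R)).
rewrite -[RHS]/(Z ^+ i *m (D ^+ j *m S ^+ k) *m (Z ^+ i' *m (D ^+ j' *m S ^+ k'))).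
have ZM (x y : C8) : Z ^+ (x * y)%g = Z ^+ x *m Z ^+ y.
  by rewrite mulmxE -exprD [LHS](expr_mod _ Z8).
rewrite !ZM -!mulmxA; congr (_ *m _).
rewrite -DS_mul !mulmxA; congr (_ *m _ *m _).
by rewrite (commX _ (DS_Z j k)) mulmxA.
Qed.

Lemma gam_repO x : gam_rep_fun x *m (gam_rep_fun x)^T = 1%:M.
Proof.
have OM (A B : 'M[R]_4) : A *m A^T = 1%:M -> B *m B^T = 1%:M -> (A *m B) *m (A *m B)^T = 1%:M.
  by move=> AA BB; rewrite trmx_mul mulmxA -(mulmxA A) BB mulmx1.
apply: (OM); first exact: orthogonalX.
by apply: OM; apply: orthogonalX => //; exact: rep_orthogonal.
Qed.

Definition gam_rep : orthogonal_rep R Gam 4 := build_rep gam_rep1 gam_repM gam_repO.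

Lemma gam_rep_restrict x : r x = gam_rep (to_gam card_G gen_G a8 b2 bab x).
Proof.
have [[i j] <-] := word_surj gen_G a8 b2 bab x; rewrite to_gam_word.
rewrite -[RHS]/(Z ^+ i *m (D ^+ parity8 i *m S ^+ j)) /word rep_homM !rep_power mulmxA.
congr (_ *m _).
have aE : r a = Z *m D by rewrite -DZ /D -mulmxA (orthogonalC ZZ) mulmx1.
have ZDX n : (Z *m D) ^+ n = Z ^+ n *m D ^+ n.
  elim: n => [|n IH]; first by rewrite !expr0 mulmx1.
  by rewrite !exprS IH -!mulmxE -(mulmxA Z D) (mulmxA D (Z ^+ n)) (commX n DZ) -(mulmxA (Z ^+ n) D) (mulmxA Z (Z ^+ n)).
rewrite aE ZDX; congr (_ *m _).
have D2 : D ^+ 2 = 1 by rewrite expr2 -mulmxE DD.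
rewrite -(expr_mod i D2); congr (_ ^+ _).
by rewrite /= ?modnMml ?modnMmr ?mul1n ?muln1.
Qed.

Variable w : forall k : nat, nat -> cohomology (BO R k).
Hypothesis w_universal : stiefel_whitney w.
Local Notation W := (sw w 4 gam_rep).
Local Notation W8 := (res (fst_hom C8) c8 * res C8_twist c8).

Lemma res_gam_rep : res (to_gam card_G gen_G a8 b2 bab) W = sw w 4 r.
Proof. by apply: sw_res => x; exact: gam_rep_restrict. Qed.

Let restricted (f : ghom (C8 * 'F_2)%type Gam) (g : 'M[R]_4) :
  f (inZp 1, 0) = gam (inZp 1) 0 0 -> g *m g^T = 1%:M -> g *m Z = Z *m g ->
  g *m gam_rep (f (1%g, 1)) = - (gam_rep (f (1%g, 1)) *m g) ->
  res f W = W8.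
Proof.
move=> f1 gg gZ gf; rewrite (@sw_res _ w _ _ f 4 4 gam_rep (restrict_rep f gam_rep)) //.
have ZE : restrict_rep f gam_rep (inZp 1, 0) = Z.
  rewrite -[LHS]/(gam_rep_fun (f (inZp 1, 0))) f1 /gam_rep_fun /=.
  by rewrite !expr0 !mulmx1 expr1.
apply: (eigenframe w_universal (g := g)); rewrite ?ZE //.
by rewrite expr2 -mulmxE Z2.
Qed.

(** The matrix g asked for by [eigenframe] is the action of an element outside the subgroup, s for
    the first one and d for the other two; it anticommutes with the involution T, which is D, S and
    J D S respectively. *)
Lemma res_gam_rep_subgroups :
  [/\ res gam_inc1 W = W8, res gam_inc2 W = W8 & res gam_inc3 W = W8].
Proof.
split.
- apply: (@restricted gam_inc1 S) => //; first exact: rep_orthogonal.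
  by rewrite -[gam_rep _]/(1%:M *m (D *m 1%:M)) mul1mx mulmx1.
- apply: (@restricted gam_inc2 D) => //.
  rewrite -[gam_rep _]/(1%:M *m (1%:M *m S)) !mul1mx.
  by rewrite SD opprK.
- apply: (@restricted gam_inc3 D) => //.
    by congr gam; exact: val_inj.
  rewrite -[gam_rep _]/(Z ^+ 2 *m (D *m S)) expr2 -mulmxE.
  have DJ : D *m J = J *m D by rewrite -Z2 mulmxA DZ -mulmxA DZ mulmxA.
  rewrite Z2; have -> : D *m (J *m (D *m S)) = J *m S.
    by rewrite mulmxA DJ -mulmxA (mulmxA D) DD mul1mx.
  by rewrite -2!mulmxA SD !mulmxN opprK (mulmxA D D) DD mul1mx.
Qed.

End ExtendRep.

(** * The cohomology of G x Z/2 as a polynomial ring, and central involutions *)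

Section ProductPolynomials.
Variable gT : finGroupType.
Local Notation G2 := (gT * 'F_2)%type.
Local Notation t := (chi_class (snd_hom gT)).
Local Notation fst := (res (fst_hom gT)).

Definition prod_eval (p : {poly H gT}) : H G2 := (map_poly fst p).[t].

Lemma prod_evalM : {morph prod_eval : p q / p * q}.
Proof. by move=> p q; rewrite /prod_eval rmorphM hornerM. Qed.

Lemma prod_eval_surj n a : in_degree n a -> exists p,
  [/\ prod_eval p = a, (size p <= n.+1)%N & forall i, (i <= n)%N -> in_degree (n - i) p`_i].
Proof.
elim: n a => [|n IH] a an.
  exists (res (inl_hom gT) a)%:P; rewrite /prod_eval map_polyC hornerC.
  split; [exact/esym/prod_degree0 | exact: size_polyC_leq1|].
  by case=> // _; rewrite coefC; exact: pull_degree.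
have [b bn ->] := prod_decomp an; have [p [<- pn pd]] := IH b bn.
exists (p * 'X + (res (inl_hom gT) a)%:P); split.
- by rewrite /prod_eval rmorphD rmorphM /= map_polyX map_polyC hornerD hornerM hornerX hornerC addrC mulrC.
- by rewrite size_MXaddC; case: ifP.
- case=> [|i] i_n; rewrite coefD coefMX coefC /= ?add0r ?addr0; first exact: pull_degree.
  by rewrite subSS; exact: pd.
Qed.

Lemma prod_regular a : t * a = 0 -> a = 0.
Proof.
move=> ta; apply: hcomp_eq0 => n; apply: (prod_inj (hcomp_in n a)).
by rewrite -(hcompM n a (chi_degree _)) ta hcomp0.
Qed.

Lemma prod_eval_eq0 p : prod_eval p = 0 -> p = 0.
Proof.
elim/poly_ind: p => // p c IH; rewrite /prod_eval rmorphD rmorphM /= map_polyX map_polyC.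
rewrite hornerD hornerM hornerX hornerC => E.
have c0 : c = 0.
  have := congr1 (res (inl_hom gT)) E.
  by rewrite rmorph0 rmorphD rmorphM /= res_inl_snd mulr0 add0r res_inl_fst.
move: E; rewrite c0 raddf0 addr0 mulrC => E; rewrite (IH (prod_regular E)).
by rewrite mul0r add0r.
Qed.

Lemma prod_eval_onto a : exists p, prod_eval p = a.
Proof.
have [N ->] := hcomp_decomp a.
elim/big_rec: _ => [|i b _ [q <-]]; first by exists 0; rewrite /prod_eval rmorph0 horner0.
have [p [<- _ _]] := prod_eval_surj (hcomp_in i a).
by exists (p + q); rewrite /prod_eval rmorphD hornerD.
Qed.

Lemma monic_regular p a : p \is monic -> prod_eval p * a = 0 -> a = 0.
Proof.
move=> pm; have [q <-] := prod_eval_onto a; rewrite -prod_evalM => /prod_eval_eq0.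
rewrite mulrC => /eqP; rewrite mulIr_eq0; last exact: monic_rreg.
by move=> /eqP ->; rewrite /prod_eval rmorph0 horner0.
Qed.

End ProductPolynomials.

Section CentralRegular.
Variables (gT : finGroupType) (s : gT).
Hypotheses (s2 : (s * s = 1)%g) (s_central : forall g, commute s g).

Let central_subproof (i j : 'F_2) : (s ^+ (i * j)%g = s ^+ i * s ^+ j)%g.
Proof. by have [->|->] := F2P i; have [->|->] := F2P j; rewrite /= ?mulg1 ?mul1g. Qed.
Definition central_hom : ghom 'F_2 gT := GHom central_subproof.

Let mu_subproof (x y : gT * 'F_2) :
  ((x * y).1 * s ^+ (x * y).2 = (x.1 * s ^+ x.2) * (y.1 * s ^+ y.2))%g.
Proof.
rewrite [(s ^+ (x * y).2)%g]central_subproof -!mulgA; congr (_ * _)%g; rewrite !mulgA; congr (_ * _)%g.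
by apply: commuteX; apply/commute_sym/s_central.
Qed.
Let mu : ghom (gT * 'F_2)%type gT := GHom mu_subproof.

(* A class restricting to t^n on a central subgroup of order 2 pulls back under
   the multiplication G x Z/2 -> G to a polynomial in t that is monic over H^*(G). *)
Lemma central_regular n (W a : H gT) : in_degree n W -> res central_hom W = tF2 ^+ n ->
  W * a = 0 -> a = 0.
Proof.
move=> Wn WE Wa; have [p [pE pn pd]] := prod_eval_surj (pull_degree (Bmap mu) Wn).
have inrP (i j : 'F_2) : ((1%g : gT), (i * j)%g) = ((1%g, i) * (1%g, j) : gT * 'F_2)%g.
  by congr pair; rewrite mulg1.
have inr_fst k (b : H gT) : in_degree k.+1 b -> res (GHom inrP) (res (fst_hom gT) b) = 0.
  move=> bk; have one_hom (x y : 'I_1) : (1%g : gT) = (1 * 1)%g by rewrite mulg1.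
  have I1 (x y : 'F_2) : (ord0 : 'I_1) = (ord0 * ord0)%g by rewrite [RHS]ord1.
  rewrite !(res_comp (h := GHom (fun x y : 'F_2 => esym (mulg1 (1%g : gT))))) //.
  rewrite -(res_comp (f := GHom I1) (g := GHom one_hom)) //.
  by rewrite (I1_positive_degree (pull_degree _ bk)) rmorph0.
have inr_snd : res (GHom inrP) (chi_class (snd_hom gT)) = tF2 by exact: res_chi.
(* On the second factor Z/2 the map [mu] becomes the inclusion of the central subgroup and
   coefficients of positive degree die, so the value t^n of W there is the leading term. *)
have lead : p`_n = 1.
  have pn0 : in_degree 0 p`_n by rewrite -(subnn n); exact: pd.
  have := congr1 (res (GHom inrP)) pE.
  rewrite (res_comp (h := central_hom)) ?WE; last by move=> x /=; rewrite mul1g.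
  rewrite /prod_eval (horner_coef_wide (n := n.+1)); last exact: leq_trans (size_poly _ _) pn.
  rewrite rmorph_sum big_ord_recr /= big1 ?add0r => [|i _].
    rewrite coef_map rmorphM rmorphXn /= inr_snd; case: (degree0P pn0) => // -> /eqP.
    by rewrite !rmorph0 mul0r eq_sym (negPf (tF2_power_neq0 n)).
  rewrite coef_map rmorphM /=; have := pd i (ltnW (ltn_ord i)).
  by rewrite -[(n - i)%N]prednK ?subn_gt0 // => /inr_fst ->; rewrite mul0r.
have pm : p \is monic.
  have sp : size p = n.+1.
    apply/eqP; rewrite eqn_leq pn ltnNge; apply/negP => np.
    by move: lead; rewrite nth_default // => /eqP; rewrite eq_sym oner_eq0.
  by rewrite monicE lead_coefE sp lead.
have mu_a : res mu a = 0 by apply: (monic_regular pm); rewrite pE -rmorphM Wa rmorph0.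
have := congr1 (res (inl_hom gT)) mu_a; rewrite rmorph0.
rewrite (res_comp (h := GHom (fun x y : gT => erefl (x * y)%g))) ?res_id // => x /=.
by rewrite mulg1.
Qed.

End CentralRegular.

(** * The classes z, y, x and their relations *)

Section ModularCohomology.
Variables (gT : finGroupType) (a b : gT).
Hypotheses (card_G : #|gT| = 16%N) (gen_G : <<[set a; b]>>%g = [set: gT]).
Hypotheses (a8 : (a ^+ 8 = 1)%g) (b2 : (b ^+ 2 = 1)%g) (bab : (b * a * b^-1 = a ^+ 5)%g).
Local Notation toG := (to_gam card_G gen_G a8 b2 bab).
Local Notation iA := (index_a card_G gen_G a8 b2 bab).
Local Notation iK := (index_K card_G gen_G a8 b2 bab).
Local Notation incA := (inc_a a8).

Definition mod_z : H gT := chi_class (chi_z card_G gen_G a8 b2 bab).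
Definition mod_y : H gT := chi_class (chi_y card_G gen_G a8 b2 bab).
Local Notation z := mod_z.
Local Notation y := mod_y.

Lemma gam_mod4_subproof (p q : Gam) :
  @zmul 7 3 1 isT (p * q)%g.1 = (@zmul 7 3 1 isT p.1 * @zmul 7 3 1 isT q.1)%g.
Proof.
have f4 (c : 'F_2) : @zmul 7 3 1 isT (F2_C8 c) = 1%g.
  by have [->|->] := F2P c; apply: val_inj.
by rewrite -[(p * q)%g.1]/(p.1 * q.1 * F2_C8 (p.2.2 * q.2.1)%R)%g 2!ghomM f4 mulg1.
Qed.
Definition gam_mod4 : ghom Gam C4 := GHom gam_mod4_subproof.

(** The character z factors through a map to C4 that sends a to a generator, and e4^2 = 0 there. *)
Lemma mod_z_sqr : z ^+ 2 = 0.
Proof.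
have E (g h : gT) : gam_mod4 (toG (g * h)%g) = (gam_mod4 (toG g) * gam_mod4 (toG h))%g by rewrite 2!ghomM.
have -> : z = res (GHom E) e4.
  rewrite (@res_chi _ _ _ _ (chi_z card_G gen_G a8 b2 bab)) // => g.
  have [x <-] := word_surj gen_G a8 b2 bab g.
  rewrite chi_z_word -[GHom E _]/(gam_mod4 (toG (word a b x))) to_gam_word.
  by case: x => -[[|[|[|[|[|[|[|[|//]]]]]]]] ?] ?; apply: val_inj.
by have [_ e0 _ _] := C4P; rewrite -rmorphXn e0 rmorph0.
Qed.

(** The relation of the central product pulls back to y z (z + y) = 0, and z^2 = 0. *)
Lemma mod_zyy : z * y ^+ 2 = 0.
Proof.
have := congr1 (res toG) gam_relation; rewrite rmorph0 2!rmorphM rmorphD /=.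
rewrite (@res_chi _ _ toG gam_y (chi_y card_G gen_G a8 b2 bab)) //.
rewrite (@res_chi _ _ toG gam_x (chi_z card_G gen_G a8 b2 bab)) // -/z -/y => E.
have -> : z * y ^+ 2 = y * (z * (z + y)) - y * z ^+ 2 by move: z y => p q; ring.
by rewrite E mod_z_sqr mulr0 subr0.
Qed.

Lemma res_a_y : res incA y = 0.
Proof. exact: (res_sgn iA). Qed.

Lemma res_a_z : res incA z = e8.
Proof. by apply: res_chi => i; rewrite (inc_a_word b) chi_z_word. Qed.

Lemma mod_z_neq0 : z != 0.
Proof. exact: (sgn_neq0 iK). Qed.

Lemma tr_a_e8 : tr iA e8 = 0.
Proof. by rewrite -res_a_z; exact: (tr_res iA). Qed.

Lemma ker_y_small n u : in_degree n u -> y * u = 0 -> u = 0 \/ u = tr iA (cyclic_gen e8 c8 n).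
Proof.
move=> un /(@sgn_eq0 _ _ iA n _ un)[v /(cyclic_span C8_cyclic)[]-> ->]; [left|by right].
exact: tr0.
Qed.

Lemma mod_zy_neq0 : z * y != 0.
Proof.
apply/eqP => zy; have := ker_y_small (chi_degree _ : in_degree 1 z); rewrite mulrC zy.
case=> // [/eqP|/eqP]; first by rewrite (negPf mod_z_neq0).
by rewrite /cyclic_gen expr1 expr0 mulr1 tr_a_e8 (negPf mod_z_neq0).
Qed.

(** z y is annihilated by y, so it is a transfer from <a>, where [c8] is the only nonzero class of
    degree 2. *)
Lemma tr_a_c8 : tr iA c8 = z * y.
Proof.
have zy2 : in_degree 2 (z * y) by apply: (@in_degreeM _ 1 1); exact: chi_degree.
have [|zy0|->] := ker_y_small zy2; first by rewrite mulrCA -expr2 mod_zyy.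
  by have := mod_zy_neq0; rewrite zy0 eqxx.
by rewrite /cyclic_gen expr0 mul1r expr1.
Qed.

Section Periodicity.
Variable W : H gT.
Hypotheses (W4 : in_degree 4 W) (WE : res incA W = c8 ^+ 2).

Lemma W_regular u : W * u = 0 -> u = 0.
Proof.
have s2 : (a ^+ 4 * a ^+ 4 = 1)%g by rewrite -expgD.
have s_central g : commute (a ^+ 4)%g g.
  have [x <-] := word_surj gen_G a8 b2 bab g; apply: commuteM.
    by apply: commuteX; apply/commute_sym/commuteX.
  apply: commuteX; apply/commute_sym.
  by rewrite /commute (b_mul_a bab) -(a_mod a8).
apply: (@central_regular _ _ s2 s_central _ _ _ W4).
have -> : tF2 ^+ 4 = res F2_C8 (c8 ^+ 2) by rewrite rmorphXn /= res_F2_c8 -exprM.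
rewrite -WE (res_comp (h := central_hom s2)) // => x.
rewrite -[RHS]/(a ^+ ((4 * x) %% 8))%g (a_mod a8) expgM.
by [].
Qed.

(** Since e8 and c8^2 are the restrictions of z and W, the projection formula leaves only the
    transfers of 1 and c8, which are 0 and z y. In degrees 3 mod 4 the result contains z^2. *)
Lemma tr_a_gen n : tr iA (cyclic_gen e8 c8 n) =
  if (n %% 4 == 2)%N then z * y * W ^+ (n %/ 4) else 0.
Proof.
have genE : cyclic_gen e8 c8 n =
    c8 ^+ odd n./2 * res incA (z ^+ odd n * W ^+ (n %/ 4)).
  rewrite rmorphM !rmorphXn /= res_a_z WE -exprM mulrCA -exprD; congr (_ * _ ^+ _).
  by rewrite -[n in LHS]odd_double_half; clear; lia.
rewrite genE (trM iA); case: ifP => n4.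
  have -> : odd n = false by clear -n4; lia.
  have -> : odd n./2 by clear -n4; lia.
  by rewrite expr0 mul1r expr1 tr_a_c8.
case: (boolP (odd n./2)) => on; last first.
  by rewrite expr0 -(rmorph1 (res incA)) (tr_res iA) mul0r.
have -> : odd n by clear -n4 on; lia.
rewrite [c8 ^+ _]expr1 [z ^+ true]expr1 tr_a_c8.
have -> (p q v : H gT) : p * q * (p * v) = p ^+ 2 * (q * v) by ring.
by rewrite mod_z_sqr mul0r.
Qed.

Lemma ker_y n u : in_degree n u -> y * u = 0 ->
  u = 0 \/ (n %% 4 = 2)%N /\ u = z * y * W ^+ (n %/ 4).
Proof.
move=> un /(ker_y_small un)[->|->]; first by left.
by rewrite tr_a_gen; case: eqP => ?; [right | left].
Qed.

Lemma zyW_neq0 k : z * y * W ^+ k != 0.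
Proof.
elim: k => [|k]; first by rewrite expr0 mulr1 mod_zy_neq0.
by apply: contra_neq; rewrite exprS mulrCA => /W_regular.
Qed.

(** A restriction has transfer 0, whereas the generator in these degrees has the nonzero transfer z
    y W^k. *)
Lemma res_a_2mod4 n u : in_degree n u -> (n %% 4 = 2)%N -> res incA u = 0.
Proof.
move=> un n4; have [//|uE] := cyclic_span C8_cyclic (pull_degree (Bmap incA) un).
have := tr_res iA u; rewrite -[inc iA]/incA uE tr_a_gen n4 eqxx => /eqP.
by rewrite (negPf (zyW_neq0 _)).
Qed.

End Periodicity.

Local Notation fK := (res (fst_hom C4)).
(** As a transfer from the kernel of z, it is annihilated by z. The class transferred is chosen so
    that x restricts to the generator of degree 3 on <a>. *)
Definition mod_x : H gT := tr iK (fK (e4 * c4)).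
Local Notation x := mod_x.

Lemma mod_x_degree : in_degree 3 x.
Proof.
apply: tr_degree; apply: pull_degree; apply: (@in_degreeM _ 1 2); first exact: chi_degree.
exact: cyclic_deg2 C4_cyclic.
Qed.

Lemma mod_zx : z * x = 0.
Proof. exact: (sgn_tr iK). Qed.

(** Conjugation by a on the subgroup <a^2, b>: it sends b to a^4 b, and a^4 is the element 2 of
    C4. *)
Lemma twist_K_subproof (p q : C4 * 'F_2) :
  ((p * q)%g.1 * @zmul 1 3 2 isT (p * q)%g.2, (p * q)%g.2)%g =
  ((p.1 * @zmul 1 3 2 isT p.2, p.2) * (q.1 * @zmul 1 3 2 isT q.2, q.2))%g :> (C4 * 'F_2)%type.
Proof.
congr pair; rewrite -[(p * q)%g.1]/(p.1 * q.1)%g -[(p * q)%g.2]/(p.2 * q.2)%g ghomM /=.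
rewrite -!mulgA; congr (_ * _)%g; rewrite !mulgA; congr (_ * _)%g.
exact: Zp_mulgC.
Qed.
Definition twist_K : ghom (C4 * 'F_2)%type (C4 * 'F_2)%type := GHom twist_K_subproof.

Lemma twist_KP p : inc iK (twist_K p) = (rep iK * inc iK p * (rep iK)^-1)%g.
Proof.
case: p => i j; apply: (canRL (mulgK _)); rewrite -[rep iK]/a.
rewrite -[inc iK _]/(word a b (inc C8_index2 (i * @zmul 1 3 2 isT j)%g, j)).
rewrite -[inc iK _]/(word a b (inc C8_index2 i, j)).
rewrite [X in (_ * X = _)%g](a_word a b) [X in (_ = X * _)%g](a_word a b) !(word_mul a8 b2 bab) /parity8.
rewrite (sgn_inc C8_index2) mulr0 F2_C8_0 mulg1 addr0 add0r.
congr word; congr pair.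
rewrite -[LHS]/(inc C8_index2 (i * @zmul 1 3 2 isT j) * inZp 1 * F2_C8 (j * sgn C8_index2 (inZp 1))%R)%g.
rewrite -[RHS]/(inZp 1 * inc C8_index2 i)%g ghomM.
rewrite (_ : sgn C8_index2 (inZp 1) = 1) ?mulr1; last exact: val_inj.
have -> : inc C8_index2 (@zmul 1 3 2 isT j) = F2_C8 j by have [->|->] := F2P j; apply: val_inj.
rewrite [RHS](Zp_mulgC (inZp 1)) -!mulgA; congr (_ * _)%g.
by have [->|->] := F2P j; apply: val_inj.
Qed.

(** The square is the transfer of e4 c4 times the restriction of x, and this restriction is e4 c4
    plus its conjugate. Conjugation fixes e4, so e4^2 = 0 is a factor. *)
Lemma mod_x_sqr : x ^+ 2 = 0.
Proof.
have e40 : fK e4 * fK e4 = 0.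
  by have [_ e40 _ _] := C4P; rewrite -rmorphM -expr2 e40 rmorph0.
have twist_e : res twist_K (fK e4) = fK e4.
  have E (p q : C4 * 'F_2) : sgn C4_index2 (p * q)%g.1 = sgn C4_index2 p.1 + sgn C4_index2 q.1.
    by rewrite -chiM.
  have fE : fK e4 = chi_class (GHom E) by exact: res_chi.
  rewrite fE; apply: res_chi => p /=.
  by case: p => -[[|[|[|[|//]]]] ?] [[|[|//]] ?]; apply: val_inj.
rewrite expr2 {1}/x -(trM iK) (res_tr twist_KP) rmorphM /= rmorphM /= twist_e.
rewrite (_ : _ * _ = fK e4 * fK e4 * (fK c4 * (fK c4 + res twist_K (fK c4)))); last first.
  by move: (fK e4) (fK c4) (res twist_K _) => p q v; ring.
by rewrite e40 mul0r; exact: tr0.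
Qed.

(** <a> meets <a^2, b> in <a^2>, so by base change the transfer becomes the one from C4 to C8. *)
Lemma res_a_x : res incA x = e8 * c8.
Proof.
have [_ _ _ trE] := C8P.
rewrite (@res_tr_natural _ _ _ _ iK C8_index2 incA (inl_hom C4)).
- by rewrite res_inl_fst -[c4]expr1 trE expr1.
- by move=> i; rewrite -[LHS]/(word a b (inc C8_index2 i, 0)) (inc_a_word b).
- by move=> i; rewrite (inc_a_word b) chi_z_word.
- by rewrite (inc_a_word b) -(a_word a b).
Qed.

(** The powers of y survive on the subgroup generated by b. *)
Lemma mod_y_power_neq0 n : y ^+ n != 0.
Proof.
have bE (i j : 'F_2) : word a b (1%g, (i * j)%g) = (word a b (1%g, i) * word a b (1%g, j))%g.
  by rewrite (word_mul a8 b2 bab) /parity8 chi1 mulr0 F2_C8_0.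
apply/eqP => /(congr1 (res (GHom bE))) /eqP; rewrite rmorphXn rmorph0 /=.
rewrite (@res_chi _ _ (GHom bE) _ idF2) ?(negPf (tF2_power_neq0 n)) // => i.
by rewrite chi_y_word.
Qed.

End ModularCohomology.

(** * Presentations *)

Lemma addF2mpoly n (p : {mpoly 'F_2[n]}) : p + p = 0.
Proof. by rewrite -[p]scale1r -scalerDl addF2 scale0r. Qed.

Lemma mpolyF2_ind n (P : {mpoly 'F_2[n]} -> Prop) :
  P 1 -> (forall p q, P p -> P q -> P (p + q)) -> (forall i p, P p -> P ('X_i * p)) ->
  forall p, P p.
Proof.
move=> P1 PD PX; have P0 : P 0 by rewrite -(addF2mpoly 1); exact: PD.
apply: mpolyind => // c m p _ c0 Pp; apply: (PD) => //.
have [c0'|->] := F2P c; first by rewrite c0' eqxx in c0.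
rewrite scale1r mpolyXE_id -[\prod_(i < n) _]mulr1; elim/big_rec: _ => [|i q _ Pq]; first by rewrite mul1r.
rewrite -mulrA; elim: (m i) => [|k IH]; first by rewrite expr0 mul1r.
by rewrite exprS -mulrA; exact: PX.
Qed.

Section Evaluation.
Variables (X : sset) (n : nat) (gens : 'I_n -> cohomology X).
Local Notation ev := (eval_gens gens).

Lemma eval0 : ev 0 = 0. Proof. exact: raddf0. Qed.
Lemma evalD : {morph ev : p q / p + q}. Proof. exact: raddfD. Qed.
Lemma evalMn p k : ev (p *+ k) = ev p *+ k. Proof. exact: raddfMn. Qed.
Lemma eval1 : ev 1 = 1. Proof. exact: rmorph1. Qed.
Lemma evalM : {morph ev : p q / p * q}. Proof. exact: rmorphM. Qed.
Lemma evalE p k : ev (p ^+ k) = ev p ^+ k. Proof. exact: rmorphXn. Qed.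
Lemma evalX i : ev 'X_i = gens i.
Proof. by rewrite /eval_gens mmapX mmap1U. Qed.
Lemma eval_sum I (r : seq I) (P : pred I) F :
  ev (\sum_(i <- r | P i) F i) = \sum_(i <- r | P i) ev (F i).
Proof. exact: raddf_sum. Qed.

End Evaluation.

Section Ideal.
Variables (n : nat) (rels : seq {mpoly 'F_2[n]}).

Definition in_ideal (p : {mpoly 'F_2[n]}) : Prop :=
  exists q : 'I_(size rels) -> {mpoly 'F_2[n]}, p = \sum_i q i * rels`_i.

Lemma ideal0 : in_ideal 0.
Proof. by exists (fun=> 0); rewrite big1 // => i _; rewrite mul0r. Qed.

Lemma idealD p q : in_ideal p -> in_ideal q -> in_ideal (p + q).
Proof.
move=> [f ->] [g ->]; exists (fun i => f i + g i).
by rewrite -big_split; apply: eq_bigr => i _; rewrite mulrDl.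
Qed.

Lemma idealM p q : in_ideal q -> in_ideal (p * q).
Proof.
move=> [f ->]; exists (fun i => p * f i); rewrite mulr_sumr.
by apply: eq_bigr => i _; rewrite mulrA.
Qed.

Lemma idealMr p q : in_ideal p -> in_ideal (p * q).
Proof. by rewrite mulrC; exact: idealM. Qed.

Lemma ideal_rel i : (i < size rels)%N -> in_ideal rels`_i.
Proof.
move=> ir; exists (fun j => (j == Ordinal ir)%:R).
rewrite (bigD1 (Ordinal ir)) //= eqxx mul1r big1 ?addr0 // => j /negPf ->.
exact: mul0r.
Qed.

Lemma ideal_sum I (r : seq I) (P : pred I) F :
  (forall i, P i -> in_ideal (F i)) -> in_ideal (\sum_(i <- r | P i) F i).
Proof.
move=> FI; elim/big_rec: _ => [|i p Pi Ip]; first exact: ideal0.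
by apply: idealD => //; exact: FI.
Qed.

End Ideal.

(** * A criterion for Carlson's presentation *)

Section CarlsonCriterion.
Local Notation P4 := {mpoly 'F_2[4]}.
Let Z : P4 := 'X_(0 : 'I_4).
Let Y : P4 := 'X_(1 : 'I_4).
Let X : P4 := 'X_(2 : 'I_4).
Let W : P4 := 'X_(3 : 'I_4).
Local Notation I := (in_ideal carlson_relations).

Lemma carlson_ZZ : I (Z * Z). Proof. by rewrite -expr2; exact: (@ideal_rel _ carlson_relations 0). Qed.
Lemma carlson_ZYY : I (Z * (Y * Y)). Proof. by rewrite -expr2; exact: (@ideal_rel _ carlson_relations 1). Qed.
Lemma carlson_ZX : I (Z * X). Proof. exact: (@ideal_rel _ carlson_relations 2). Qed.
Lemma carlson_XX : I (X * X). Proof. by rewrite -expr2; exact: (@ideal_rel _ carlson_relations 3). Qed.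

(* The monomial of degree n without Y that survives modulo the relations; there
   is none if n = 2 mod 4. *)
Definition carlson_mono n : P4 := [:: 1; Z; 0; X]`_(n %% 4) * W ^+ (n %/ 4).

(* The combination of the Y^i (carlson_mono (n - i)) with coefficients the list l of
   length n + 1. *)
Fixpoint carlson_nf (l : seq bool) : P4 :=
  if l is c :: l' then carlson_mono (size l') *+ c + Y * carlson_nf l' else 0.

Lemma carlson_monoE n k r : n = (4 * k + r)%N -> (r < 4)%N ->
  carlson_mono n = [:: 1; Z; 0; X]`_r * W ^+ k.
Proof.
move=> -> r4; rewrite /carlson_mono -[(4 * k)%N]mulnC modnMDl modn_small //.
by rewrite divnMDl // divn_small // addn0.
Qed.

Lemma carlson_nf_nseq n : carlson_nf (nseq n false) = 0.
Proof. by elim: n => //= n ->; rewrite mulr0 addr0. Qed.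

Lemma carlson_nfD l l' : size l = size l' ->
  carlson_nf l + carlson_nf l' = carlson_nf [seq p.1 (+) p.2 | p <- zip l l'].
Proof.
elim: l l' => [|c l IH] [|c' l'] //=; first by rewrite addr0.
move=> [ll']; rewrite -IH // mulrDr size_map size_zip ll' minnn.
have -> (p : P4) : p *+ (c (+) c') = p *+ c + p *+ c'.
  by case: c c' {ll' IH} => [] []; rewrite ?addF2mpoly ?addr0 ?add0r.
by rewrite addrACA.
Qed.

Lemma mod4_cases n : exists k r, [/\ n = (4 * k + r)%N & (r < 4)%N].
Proof. by exists (n %/ 4)%N, (n %% 4)%N; rewrite mulnC -divn_eq ltn_mod. Qed.

Lemma carlson_monoZ n : exists c : bool, I (Z * carlson_mono n + carlson_mono (n + 1) *+ c).
Proof.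
have [k [r [nE r4]]] := mod4_cases n; rewrite (carlson_monoE nE) //.
case: r r4 nE => [|[|[|[|//]]]] _ nE /=.
- exists true; rewrite (@carlson_monoE _ k 1) //=; last by rewrite nE addn0.
  by rewrite mul1r addF2mpoly; exact: ideal0.
- by exists false; rewrite addr0 mulrA; exact/idealMr/carlson_ZZ.
- by exists false; rewrite addr0 mul0r mulr0; exact: ideal0.
- by exists false; rewrite addr0 mulrA; exact/idealMr/carlson_ZX.
Qed.

Lemma carlson_monoX n : exists c : bool, I (X * carlson_mono n + carlson_mono (n + 3) *+ c).
Proof.
have [k [r [nE r4]]] := mod4_cases n; rewrite (carlson_monoE nE) //.
case: r r4 nE => [|[|[|[|//]]]] _ nE /=.
- exists true; rewrite (@carlson_monoE _ k 3) //=; last by rewrite nE addn0.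
  by rewrite mul1r addF2mpoly; exact: ideal0.
- by exists false; rewrite addr0 mulrA (mulrC X); exact/idealMr/carlson_ZX.
- by exists false; rewrite addr0 mul0r mulr0; exact: ideal0.
- by exists false; rewrite addr0 mulrA; exact/idealMr/carlson_XX.
Qed.

Lemma carlson_monoW n : exists c : bool, I (W * carlson_mono n + carlson_mono (n + 4) *+ c).
Proof.
exists true; rewrite /carlson_mono modnDr divnDr // mulrCA -exprS addn1.
by rewrite addF2mpoly; exact: ideal0.
Qed.

(** Multiplication by M commutes with Y, so it acts on the coefficients one at a time, as on the
    monomials; d is the degree of M. *)
Lemma carlson_nf_mul (M : P4) d :
  (forall n, exists c : bool, I (M * carlson_mono n + carlson_mono (n + d) *+ c)) ->
  forall l, exists2 l', size l' = (size l + d)%N & I (M * carlson_nf l + carlson_nf l').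
Proof.
move=> Md; elim=> [|c l [l' sl' IH]].
  by exists (nseq d false); rewrite ?size_nseq // carlson_nf_nseq mulr0 addr0; exact: ideal0.
have [c0 Ic0] := Md (size l); exists ((c && c0) :: l'); rewrite /= ?sl' //.
rewrite (_ : _ + _ = (M * carlson_mono (size l) + carlson_mono (size l + d) *+ c0) *+ c +
    Y * (M * carlson_nf l + carlson_nf l')); last first.
  case: c; rewrite ?andTb ?andFb ?mulr1n ?mulr0n ?addr0 ?add0r.
    by move: (carlson_mono (_ + _)) => q; case: (c0); rewrite ?mulr1n ?mulr0n; ring.
  by ring.
apply: idealD; last exact: idealM.
by case: c => //; exact: ideal0.
Qed.

(** Each normal form is homogeneous, so a general polynomial is congruent to a sum over a list of
    them. *)
Lemma carlson_nf_span p : exists ls, I (p + \sum_(l <- ls) carlson_nf l).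
Proof.
elim/mpolyF2_ind: p => [|p q [lp Ip] [lq Iq]|i p [lp Ip]].
- exists [:: [:: true]]; rewrite big_seq1 /= /carlson_mono /= expr0 mulr0 addr0 mulr1.
  by rewrite addF2mpoly; exact: ideal0.
- by exists (lp ++ lq); rewrite big_cat addrACA; exact: idealD.
- have Xi l : exists l', I ('X_i * carlson_nf l + carlson_nf l').
    have [] : [\/ i = 0, i = 1, i = 2 | i = 3].
    + by case: i => -[|[|[|[|//]]]] ?; [constructor 1|constructor 2|constructor 3|constructor 4]; apply: val_inj.
    + by move=> ->; have [l' _ ?] := carlson_nf_mul carlson_monoZ l; exists l'.
    + by move=> ->; exists (false :: l) => /=; rewrite add0r addF2mpoly; exact: ideal0.
    + by move=> ->; have [l' _ ?] := carlson_nf_mul carlson_monoX l; exists l'.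
    + by move=> ->; have [l' _ ?] := carlson_nf_mul carlson_monoW l; exists l'.
  have [ls Ils] : exists ls, I ('X_i * (\sum_(l <- lp) carlson_nf l) + \sum_(l <- ls) carlson_nf l).
    elim: lp {Ip} => [|l lp [ls Ils]]; first by exists [::]; rewrite !big_nil mulr0 addr0; exact: ideal0.
    have [l' Il'] := Xi l; exists (l' :: ls); rewrite !big_cons mulrDr addrACA.
    exact: idealD.
  exists ls; rewrite (_ : _ + _ = 'X_i * (p + \sum_(l <- lp) carlson_nf l) +
    ('X_i * (\sum_(l <- lp) carlson_nf l) + \sum_(l <- ls) carlson_nf l)).
    by apply: idealD => //; exact: idealM.
  by rewrite mulrDr addrA -[_ + _ + 'X_i * _]addrA addF2mpoly addr0.
Qed.

Variables (T : sset) (z y x w : cohomology T).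
Hypotheses (z1 : in_degree 1 z) (y1 : in_degree 1 y) (x3 : in_degree 3 x) (w4 : in_degree 4 w).
Hypotheses (zz : z ^+ 2 = 0) (zyy : z * y ^+ 2 = 0) (zx : z * x = 0) (xx : x ^+ 2 = 0).
Local Notation gens := (fun i : 'I_4 => [:: z; y; x; w]`_i).
Local Notation ev := (eval_gens gens).
Local Notation g n := (ev (carlson_mono n)).
Hypothesis degree0 : forall a : cohomology T, in_degree 0 a -> a = 0 \/ a = 1.
(** This hypothesis and the next two are what the restriction to <a> and the Gysin sequence of y
    will provide. *)
Hypothesis span : forall n (a : cohomology T), in_degree n.+1 a ->
  exists (c : bool) b, in_degree n b /\ a = g n.+1 *+ c + y * b.
Hypothesis independent : forall n b, in_degree n b -> g n.+1 = y * b -> (n.+1 %% 4 = 2)%N.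
Hypothesis ker_y : forall n b, in_degree n b -> y * b = 0 ->
  b = 0 \/ (n %% 4 = 2)%N /\ b = z * y * w ^+ (n %/ 4).

Let evE : [/\ ev Z = z, ev Y = y, ev X = x & ev W = w].
Proof. by split; rewrite evalX. Qed.

Lemma eval_mono_degree n : in_degree n (g n).
Proof.
have [k [r [nE r4]]] := mod4_cases n; rewrite (carlson_monoE nE) // evalM evalE nE addnC.
have [Ez _ Ex Ew] := evE; rewrite Ew; apply: in_degreeM; last exact: in_degreeX.
case: r r4 {nE} => [|[|[|[|//]]]] _ /=; rewrite ?Ez ?Ex ?eval1 ?eval0 //.
  exact: in_degree_one.
exact: in_degree0.
Qed.

Lemma eval_nf_degree l : in_degree (size l).-1 (ev (carlson_nf l)).
Proof.
elim: l => [|c l IH] /=; first by rewrite eval0; exact: in_degree0.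
have [_ Ey _ _] := evE; rewrite evalD evalM evalMn Ey; apply: in_degreeD.
  by apply: in_degree_mulb; exact: eval_mono_degree.
case: l IH => [|c' l] IH; first by rewrite eval0 mulr0; exact: in_degree0.
exact: (in_degreeM y1 IH).
Qed.

(** Only membership in the ideal can be claimed, since a normal form may contain Z Y^i with i >= 2.
    The term free of Y is removed by [independent]. What remains is Y times a normal form whose
    image lies in the kernel of y, so this image is 0 or that of Z Y W^k; in the latter case the
    relation Z Y^2 absorbs the product with Y. *)
Lemma eval_nf_eq0 l : ev (carlson_nf l) = 0 -> I (carlson_nf l).
Proof.
have [Ez Ey Ex Ew] := evE.
elim: {l}(size l) {-2}l (erefl (size l)) => [|n IH] [|c l] //= => [_ _|[sl]]; first exact: ideal0.
rewrite evalD evalM evalMn Ey => E.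
have {E} [-> E] : carlson_mono (size l) *+ c = 0 /\ y * ev (carlson_nf l) = 0.
  case: c E => /= E; last by split=> //; move: E; rewrite add0r.
  case: l sl E => [_|c1 l1 sl] E.
    by move: E; rewrite eval0 mulr0 addr0 /carlson_mono expr0 mulr1 /= eval1 => /eqP; rewrite oner_eq0.
  have n2 := independent (eval_nf_degree (c1 :: l1)) (addHC_eq0 E).
  have m0 : carlson_mono (size (c1 :: l1)) = 0 by rewrite /carlson_mono n2 mul0r.
  by split=> //; move: E; rewrite m0 eval0 add0r.
rewrite add0r; have [lE|[n2 lE]] := ker_y (eval_nf_degree l) E; first exact/idealM/IH.
case: l sl n2 lE {E} => // c1 l1 /= sl n2 lE.
set k := (size l1 %/ 4)%N in lE.
have l1E : size l1 = (4 * k + 1).+1 by rewrite [LHS](divn_eq _ 4) n2 mulnC addn2 addn1.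
(* The coefficients of Y Z W^k in degree 4 k + 2: the entry at Y^1, followed by the 4 k + 1 entries
   at higher powers of Y. *)
pose l2 := [:: false, true & nseq (4 * k + 1) false].
have l2E : carlson_nf l2 = Y * (Z * W ^+ k).
  by rewrite /= carlson_nf_nseq mulr0 addr0 add0r size_nseq (@carlson_monoE _ k 1).
have sl2 : size (c1 :: l1) = size l2 by rewrite /= size_nseq l1E.
have I12 : I (carlson_nf (c1 :: l1) + carlson_nf l2).
  rewrite carlson_nfD //; apply: IH; first by rewrite size_map size_zip -sl2 minnn /= sl.
  rewrite -carlson_nfD // evalD lE l2E !evalM evalE Ez Ey Ew -mulrA (mulrCA z) addHH //.
have -> p : Y * p = Y * (p + carlson_nf l2) + Z * (Y * Y) * W ^+ k.
  rewrite l2E mulrDr -addrA (_ : Z * (Y * Y) * W ^+ k = Y * (Y * (Z * W ^+ k))); last by ring.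
  by rewrite addF2mpoly addr0.
by apply: idealD; [exact: idealM | exact/idealMr/carlson_ZYY].
Qed.

Lemma eval_gens_surj a : exists p, a = ev p.
Proof.
have [_ Ey _ _] := evE; have [N ->] := hcomp_decomp a.
suff H n b : in_degree n b -> exists p, b = ev p.
  elim/big_rec: _ => [|i b _ [p ->]]; first by exists 0; rewrite eval0.
  by have [q ->] := H _ _ (hcomp_in i a); exists (q + p); rewrite evalD.
elim: n b => [|n IH] b bn.
  by case: (degree0 bn) => ->; [exists 0; rewrite eval0 | exists 1; rewrite eval1].
have [c [b' [/IH[p ->] ->]]] := span bn.
by exists (carlson_mono n.+1 *+ c + Y * p); rewrite evalD evalMn evalM Ey.
Qed.

Lemma eval_gens_ker p : ev p = 0 -> I p.
Proof.
move=> p0; have [ls Ip] := carlson_nf_span p.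
have ev_ideal q : I q -> ev q = 0.
  case=> f ->; have [Ez Ey Ex Ew] := evE.
  rewrite eval_sum big1 // => -[[|[|[|[|//]]]] ?] _;
    by rewrite evalM /= ?evalE ?evalM ?evalE ?Ez ?Ey ?Ex ?zz ?zyy ?zx ?xx mulr0.
have ls0 : ev (\sum_(l <- ls) carlson_nf l) = 0 by have := ev_ideal _ Ip; rewrite evalD p0 add0r.
(* Lists of length n + 1 evaluate in degree n, so the part of each length vanishes separately; the
   empty list contributes the zero polynomial. *)
have by_size n : I (\sum_(l <- ls | size l == n) carlson_nf l).
  have [s sn sE] : exists2 s, size s = n & \sum_(l <- ls | size l == n) carlson_nf l = carlson_nf s.
    elim/big_rec: _ => [|l q /eqP ln [s sn ->]]; first by exists (nseq n false); rewrite ?size_nseq ?carlson_nf_nseq.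
    by exists [seq p.1 (+) p.2 | p <- zip l s]; rewrite ?carlson_nfD ?size_map ?size_zip ?ln ?sn ?minnn.
  rewrite sE; case: n sn sE => [/size0nil ->|n sn sE]; first by move=> _; exact: ideal0.
  apply: eval_nf_eq0; rewrite -sE eval_sum.
  have := congr1 (hcomp n) ls0; rewrite hcomp0 eval_sum hcomp_sum; apply: etrans.
  rewrite [RHS](bigID (fun l => size l == n.+1)) /= [X in _ + X]big1 ?addr0; last first.
    case=> [|c l] ln; first by rewrite eval0 hcomp0.
    exact: (hcomp_neq (eval_nf_degree _)).
  apply: eq_bigr => l /eqP ln; rewrite hcomp_id //.
  by have := eval_nf_degree l; rewrite ln.
have bound M : I (\sum_(l <- ls | (size l < M)%N) carlson_nf l).
  elim: M => [|M IH]; first by rewrite big_pred0 //; exact: ideal0.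
  rewrite (bigID (fun l => size l == M)) /=; apply: idealD.
    rewrite (eq_bigl (fun l => size l == M)) // => l.
    by rewrite ltnS; case: eqP => [->|]; rewrite ?leqnn ?andbF.
  rewrite (eq_bigl (fun l => (size l < M)%N)) // => l.
  by rewrite ltnS [RHS]ltn_neqAle andbC.
rewrite -[p]addr0 -(addF2mpoly (\sum_(l <- ls) carlson_nf l)) addrA; apply: idealD => //.
have := bound (\max_(l <- ls) size l).+1; rewrite big_seq_cond.
rewrite (eq_bigl (fun l => l \in ls)) -?big_seq // => l.
by case: (boolP (l \in ls)) => // lls; rewrite ltnS leq_bigmax_seq.
Qed.

Lemma carlson_criterion : carlson_presentation z y x w.
Proof.
split=> //; split; first exact: eval_gens_surj.
move=> p; split; first exact: eval_gens_ker.
case=> f ->; have [Ez Ey Ex Ew] := evE.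
rewrite eval_sum big1 // => -[[|[|[|[|//]]]] ?] _;
  by rewrite evalM /= ?evalE ?evalM ?evalE ?Ez ?Ey ?Ex ?zz ?zyy ?zx ?xx mulr0.
Qed.

End CarlsonCriterion.

(** * Change of generators *)

Section Substitution.
Variables (m n : nat) (h : 'I_m -> {mpoly 'F_2[n]}).

Definition subst (p : {mpoly 'F_2[m]}) : {mpoly 'F_2[n]} := mmap (@mpolyC n 'F_2) h p.

Lemma substD : {morph subst : p q / p + q}. Proof. exact: raddfD. Qed.
Lemma substM : {morph subst : p q / p * q}. Proof. exact: rmorphM. Qed.
Lemma subst1 : subst 1 = 1. Proof. exact: rmorph1. Qed.
Lemma substE p k : subst (p ^+ k) = subst p ^+ k. Proof. exact: rmorphXn. Qed.
Lemma subst_X i : subst 'X_i = h i.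
Proof. by rewrite /subst mmapX mmap1U. Qed.
Lemma subst_sum I (r : seq I) (P : pred I) F :
  subst (\sum_(i <- r | P i) F i) = \sum_(i <- r | P i) subst (F i).
Proof. exact: raddf_sum. Qed.

Lemma eval_subst (X : sset) (gens : 'I_n -> cohomology X) (gens' : 'I_m -> cohomology X) p :
  (forall i, eval_gens gens (h i) = gens' i) -> eval_gens gens (subst p) = eval_gens gens' p.
Proof.
move=> hE; elim/mpolyF2_ind: p => [|p q IHp IHq|i p IH]; first by rewrite subst1 !eval1.
  by rewrite (substD p q) (evalD gens (subst p)) (evalD gens' p); exact: congr2 IHp IHq.
by rewrite substM !evalM subst_X hE evalX IH.
Qed.

End Substitution.

(** A relation among [gens'] is carried by h into the ideal of [rels]; h' brings it back to itself
    and maps that ideal into the one of [rels']. *)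
Lemma presented_subst (X : sset) m n (h : 'I_m -> {mpoly 'F_2[n]}) (h' : 'I_n -> {mpoly 'F_2[m]})
    (gens : 'I_n -> cohomology X) (gens' : 'I_m -> cohomology X) rels rels' :
  (forall i, eval_gens gens (h i) = gens' i) -> (forall i, eval_gens gens' (h' i) = gens i) ->
  (forall i, subst h' (h i) = 'X_i) ->
  (forall i, (i < size rels)%N -> in_ideal rels' (subst h' rels`_i)) ->
  (forall i, (i < size rels')%N -> eval_gens gens' rels'`_i = 0) ->
  presented_by gens rels -> presented_by gens' rels'.
Proof.
move=> hE hE' hK relsI rels0 [surj ker]; split=> [a|p].
  by have [p ->] := surj a; exists (subst h' p); rewrite (eval_subst _ hE').
split=> [p0|[f ->]]; last by rewrite eval_sum big1 // => i _; rewrite evalM rels0 ?mulr0.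
rewrite -[p](_ : subst h' (subst h p) = p); last first.
  elim/mpolyF2_ind: {p0}p => [|p q IHp IHq|i p IH]; first by rewrite !subst1.
    by rewrite (substD h p q) (substD h' (subst h p)); exact: congr2 IHp IHq.
  by rewrite !substM subst_X hK IH.
move: p0; rewrite -(eval_subst _ hE) => /ker[f ->].
rewrite subst_sum; apply: ideal_sum => i _.
by rewrite substM; apply/idealM/relsI.
Qed.

(** * The two presentations, and the place of x outside the Stiefel-Whitney subring *)

Section ModularPresentation.
Variables (gT : finGroupType) (a b : gT).
Hypotheses (card_G : #|gT| = 16%N) (gen_G : <<[set a; b]>>%g = [set: gT]).
Hypotheses (a8 : (a ^+ 8 = 1)%g) (b2 : (b ^+ 2 = 1)%g) (bab : (b * a * b^-1 = a ^+ 5)%g).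
Local Notation iA := (index_a card_G gen_G a8 b2 bab).
Local Notation incA := (inc_a a8).
Local Notation z := (mod_z card_G gen_G a8 b2 bab).
Local Notation y := (mod_y card_G gen_G a8 b2 bab).
Local Notation x := (mod_x card_G gen_G a8 b2 bab).
Variable W : H gT.
Hypotheses (W4 : in_degree 4 W) (WE : res incA W = c8 ^+ 2).
Local Notation g n := (eval_gens (fun i : 'I_4 => [:: z; y; x; W]`_i) (carlson_mono n)).

Lemma res_a_mono n : (n %% 4 != 2)%N -> res incA (g n) = cyclic_gen e8 c8 n.
Proof.
have [k [r [nE r4]]] := mod4_cases n; rewrite (carlson_monoE nE) // evalM evalE rmorphM rmorphXn evalX /=.
rewrite WE -exprM /cyclic_gen nE => n2.
have -> : odd (4 * k + r) = odd r by rewrite oddD oddM.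
have -> : (4 * k + r)./2 = (2 * k + r./2)%N by clear; lia.
rewrite exprD; case: r r4 nE n2 => [|[|[|[|//]]]] _ _ n2 /=.
- by rewrite eval1 rmorph1 !mul1r mulr1.
- by rewrite evalX res_a_z -[c8 ^+ 0]/(1 : H C8) mulr1.
- by move: n2; rewrite mulnC modnMDl.
- by rewrite evalX res_a_x -mulrA (mulrC c8).
Qed.

(** On <a> a class is 0 or the generator. In the latter case the normal monomial has the same
    restriction, and the difference is a multiple of y. *)
Lemma mod_span n (u : H gT) : in_degree n.+1 u ->
  exists (c : bool) v, in_degree n v /\ u = g n.+1 *+ c + y * v.
Proof.
have ker v : in_degree n.+1 v -> res incA v = 0 -> exists2 v', in_degree n v' & v = y * v'.
  exact: (@res_eq0 _ _ iA).
move=> un; have [u0|] := cyclic_span C8_cyclic (pull_degree (Bmap incA) un).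
  by have [v vn ->] := ker u un u0; exists false, v; rewrite add0r.
have [n2|n2] := eqVneq (n.+1 %% 4)%N 2%N; last move=> uE.
  have u0 := res_a_2mod4 card_G gen_G b2 bab W4 WE un n2.
  by have [v vn -> _] := ker u un u0; exists false, v; rewrite add0r.
have gn : in_degree n.+1 (g n.+1).
  apply: eval_mono_degree; rewrite ?W4 //; [exact: chi_degree | exact: mod_x_degree].
have [||v vn vE] := ker (u + g n.+1); first exact: in_degreeD.
  by rewrite rmorphD /= uE res_a_mono // addHH.
by exists true, v; split=> //; rewrite -vE addrCA addHH addr0.
Qed.

Lemma modular_carlson : carlson_presentation z y x W.
Proof.
apply: carlson_criterion; rewrite ?mod_z_sqr ?mod_zyy ?mod_zx ?mod_x_sqr //; try exact: chi_degree.
- exact: mod_x_degree.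
- exact: degree0P.
- exact: mod_span.
- move=> n v vn gE; apply/eqP; apply: contraT => n2; have := res_a_mono n2.
  rewrite gE rmorphM /= res_a_y mul0r => /esym/eqP.
  by rewrite (negPf (cyclic_neq0 C8_cyclic _)).
- exact: ker_y.
Qed.

Lemma modular_sw_presentation :
  presented_by (fun i : 'I_4 => [:: y; y + z; W; x]`_i) sw_relations.
Proof.
have [_ _ _ _] := modular_carlson.
pose h (i : 'I_4) : {mpoly 'F_2[4]} := [:: 'X_1; 'X_1 + 'X_0; 'X_3; 'X_2]`_i.
pose h' (i : 'I_4) : {mpoly 'F_2[4]} := [:: 'X_0 + 'X_1; 'X_0; 'X_3; 'X_2]`_i.
apply: (@presented_subst _ _ _ h h').
- by case=> -[|[|[|[|//]]]] ?; rewrite /h /= ?evalD !evalX.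
- by case=> -[|[|[|[|//]]]] ?; rewrite /h' /= ?evalD !evalX //= addrA addHH add0r.
- case=> -[|[|[|[|//]]]] ?; rewrite /h /= ?substD !subst_X /h' /=; try by congr mpolyX; congr mnm1; apply: val_inj.
  rewrite addrA addF2mpoly add0r; congr mpolyX; congr mnm1; exact: val_inj.
- have r0 := @ideal_rel _ sw_relations 0 isT; have r1 := @ideal_rel _ sw_relations 1 isT.
  have r2 := @ideal_rel _ sw_relations 2 isT; have r3 := @ideal_rel _ sw_relations 3 isT.
  move: r0 r1 r2 r3 => /= r0 r1 r2 r3.
  case=> [|[|[|[|//]]]] _; rewrite /carlson_relations /= ?substE ?substM ?substE !subst_X /h' /=.
  + rewrite sqrrD mulr2n addF2mpoly addr0; exact: r0.
  + rewrite (_ : _ * _ = 'X_0 * ('X_0 ^+ 2 + 'X_1 ^+ 2) + ('X_0 ^+ 2 * 'X_1 + 'X_0 * 'X_1 ^+ 2)).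
      by apply: idealD => //; exact: idealM.
    have E (p q : {mpoly 'F_2[4]}) : p * (p ^+ 2 + q ^+ 2) + (p ^+ 2 * q + p * q ^+ 2) =
       (p + q) * p ^+ 2 + (p * q ^+ 2 + p * q ^+ 2) by ring.
    by rewrite E addF2mpoly addr0.
  + by rewrite mulrDl.
  + exact: r3.
- have zz := mod_z_sqr card_G gen_G a8 b2 bab; have zyy := mod_zyy card_G gen_G a8 b2 bab.
  have zx := mod_zx card_G gen_G a8 b2 bab; have xx := mod_x_sqr card_G gen_G a8 b2 bab.
  case=> [|[|[|[|//]]]] _; rewrite /sw_relations /=.
  + by rewrite evalD !evalE !evalX /= sqrHD addrA addHH add0r zz.
  + rewrite evalD (evalM _ ('X_0 ^+ 2)) (evalM _ 'X_0) !evalE !evalX /=.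
    by rewrite sqrHD zz addr0 mulrDr -exprSr -exprS addrAC addHH add0r mulrC zyy.
  + by rewrite evalD !evalM !evalX /= mulrDl addrA addHH add0r zx.
  + by rewrite evalE evalX.
Qed.

Lemma carlson_x_unique z' y' x' w' : carlson_presentation z' y' x' w' -> x' = x.
Proof.
case=> _ _ x3 _ [_ ker'].
have xx' : x' ^+ 2 = 0.
  have := ker' ('X_(2 : 'I_4) ^+ 2); rewrite evalE evalX /= => ->.
  exact: (@ideal_rel _ carlson_relations 3).
have x_neq0 : x != 0.
  apply/eqP => /(congr1 (res incA)); rewrite res_a_x rmorph0 => /eqP.
  have := cyclic_neq0 C8_cyclic 3; rewrite /cyclic_gen /= expr1 expr1.
  by move=> /negPf ->.
(* If x' were 0, the variable X would lie in the ideal of Carlson's relations, which is also the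
   kernel for x. *)
have x'_neq0 : x' != 0.
  apply: contra x_neq0 => /eqP x'0; apply/eqP.
  have [_ _ _ _ [_ ker]] := modular_carlson.
  have := ker 'X_(2 : 'I_4); rewrite evalX /= => ->; apply/ker'.
  by rewrite evalX.
have [c [v [v2 x'E]]] := mod_span x3; have [c' [v' [v1 vE]]] := mod_span v2.
have [c2 [d [d0 v'E]]] := mod_span v1.
have g1 : g 1 = z by rewrite /carlson_mono /= expr0 mulr1 evalX.
have g2 : g 2 = 0 by rewrite /carlson_mono /= mul0r eval0.
have g3 : g 3 = x by rewrite /carlson_mono /= expr0 mulr1 evalX.
have {x'E} x'E : x' = x *+ c + y ^+ 3 * d.
  rewrite x'E vE v'E g3 g2 g1 mul0rn add0r; congr (_ + _).
  have E (p q s t : H gT) : p * (p * (q * s + p * t)) = q * p ^+ 2 * s + p ^+ 3 * t by ring.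
  by rewrite -mulr_natr E mod_zyy mul0r add0r.
case: (degree0P d0) => dE; last first.
  move: xx'; rewrite x'E dE mulr1 sqrHD -exprM => /eqP.
  have -> : (x *+ c) ^+ 2 = 0 by case: (c); rewrite ?mulr0n ?mulr1n ?mod_x_sqr ?expr0n.
  by rewrite add0r (negPf (mod_y_power_neq0 _ _ _ _ _ _)).
move: x'_neq0; rewrite x'E dE mulr0 addr0.
by case: (c); rewrite ?eqxx.
Qed.

Lemma hcomp_mul (X : sset) n (p q : cohomology X) :
  hcomp n (p * q) = \sum_(i < n.+1) hcomp i p * hcomp (n - i) q.
Proof.
have [N pE] := hcomp_decomp p; rewrite {1}pE mulr_suml hcomp_sum.
have term i : hcomp n (hcomp i p * q) = if (i < n.+1)%N then hcomp i p * hcomp (n - i) q else 0.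
  case: ltnP => ni; last exact: hcompM_lt (hcomp_in _ _) ni.
  by rewrite -{1}(subnKC (n := n) ni) (hcompM _ _ (hcomp_in _ _)).
under eq_bigr do rewrite term.
have tail i : (N <= i)%N -> hcomp i p = 0.
  move=> Ni; rewrite pE hcomp_sum big1 // => j _.
  by apply: (hcomp_neq (hcomp_in _ _)); rewrite neq_ltn (leq_trans (ltn_ord j) Ni).
rewrite -big_mkcond /= -(big_mkord (fun i => (i < n.+1)%N) (fun i => hcomp i p * hcomp (n - i) q)).
rewrite -(big_mkord xpredT (fun i => hcomp i p * hcomp (n - i) q)).
have [Nn|nN] := leqP N n.+1.
  rewrite [RHS](big_cat_nat (n := N)) //= [X in _ + X]big_nat_cond [X in _ + X]big1 ?addr0; last first.
    by move=> i /andP[/andP[Ni _] _]; rewrite tail ?mul0r.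
  rewrite big_nat_cond [RHS]big_nat_cond; apply: eq_bigl => i.
  by case: (ltnP i N) => iN; rewrite ?andbF //= (leq_trans iN Nn).
rewrite (big_cat_nat (n := n.+1)) ?(ltnW nN) //= [X in _ + X]big_nat_cond [X in _ + X]big1 ?addr0.
  by rewrite big_nat_cond [RHS]big_nat_cond; apply: eq_bigl => i; rewrite andbT; case: (ltnP i n.+1).
by move=> i /andP[/andP[ni _]]; rewrite ltnNge ni.
Qed.

(** The classes whose component of degree 3 vanishes on <a> form a subring: in a product, each term
    of degree 3 has a factor of degree 2 or 3, and components of degree 2 vanish on <a> as well.
    Every w_3 lies in this subring by [sw3_C8], whereas x does not. *)
Lemma modular_not_sw (R : realType) (w : forall k : nat, nat -> cohomology (BO R k)) :
  stiefel_whitney w -> ~ sw_subring w x.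
Proof.
move=> w_universal xS.
pose S : set (H gT) := fun u => hcomp 3 (res incA u) = 0.
have two (u : H gT) : hcomp 2 (res incA u) = 0.
  by rewrite -pull_hcomp (res_a_2mod4 card_G gen_G b2 bab W4 WE (hcomp_in 2 u)).
suff : S x.
  rewrite /S /= res_a_x hcomp_id; last exact: (@in_degreeM _ 1 2 _ _ (cyclic_deg1 C8_cyclic) (cyclic_deg2 C8_cyclic)).
  move=> /eqP; have := cyclic_neq0 C8_cyclic 3; rewrite /cyclic_gen /= expr1 expr1.
  by move=> /negPf ->.
apply: xS; split.
  split=> [|u v /set_mem uS /set_mem vS|u v /set_mem uS /set_mem vS]; apply/mem_set.
  - by rewrite /S /= rmorph1; exact: (hcomp_neq (in_degree_one _)).
  - by rewrite /S /= rmorphD /= oppH hcompD uS vS addr0.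
  - rewrite /S /= rmorphM /= hcomp_mul 4!big_ord_recl big_ord0 /= /bump /=.
    by rewrite uS vS !two !mul0r !mulr0 !addr0.
move=> _ [k [r [j ->]]]; rewrite /S /=.
rewrite (@sw_res _ w _ _ incA j k r (restrict_rep incA r)) //.
have [->|j3] := eqVneq j 3%N; last exact: hcomp_neq (sw_in w_universal _ _) j3.
rewrite sw3_C8 // -(@sw_res _ w _ _ incA 2 k r (restrict_rep incA r)) //.
by rewrite (res_a_2mod4 card_G gen_G b2 bab W4 WE (sw_in w_universal r 2)) // mulr0 hcomp0.
Qed.

End ModularPresentation.

(** Schur's lemma: for an eigenvalue c of f, the matrix f - c commutes with the action and is not
    invertible, so it is 0. *)
Lemma irr_centgmx_scalar (C : closedFieldType) (gT : finGroupType) (G : {group gT}) n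
    (rho : mx_representation C G n.+1) f :
  mx_irreducible rho -> centgmx rho f -> exists c, f = c%:M.
Proof.
move=> rho_irr fC; have /closed_rootP [c] : size (char_poly f) != 1%N by rewrite size_char_poly.
rewrite -eigenvalue_root_char => c_eig; exists c; apply/eqP; rewrite -subr_eq0.
apply: contraLR c_eig => fc0; rewrite /eigenvalue /eigenspace negbK kermx_eq0 row_free_unit.
apply: (mx_Schur rho_irr) => //; apply/centgmxP => x Gx.
by rewrite mulmxBl mulmxBr scalar_mxC (centgmxP fC).
Qed.

Lemma realifyN1 (R : realType) n : realify (- 1%:M : 'M[R[i]]_n) = - 1%:M.
Proof.
rewrite -[in RHS](@realify1 R n) /realify opp_block_mx; congr block_mx;
  by apply/matrixP => i j; rewrite !mxE; case: eqP => _ /=; rewrite ?oppr0 ?opprK.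
Qed.

(** * The representations r_2, r_3 and r_8 of the modular group *)

Section ModularRepresentations.
Variables (gT : finGroupType) (a b : gT).
Hypotheses (card_G : #|gT| = 16%N) (gen_G : <<[set a; b]>>%g = [set: gT]).
Hypotheses (a8 : (a ^+ 8 = 1)%g) (b2 : (b ^+ 2 = 1)%g) (bab : (b * a * b^-1 = a ^+ 5)%g).

(* Otherwise a and b would act by commuting matrices, hence by scalars. *)
Lemma irr_a4 (C : closedFieldType) (rho : mx_representation C [set: gT] 2) :
  mx_irreducible rho -> rho (a ^+ 4)%g = - 1%:M.
Proof.
move=> rho_irr; pose scalar := irr_centgmx_scalar rho_irr.
have rhoM x y : rho (x * y)%g = rho x *m rho y by rewrite repr_mxM ?inE.
have rhoX x n : rho (x ^+ n)%g = rho x ^+ n by rewrite repr_mxX ?inE.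
have cent x : (forall c, c \in [set a; b] -> rho x *m rho c = rho c *m rho x) ->
    exists c, rho x = c%:M.
  move=> xC; apply: scalar; apply/centgmxP => y _.
  have [[i j] <-] := word_surj gen_G a8 b2 bab y; rewrite rhoM !rhoX.
  have X c n : rho x *m rho c = rho c *m rho x -> rho x *m rho c ^+ n = rho c ^+ n *m rho x.
    move=> xc; elim: n => [|n IH]; first by rewrite mulmx1 mul1mx.
    by rewrite exprS -mulmxE mulmxA xc -!mulmxA IH.
  by rewrite mulmxA X ?xC ?inE ?eqxx // -mulmxA X ?xC ?inE ?eqxx ?orbT // mulmxA.
have ba : (b * a = a ^+ 4 * (a * b))%g by rewrite mulgA -expgSr -(b_mul_a bab 1).
have b4 : (b * a ^+ 4 = a ^+ 4 * b)%g by rewrite (b_mul_a bab) -(a_mod a8).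
have [|c cE] := cent (a ^+ 4)%g.
  move=> d; rewrite !inE => /orP[]/eqP ->; rewrite -!rhoM ?b4 //.
  by rewrite -expgSr -expgS.
have : c ^+ 2 = 1.
  have : rho (a ^+ 4 * a ^+ 4)%g = 1%:M by rewrite -expgD a8 repr_mx1.
  rewrite rhoM cE -scalar_mxM -expr2 => /matrixP/(_ 0 0).
  by rewrite !mxE eqxx !mulr1n.
move=> /eqP; rewrite sqrf_eq1 => /orP[]/eqP c1; last by rewrite cE c1 raddfN.
have ab_comm : rho a *m rho b = rho b *m rho a.
  by rewrite -!rhoM ba (rhoM (a ^+ 4)%g) cE c1 mul1mx.
have [|ca aE] := cent a; first by move=> d; rewrite !inE => /orP[]/eqP ->.
have [|cb bE] := cent b; first by move=> d; rewrite !inE => /orP[]/eqP ->.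
have /mx_irrP[_ full] := rho_irr.
have U0 : delta_mx 0 0 != 0 :> 'M[C]_2.
  by apply/eqP => /matrixP/(_ 0 0); rewrite !mxE /= => /eqP; rewrite oner_eq0.
(* If all group elements act by scalars, the line of the first basis vector is invariant, which
   irreducibility in dimension 2 forbids. *)
suff modU : mxmodule rho (delta_mx 0 0 : 'M[C]_2).
  by have := full _ modU U0; rewrite /row_full mxrank_delta.
apply/mxmoduleP => x _; have [[i j] <-] := word_surj gen_G a8 b2 bab x.
rewrite rhoM !rhoX aE bE -!rmorphXn /= -scalar_mxM mul_mx_scalar.
exact: scalemx_sub.
Qed.

Section StiefelWhitney.
Variable R : realType.
Variable w : forall k : nat, nat -> cohomology (BO R k).
Hypothesis w_universal : stiefel_whitney w.
Local Notation y := (mod_y card_G gen_G a8 b2 bab).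
Local Notation z := (mod_z card_G gen_G a8 b2 bab).

Lemma sw1_y (r : orthogonal_rep R gT 1) : r a = 1%:M -> r b = (-1)%:M -> sw w 1 r = y.
Proof.
move=> ra rb; apply: sw1_line => // g.
have [[i j] <-] := word_surj gen_G a8 b2 bab g; rewrite chi_y_word /word rep_homM !rep_power ra rb.
by rewrite -[1%:M ^+ _]/(1 ^+ _) expr1n mul1mx /neg_hom_fun rmorphXn.
Qed.

Lemma sw1_yz (r : orthogonal_rep R gT 1) : r a = (-1)%:M -> r b = (-1)%:M -> sw w 1 r = y + z.
Proof.
move=> ra rb.
have E (g h : gT) : chi_y card_G gen_G a8 b2 bab (g * h)%g + chi_z card_G gen_G a8 b2 bab (g * h)%g =
   (chi_y card_G gen_G a8 b2 bab g + chi_z card_G gen_G a8 b2 bab g) +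
   (chi_y card_G gen_G a8 b2 bab h + chi_z card_G gen_G a8 b2 bab h).
  by rewrite !chiM addrACA.
rewrite (@sw1_line _ _ w_universal _ _ (GHom E)); first exact: chi_classD.
move=> g; have [[i j] <-] := word_surj gen_G a8 b2 bab g.
rewrite -[GHom E _]/(chi_y card_G gen_G a8 b2 bab (word a b (i, j)) +
   chi_z card_G gen_G a8 b2 bab (word a b (i, j))).
rewrite chi_y_word chi_z_word /word rep_homM !rep_power ra rb.
rewrite addrC [neg_hom_fun _ _]neg_hom_funM /neg_hom_fun !rmorphXn; congr (_ *m _).
have sq : (-1)%:M ^+ 2 = 1 :> 'M[R]_1 by rewrite -rmorphXn sqrrN expr1n rmorph1.
rewrite /= -(expr_mod i sq); congr (_ ^+ _).
by rewrite mul1n.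
Qed.

Variable r : orthogonal_rep R gT 4.
Hypothesis r4 : r (a ^+ 4)%g = - 1%:M.
Local Notation W := (sw w 4 r).

Lemma res_a_sw4 : res (inc_a a8) W = c8 ^+ 2.
Proof.
have W4 : in_degree 4 (res (inc_a a8) W) by apply/pull_degree/sw_in.
have [W0|->] := cyclic_span C8_cyclic W4; last by rewrite /cyclic_gen expr0 mul1r.
have := congr1 (res F2_C8) W0; rewrite rmorph0.
rewrite (@sw_res _ w _ _ (inc_a a8) 4 4 r (restrict_rep (inc_a a8) r)) //.
rewrite (@sw_res _ w _ _ F2_C8 4 4 _ (restrict_rep F2_C8 (restrict_rep (inc_a a8) r))) //.
rewrite sw_scalar => // [/eqP|x]; first by rewrite (negPf (tF2_power_neq0 4)).
rewrite -[LHS]/(r (a ^+ F2_C8 x)%g); have [->|->] := F2P x; first by rewrite rep_hom1.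
by rewrite -[LHS]/(r (a ^+ 4)%g) r4 expr1 raddfN.
Qed.

(** X^2 + X Y + Y^2 pulls back to z y + y^2 = y (y + z), because z^2 = 0. *)
Lemma modular_Sq : [/\ Sq 1 W = 0, Sq 2 W = W * y * (y + z) & Sq 3 W = 0].
Proof.
have [R1 R2 R3] := res_gam_rep_subgroups a8 b2 bab r4 w_universal.
have [|S1 S2 S3] := gam_squares _ R1 R2 R3; first exact: sw_in.
rewrite -(res_gam_rep card_G gen_G a8 b2 bab r4 w); split.
- by rewrite -pull_Sq S1 rmorph0.
- rewrite -pull_Sq S2 rmorphM !rmorphD !rmorphXn rmorphM /=.
  rewrite (@res_chi _ _ _ gam_y (chi_y card_G gen_G a8 b2 bab)) //.
  rewrite (@res_chi _ _ _ gam_x (chi_z card_G gen_G a8 b2 bab)) //.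
  rewrite -/z -/y mod_z_sqr add0r -mulrA; congr (_ * _).
  by rewrite mulrDr expr2 addrC (mulrC z y).
- by rewrite -pull_Sq S3 rmorph0.
Qed.

End StiefelWhitney.
End ModularRepresentations.

Theorem proposition1p2 (R : realType)
  (w : forall k : nat, nat -> cohomology (BO R k))
  (w_universal : stiefel_whitney w)
  (gT : finGroupType) (a b : gT)
  (card_G : #|gT| = 16%N)
  (gen_G : <<[set a; b]>>%g = [set: gT])
  (a8 : (a ^+ 8 = 1)%g) (b2 : (b ^+ 2 = 1)%g)
  (bab : (b * a * b^-1 = a ^+ 5)%g)
  (r2 r3 : orthogonal_rep R gT 1)
  (r2b : r2 b = (-1)%:M) (r3b : r3 b = (-1)%:M)
  (r23a : r2 a = 1%:M /\ r3 a = (-1)%:M \/ r2 a = (-1)%:M /\ r3 a = 1%:M)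
  (rho : mx_representation (complex R) [set: gT] 2)
  (rho_irr : mx_irreducible rho)
  (r8 : orthogonal_rep R gT 4)
  (r8_rho : mx_rsim r8 (realification rho))
  (r8_irr : mx_irreducible r8)
  (r8_complex : complex_type r8) :
  let u := sw w 1 r2 in
  let v := sw w 1 r3 in
  let w4 := sw w 4 r8 in
  let good_generator (x : cohomology (nerve gT)) :=
    [/\ in_degree 3 x, ~ sw_subring w x &
        presented_by (fun i : 'I_4 => [:: u; v; w4; x]`_i) sw_relations] in
  [/\ exists2 x, good_generator x & exists z y w', carlson_presentation z y x w',
      [/\ Sq 1 w4 = 0, Sq 2 w4 = w4 * u * v & Sq 3 w4 = 0] &
      forall z y x w', carlson_presentation z y x w' -> good_generator x].
Proof.
(* In the other case ab and b are generators with the same relations, as (ab)^2 = a^6; and r_2 (ab)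
   = 1, r_3 (ab) = -1. *)
wlog [r2a r3a] : a gen_G a8 bab r23a / r2 a = 1%:M /\ r3 a = (-1)%:M.
  move=> wlog_a; case: (r23a) => [//|[r2a r3a]]; first exact: (wlog_a a).
  have ba : (b * a = a ^+ 5 * b)%g by rewrite -bab mulgKV.
  have bb : (b * b = 1)%g by rewrite -expg2.
  have ab2 : ((a * b) ^+ 2 = a ^+ 6)%g.
    by rewrite expgS expg1 -mulgA (mulgA b) ba -!mulgA bb mulg1.
  have r2ab : r2 (a * b)%g = 1%:M by rewrite rep_homM r2a r2b -scalar_mxM mulrNN mulr1.
  have r3ab : r3 (a * b)%g = (-1)%:M by rewrite rep_homM r3a r3b -scalar_mxM mul1r.
  apply: (wlog_a (a * b)%g) => //; last by left.
  - apply/eqP; rewrite finset.eqEsubset finset.subsetT -gen_G gen_subG.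
    apply/fintype.subsetP => c; rewrite !inE => /orP[]/eqP ->; last by rewrite mem_gen ?set22.
    have : (a * b * b^-1)%g \in <<[set (a * b)%g; b]>>%g by rewrite groupM ?groupV // mem_gen ?set21 ?set22.
    by rewrite mulgK.
  - by rewrite (expgM _ 2 4) ab2 -expgM (expgM _ 8 3) a8 expg1n.
  - rewrite mulgA mulgK ba (expgD (a * b)%g 4 1) (expgM _ 2 2) ab2 -expgM (expgD _ 8 4) a8 mul1g expg1.
    by rewrite mulgA -expgSr.
(* a^4 acts by -1 on the complex representation, hence on its realification, and a similarity does
   not change a scalar matrix. *)
have r4 : r8 (a ^+ 4)%g = - 1%:M.
  case: r8_rho => B _ Bfree rB; apply: (row_free_inj Bfree).
  rewrite rB ?inE // -[realification rho _]/(realify (rho (a ^+ 4)%g)).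
  by rewrite (irr_a4 gen_G a8 b2 bab rho_irr) realifyN1 mulmxN mulmx1 mulNmx mul1mx.
move=> u v w4.
have W4 : in_degree 4 w4 by exact: sw_in.
have WE := res_a_sw4 a8 w_universal r4.
have uE : u = mod_y card_G gen_G a8 b2 bab by exact: sw1_y.
have vE : v = mod_y card_G gen_G a8 b2 bab + mod_z card_G gen_G a8 b2 bab by exact: sw1_yz.
have good : [/\ in_degree 3 (mod_x card_G gen_G a8 b2 bab),
    ~ sw_subring w (mod_x card_G gen_G a8 b2 bab) &
    presented_by (fun i : 'I_4 => [:: u; v; w4; mod_x card_G gen_G a8 b2 bab]`_i) sw_relations].
  split; [exact: mod_x_degree | exact: (modular_not_sw W4 WE) |].
  by rewrite uE vE; exact: modular_sw_presentation.
split.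
- exists (mod_x card_G gen_G a8 b2 bab) => //.
  by exists (mod_z card_G gen_G a8 b2 bab), (mod_y card_G gen_G a8 b2 bab), w4; exact: modular_carlson.
- by rewrite uE vE; exact: modular_Sq.
- by move=> z y x w' /(carlson_x_unique card_G gen_G b2 bab W4 WE) ->.
Qed.
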